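(* Let $R\in(0,\infty]^d$ be a polyradius such that $\mathcal M$ is defined and non-zero on the open polydisc $D_R$. Let $f\colon\mathbb C^d\to\mathbb C$ be entire of exponential type strictly bounded by $R$, i.e. there exist $r\in[0,\infty)^d$ with $r<R$ and $C>0$ such that $|f(z)|\le C\exp(r\cdot|z|)$ for all $z\in\mathbb C^d$. Then the Borel transform $\mathcal Bf$ is defined and holomorphic on $E_r=\{\theta\in\mathbb C^d:|\theta_k|>r_k,\ k=1,\ldots,d\}$, and $f$ can be expanded in a series of Appell polynomials $$f(z)=\sum_K L_K(f)\frac{z^{\diamond K}}{K!},\qquad L_K(f)=\frac1{(2\pi i)^d}\int_{|\theta_1|=\rho_1}\cdots\int_{|\theta_d|=\rho_d}\theta^K\mathcal M(\theta)\,\mathcal Bf(\theta)\,d\theta_d\cdots d\theta_1,$$ for any $\rho$ with $r<\rho<R$ (the value of $L_K(f)$ being independent of $\rho$), and the series converges absolutely, both locally uniformly on compacts and in $L^1(\mu)$. Moreover, let $g$ be another entire function satisfying the same hypotheses with exponential type bounded by $r_g$ (that is, $|g(z)|\le C'\exp(r_g\cdot|z|)$), let $r_f=r$, assume $r_f+r_g<R$, and let $$f(x)=\sum_I a_I\frac{x^{\diamond I}}{I!},\qquad g(x)=\sum_J b_J\frac{x^{\diamond J}}{J!}$$ be their Appell expansions. Then the Wick product of $f$ and $g$, $$(f\diamond g)(x):=\sum_{I,J}a_Ib_J\frac{x^{\diamond(I+J)}}{I!\,J!},$$ is defined as an absolutely convergent series, both locally uniformly on compacts and in $L^1(\mu)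$.
   Context: $X$ is an $\mathbb R^d$-valued random variable with law $\mu$. Its moment-generating function is $\mathcal M(\theta)=\mathbb E\exp(\theta\cdot X)$, $\theta\in\mathbb C^d$. For $R\in(0,\infty]^d$, $D_R=\{\theta\in\mathbb C^d:|\theta_i|<R_i,\ i=1,\ldots,d\}$; ''$\mathcal M$ is defined on $D_R$'' means $\mathbb E\exp(q\cdot|X|)<\infty$ for all $q\in[0,\infty)^d$ with $q<R$, in which case $\mathcal M$ is holomorphic on $D_R$. Inequalities between vectors are entrywise, and $|z|=(|z_1|,\ldots,|z_d|)$ for $z\in\mathbb C^d$ inside expressions such as $r\cdot|z|$. Sums over $I,J,K$ range over all multiindices in $\mathbb N_0^d$; $K!=K_1!\cdots K_d!$, $\theta^K=\theta_1^{K_1}\cdots\theta_d^{K_d}$, $\partial_K=\partial_1^{K_1}\cdots\partial_d^{K_d}$, and $K+1$ is the multiindex with every entry increased by $1$. The Appell polynomials $z^{\diamond K}$ of $\mu$ are defined by $\dfrac{\exp(\theta\cdot z)}{\mathcal M(\theta)}=\sum_K\dfrac{z^{\diamond K}}{K!}\theta^K$ for $\theta$ near $0$. The Borel transform of an entire function $f$ is the Laurent series $\mathcal Bf(z)=\sum_K\dfrac{\partial_Kf(0)}{z^{K+1}}$, wherever it converges. *)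

(* Defs.v *)
From HB Require Import structures.
From mathcomp Require Import all_boot all_order all_algebra finmap complex.
From mathcomp Require Import all_classical all_reals all_analysis.
From mathcomp Require summability.

Set Implicit Arguments.
Unset Strict Implicit.
Unset Printing Implicit Defensive.

Import Order.TTheory GRing.Theory Num.Theory.
Import numFieldNormedType.Exports.

Local Open Scope classical_set_scope.
Local Open Scope complex_scope.
Local Open Scope ring_scope.

(* The library puts the norm topology on a numFieldType [K] only through [K^o]
   or for an abstract [K]; this transfers it to the concrete type [R[i]], so
   that [differentiable] on ['rV[R[i]]_d] is complex differentiability. *)
HB.instance Definition _ (R : realType) := NormedModule.copy R[i] R[i]^o.

Notation normc := ComplexField.Normc.normc.

(* [partial_sum u @ totally --> l] is convergence of the net of finite partial
   sums, i.e. unconditional summability of [u] with sum [l]. *)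
Notation totally := summability.totally.
Notation partial_sum := summability.partial_sum.

Notation midx d := {ffun 'I_d -> nat}.

Definition midx_add d (I J : midx d) : midx d := [ffun i => (I i + J i)%N].

Definition midx_succ d (K : midx d) : midx d := [ffun i => (K i).+1].

Definition mfact d (K : midx d) : nat := (\prod_i (K i)`!)%N.

Section ComplexVectors.
Variables (R : realType) (d : nat).
Local Notation C := R[i].

Definition mpow (theta : 'rV[C]_d) (K : midx d) : C :=
  \prod_i theta 0 i ^+ K i.

Definition cexp (z : C) : C :=
  (expR (complex.Re z))%:C * (cos (complex.Im z) +i* sin (complex.Im z)).

(* Bilinear, without conjugation. *)
Definition dotc (theta z : 'rV[C]_d) : C := \sum_i theta 0 i * z 0 i.

Definition cvec (x : d.-tuple R) : 'rV[C]_d := \row_i (tnth x i)%:C.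

Definition polydisc (Rad : 'I_d -> \bar R) : set 'rV[C]_d :=
  [set theta | forall i, ((normc (theta 0 i))%:E < Rad i)%E].

Definition polyexterior (r : 'I_d -> R) : set 'rV[C]_d :=
  [set theta | forall i, r i < normc (theta 0 i)].

(* \partial_0^(K 0) (\partial_1^(K 1) ... f) *)
Definition mpartial (K : midx d) (f : 'rV[C]_d -> C) : 'rV[C]_d -> C :=
  foldr (fun i => iter (K i) (fun h z => 'D_(delta_mx 0 i) h z)) f (enum 'I_d).

End ComplexVectors.

Section ComplexIntegral.
Context (R : realType) (disp : measure_display) (T : measurableType disp).
Variable mu : {measure set T -> \bar R}.

Definition cintegral (D : set T) (f : T -> R[i]) : R[i] :=
  (\int[mu]_(x in D) complex.Re (f x)) +i* (\int[mu]_(x in D) complex.Im (f x)).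

Definition cintegrable (f : T -> R[i]) : Prop :=
  mu.-integrable setT (fun x => (complex.Re (f x))%:E) /\
  mu.-integrable setT (fun x => (complex.Im (f x))%:E).

End ComplexIntegral.

Section Contours.
Variables (R : realType) (d : nat).
Local Notation C := R[i].

(* \int_{|w| = rho} h(w) dw with w = rho exp(it), 0 <= t <= 2 pi. *)
Definition circle_integral (rho : R) (h : C -> C) : C :=
  cintegral (@lebesgue_measure R) `[0, 2 * pi] (fun t : R =>
    let w := rho%:C * cexp (0 +i* t) in h w * ((0 +i* 1) * w)).

Definition set_coord (theta : 'rV[C]_d) (i : 'I_d) (w : C) : 'rV[C]_d :=
  \row_j if j == i then w else theta 0 j.

(* The first coordinate is the outermost integral. The base point 0 is
   irrelevant, as every coordinate is integrated over. *)
Definition torus_integral (rho : 'I_d -> R) (h : 'rV[C]_d -> C) : C :=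
  foldr (fun i g theta =>
           circle_integral (rho i) (fun w => g (set_coord theta i w)))
        h (enum 'I_d) 0.

End Contours.

Section MomentGeneratingFunction.
Context (R : realType) (d : nat) (disp : measure_display)
        (T : measurableType disp) (P : probability T R).
Variable X : {RV P >-> d.-tuple R}.

Definition mgf (theta : 'rV[R[i]]_d) : R[i] :=
  cintegral P setT (fun w => cexp (dotc theta (cvec (X w)))).

Definition mgf_defined (Rad : 'I_d -> \bar R) : Prop :=
  forall q : 'I_d -> R, (forall i, 0 <= q i) ->
    (forall i, ((q i)%:E < Rad i)%E) ->
    ('E_P[fun w => expR (\sum_i q i * `|tnth (X w) i|)%R] < +oo)%E.

End MomentGeneratingFunction.

Section Convergence.
Context (R : realType) (I : choiceType).
Local Notation C := R[i].

Definition abs_summable (u : I -> C) : Prop :=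
  summable [set: I] (fun i => (normc (u i))%:E).

(* For every compact A, the series of sup norms over A converges, and the sum
   is [F], uniformly on A. *)
Definition abs_cvg_compacts (U : topologicalType) (u : I -> U -> C)
    (F : U -> C) : Prop :=
  (forall A : set U, compact A -> exists m : I -> R,
     (forall i z, A z -> normc (u i z) <= m i) /\
     summable [set: I] (fun i => (m i)%:E)) /\
  {family compact, (fun J z => partial_sum (u ^~ z) J) @ totally --> F}.

(* The series of L^1 norms converges, and the sum is [F] in L^1. *)
Definition abs_cvg_L1 (disp : measure_display) (T : measurableType disp)
    (mu : {measure set T -> \bar R}) (u : I -> T -> C) (F : T -> C) : Prop :=
  [/\ forall i, cintegrable mu (u i),
      cintegrable mu F,
      summable [set: I] (fun i => \int[mu]_x (normc (u i x))%:E)%E &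
      (fun J => \int[mu]_x (normc (F x - partial_sum (u ^~ x) J))%:E)%E
        @ totally --> 0%E].

End Convergence.

Section AppellExpansions.
Variables (R : realType) (d : nat).
Local Notation C := R[i].
Implicit Types (M f : 'rV[C]_d -> C) (a b : midx d -> C).

Definition is_appell M (A : midx d -> 'rV[C]_d -> C) : Prop :=
  forall z, \forall theta \near (0 : 'rV[C]_d),
    partial_sum (fun K => A K z / (mfact K)%:R * mpow theta K) @ totally
      --> cexp (dotc theta z) / M theta.

(* The family determined by its generating function. *)
Definition appell M : midx d -> 'rV[C]_d -> C := get (is_appell M).

Definition borel_term f (z : 'rV[C]_d) (K : midx d) : C :=
  mpartial K f 0 / mpow z (midx_succ K).

Definition borel f (z : 'rV[C]_d) : C := summability.sum (borel_term f z).

Definition appell_coef M (rho : 'I_d -> R) f (K : midx d) : C :=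
  (0 +i* (2 * pi)) ^- d *
  torus_integral rho (fun theta => mpow theta K * M theta * borel f theta).

Definition appell_series M a (K : midx d) (z : 'rV[C]_d) : C :=
  a K * (appell M K z / (mfact K)%:R).

Definition wick_series M a b (IJ : midx d * midx d) (z : 'rV[C]_d) : C :=
  a IJ.1 * b IJ.2 *
  (appell M (midx_add IJ.1 IJ.2) z / ((mfact IJ.1)%:R * (mfact IJ.2)%:R)).

Definition wick M a b (z : 'rV[C]_d) : C :=
  summability.sum (wick_series M a b ^~ z).

(* Entire, of exponential type bounded by [r], where 0 <= r < Rad. *)
Definition entire_exp_type (Rad : 'I_d -> \bar R) f (r : 'I_d -> R) : Prop :=
  [/\ forall z, differentiable f z,
      forall i, 0 <= r i,
      forall i, ((r i)%:E < Rad i)%E &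
      exists2 c : R, 0 < c &
        forall z, normc (f z) <= c * expR (\sum_i r i * normc (z 0 i))].

Definition between (r : 'I_d -> R) (rho : 'I_d -> R) (Rad : 'I_d -> \bar R) :=
  forall i, r i < rho i /\ ((rho i)%:E < Rad i)%E.

End AppellExpansions.

(* Main.v *)
Require Import Defs.
From HB Require Import structures.
From mathcomp Require Import all_boot all_order all_algebra finmap complex.
From mathcomp Require Import all_classical all_reals all_analysis.
From mathcomp Require Import measurable_realfun ring lra.
From mathcomp Require summability.

Set Implicit Arguments.
Unset Strict Implicit.
Unset Printing Implicit Defensive.

Import Order.TTheory GRing.Theory Num.Theory.
Import numFieldNormedType.Exports ComplexField.Normc.

Local Open Scope classical_set_scope.
Local Open Scope ring_scope.

(** The proof compares power series. For [r < rho < Rad], Cauchy's estimate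
[mpartial_bound] bounds the partial derivatives of [f] at [0] by a multiple of [rho ^ K],
which makes the Borel transform a convergent Laurent series that may be differentiated
term by term ([borel_differentiable]). The moment-generating function is the power
series with coefficients [m_J = E (X ^ J) / J!] ([mgf_has_ps]). In the contour integral
defining the coefficient [a_K], the product of the two series is integrated term by term
over the torus ([torus_integral_csum]), where only one monomial survives, and
[appell_coef_eq] finds
  [a_K = \sum_J m_J * \partial_(K + J) f (0)].
This does not involve the radii, which gives the independence of [rho], and it is bounded
by a multiple of [rho ^ K].

The function [th |-> exp (th . z) / M th] is holomorphic on the polydisc, so that it has a
power series with coefficients [p_K z], and by uniqueness of coefficients these are the
Appell polynomials divided by [K!] ([appellE]). A bound for [1 / M] on smaller polydiscs
gives [|p_K z| * s ^ K <= S * exp (s . |z|)] for [s < Rad] ([appell_coeff_bound]).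
Multiplying back by [M] shows that [\sum_(K + J = L) p_K z * m_J = z ^ L / L!]
([conv_appell_coeff]). Inserting this in Taylor's series of [f] and summing over [J]
first turns it into [\sum_K a_K * p_K z] ([appell_expansion]).

With [rho < s < Rad] the terms of this expansion are bounded by the geometric family
[(rho / s) ^ K] times [exp (s . |z|)]. The latter is bounded on compacts and integrable
for the law of [X], so that dominated convergence gives both modes of convergence
([abs_cvg_exp_type]). For the Wick product the radii of [f] and [g] may be chosen with sum
below [s], since the coefficients do not depend on them, and the factorials
[(I + J)! / (I! * J!)] are absorbed by the binomial theorem ([mfact_midx_add_le]).

Cauchy's theory is developed from complex differentiability. In one variable Goursat's
bisection, in polar coordinates around a point of the disc, yields Cauchy's formula and
from it the Taylor expansion. It extends to polydiscs one variable at a time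
([polydisc_expansion]). Sums over multiindices are unconditional, so that all
rearrangements are instances of summation over the fibres of a map ([csum_fiber]).
Differentiability of a series, as opposed to differentiability in each variable, comes
from summing bounds on the quadratic errors of its terms ([csum_has_grad]). *)

(** * The modulus of complex numbers *)

Local Open Scope complex_scope.

Section ComplexBasics.
Context {R : realType}.
Local Notation C := R[i].
Implicit Types z w : C.

Lemma normc_ge0 z : 0 <= normc z.
Proof. by case: z => a b; rewrite /normc sqrtr_ge0. Qed.

Lemma normcD z w : normc (z + w) <= normc z + normc w.
Proof. by rewrite -lecR rmorphD /=; exact: (@ler_normD _ R[i]). Qed.

Lemma normcN z : normc (- z) = normc z.
Proof. by case: z => a b /=; rewrite !sqrrN. Qed.

Lemma normc_norm z : `|z| = (normc z)%:C.
Proof. by case: z => a b; rewrite normc_def. Qed.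

Lemma normc_real (x : R) : normc x%:C = `|x|.
Proof. by rewrite /normc /= expr0n /= addr0 sqrtr_sqr. Qed.

Lemma normc_gt0 z : z != 0 -> 0 < normc z.
Proof.
by move=> z0; rewrite lt_def normc_ge0 andbT; apply: contra z0 => /eqP/eq0_normc->.
Qed.

Lemma normc_eq0 z : (normc z == 0) = (z == 0).
Proof. by apply/eqP/eqP => [/eq0_normc|->] //; rewrite normc0. Qed.

Lemma normcX z n : normc (z ^+ n) = normc z ^+ n.
Proof. by elim: n => [|n IH]; rewrite ?expr0 ?normc1 // !exprS normcM IH. Qed.

Lemma normcBC z w : normc (z - w) = normc (w - z).
Proof. by rewrite -normcN opprB. Qed.

Lemma normcB z w : normc z - normc w <= normc (z - w).
Proof. by have := normcD (z - w) w; rewrite subrK lerBlDr. Qed.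

Lemma normc_nat n : normc (n%:R : C) = n%:R.
Proof. by rewrite -(rmorph_nat (real_complex R)) normc_real normr_nat. Qed.

Lemma normc_prod (I : Type) (s : seq I) (P : pred I) (F : I -> C) :
  normc (\prod_(i <- s | P i) F i) = \prod_(i <- s | P i) normc (F i).
Proof. by elim/big_rec2 : _ => [|i x y _ <-]; rewrite ?normc1 ?normcM. Qed.

Lemma normc_sum (I : Type) (s : seq I) (P : pred I) (F : I -> C) :
  normc (\sum_(i <- s | P i) F i) <= \sum_(i <- s | P i) normc (F i).
Proof.
elim/big_rec2 : _ => [|i x y _ h]; first by rewrite normc0.
by rewrite (le_trans (normcD _ _)) // lerD2l.
Qed.

Lemma normc_Re z : `|complex.Re z| <= normc z.
Proof.
case: z => a b /=; rewrite -sqrtr_sqr ler_wsqrtr // lerDl; exact: sqr_ge0.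
Qed.

Lemma normc_Im z : `|complex.Im z| <= normc z.
Proof.
case: z => a b /=; rewrite -sqrtr_sqr ler_wsqrtr // lerDr; exact: sqr_ge0.
Qed.

Lemma normc_ReIm z : normc z <= `|complex.Re z| + `|complex.Im z|.
Proof.
case: z => a b /=; rewrite -[leRHS]ger0_norm ?addr_ge0 // -sqrtr_sqr ler_wsqrtr //.
rewrite sqrrD !real_normK ?num_real // -addrA lerD2l lerDr.
by rewrite mulrn_wge0 // mulr_ge0.
Qed.

Lemma cReD z w : complex.Re (z + w) = complex.Re z + complex.Re w.
Proof. by case: z; case: w. Qed.
Lemma cImD z w : complex.Im (z + w) = complex.Im z + complex.Im w.
Proof. by case: z; case: w. Qed.
Lemma cReB z w : complex.Re (z - w) = complex.Re z - complex.Re w.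
Proof. by case: z; case: w. Qed.
Lemma cImB z w : complex.Im (z - w) = complex.Im z - complex.Im w.
Proof. by case: z; case: w. Qed.
Lemma cReM z w : complex.Re (z * w) =
  complex.Re z * complex.Re w - complex.Im z * complex.Im w.
Proof. by case: z; case: w. Qed.
Lemma cImM z w : complex.Im (z * w) =
  complex.Re z * complex.Im w + complex.Im z * complex.Re w.
Proof. by case: z; case: w. Qed.
Lemma Re_sum (I : Type) (s : seq I) (P : pred I) (F : I -> C) :
  complex.Re (\sum_(i <- s | P i) F i) = \sum_(i <- s | P i) complex.Re (F i).
Proof. by elim/big_rec2 : _ => // i x y _ <-; rewrite cReD. Qed.
Lemma Im_sum (I : Type) (s : seq I) (P : pred I) (F : I -> C) :
  complex.Im (\sum_(i <- s | P i) F i) = \sum_(i <- s | P i) complex.Im (F i).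
Proof. by elim/big_rec2 : _ => // i x y _ <-; rewrite cImD. Qed.

Lemma cvg_normcP (T : Type) (F : set_system T) {FF : Filter F} (f : T -> C) l :
  (f @ F --> l) <-> (forall e : R, 0 < e -> \forall x \near F, normc (f x - l) < e).
Proof.
split.
  move=> /cvgrPdist_lt fl e e0.
  have e0' : 0 < e%:C by rewrite ltcR.
  apply: filterS (fl _ e0') => x.
  by rewrite normc_norm ltcR normcBC.
move=> fl; apply/cvgrPdist_lt => e e0.
have [e1 ee] : exists e1 : R, e = e1%:C.
  by apply/complex_realP; exact: gtr0_real.
move: e0; rewrite {}ee ltcR => e0.
apply: filterS (fl _ e0) => x.
by rewrite normc_norm ltcR normcBC.
Qed.

Lemma nbhs_normcP (z : C) (A : set C) :
  nbhs z A <-> exists2 e : R, 0 < e & forall w, normc (w - z) < e -> A w.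
Proof.
split.
  move=> /nbhs_ballP[e /= e0 eA].
  have [e1 ee] : exists e1 : R, e = e1%:C.
    by apply/complex_realP; exact: gtr0_real.
  exists e1; first by move: e0; rewrite ee ltcR.
  move=> w wz; apply: eA; rewrite -ball_normE /ball_ /= ee normc_norm ltcR.
  by rewrite normcBC.
move=> [e e0 eA]; apply/nbhs_ballP; exists e%:C; first by rewrite /= ltcR.
move=> w; rewrite -ball_normE /ball_ /= normc_norm ltcR normcBC; exact: eA.
Qed.

End ComplexBasics.

(** * Unconditional sums of complex families *)

Existing Instance summability.totally_filter.

Section Summation.
Context {R : realType}.
Local Notation C := R[i].
Section OneFamily.
Context {I : choiceType}.
Implicit Types (u v : I -> C) (J : {fset I}).

Lemma partial_sumE u J : partial_sum u J = \sum_(i <- J) u i.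
Proof. by rewrite /summability.partial_sum [RHS]big_seq_fsetE. Qed.

Lemma has_csumP u (l : C) : (partial_sum u @ totally --> l) <->
  (forall e : R, 0 < e -> exists J0 : {fset I}, forall J, (J0 `<=` J)%fset ->
     normc (\sum_(i <- J) u i - l) < e).
Proof.
rewrite cvg_normcP; split => h e /h.
  by move=> [J0 _ J0h]; exists J0 => J /J0h; rewrite /= partial_sumE.
by move=> [J0 J0h]; exists J0 => // J /= /J0h; rewrite partial_sumE.
Qed.

Lemma abs_summableP u : abs_summable u <->
  exists B : R, forall J, \sum_(i <- J) normc (u i) <= B.
Proof.
rewrite /abs_summable summableE; split.
  rewrite ge0_fin_numE; last by apply: esum_ge0 => i _; exact: normr_ge0.
  move=> h.
  pose S := (\esum_(i in [set: I]) `|(normc (u i))%:E|)%E.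
  exists (fine S) => J.
  rewrite -lee_fin fineK; last first.
    by rewrite ge0_fin_numE //; apply: esum_ge0 => i _; exact: normr_ge0.
  apply: ereal_sup_ubound => /=; exists [set` J]; first by split.
  rewrite fsbig_finite //= set_fsetK -sumEFin.
  by apply: eq_bigr => i _; rewrite ger0_norm ?normc_ge0.
move=> [B hB]; rewrite ge0_fin_numE; last by apply: esum_ge0 => i _; exact: normr_ge0.
apply: (@le_lt_trans _ _ B%:E); last by rewrite ltry.
apply: ge_ereal_sup => _ [A [fA _] <-].
rewrite fsbig_finite //=.
under eq_bigr do rewrite ger0_norm ?normc_ge0 //.
by rewrite sumEFin lee_fin.
Qed.

Lemma fset_sum_subset (m : I -> R) (J J' : {fset I}) : (forall i, 0 <= m i) ->
  (J `<=` J')%fset -> \sum_(i <- J) m i <= \sum_(i <- J') m i.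
Proof.
move=> m0 JJ'; rewrite [leRHS](big_fsetID _ (mem J)) /=.
rewrite (_ : [fset x | x in J' & x \in J]%fset = J); first by rewrite lerDl sumr_ge0.
by apply/fsetP => i; rewrite !inE /= andbC; case: (boolP (i \in J)) => // /(fsubsetP JJ') ->.
Qed.

(** The supremum of the finite partial sums is the sum of a nonnegative family. *)
Lemma nonneg_sum_sup (m : I -> R) B : (forall i, 0 <= m i) ->
  (forall J, \sum_(i <- J) m i <= B) ->
  exists s : R, forall e : R, 0 < e -> exists J0 : {fset I}, forall J, (J0 `<=` J)%fset ->
     `|\sum_(i <- J) m i - s| < e.
Proof.
move=> m0 mB; pose S := [set \sum_(i <- J) m i | J in [set: {fset I}]].
have hS : has_sup S.
  split; first by exists (\sum_(i <- fset0 : {fset I}) m i), fset0.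
  by exists B => _ [J _ <-].
exists (sup S) => e e0.
have [_ [J0 _ <-] h] := sup_adherent e0 hS.
exists J0 => J J0J; rewrite distrC ger0_norm.
  by rewrite ltrBlDr -ltrBlDl (lt_le_trans h) // fset_sum_subset.
rewrite subr_ge0; apply: ub_le_sup; first by case: hS.
by exists J.
Qed.

(** [x = (|x| + x) - |x|] is a difference of nonnegative families. *)
Lemma real_abs_sum (x : I -> R) B :
  (forall J, \sum_(i <- J) `|x i| <= B) ->
  exists s : R, forall e : R, 0 < e -> exists J0 : {fset I}, forall J, (J0 `<=` J)%fset ->
     `|\sum_(i <- J) x i - s| < e.
Proof.
move=> xB.
have [s1 h1] := nonneg_sum_sup (fun i => normr_ge0 (x i)) xB.
have p0 i : 0 <= `|x i| + x i by have := ler_norm (- x i); rewrite normrN; lra.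
have pB J : \sum_(i <- J) (`|x i| + x i) <= B + B.
  rewrite big_split lerD //=; apply: le_trans (xB J); apply: ler_sum => i _.
  exact: ler_norm.
have [s2 h2] := nonneg_sum_sup p0 pB.
exists (s2 - s1) => e e0.
have e2 : 0 < e / 2 by rewrite divr_gt0.
have [J1 H1] := h1 _ e2; have [J2 H2] := h2 _ e2.
exists (J1 `|` J2)%fset => J; rewrite fsubUset => /andP[/H1 a /H2 b].
move: b; rewrite big_split /= => b.
rewrite (splitr e); set A := \sum_(i <- J) `|x i| in a b *.
rewrite [X in `|X|](_ : _ = (A + \sum_(i <- J) x i - s2) - (A - s1)); last by ring.
by rewrite (le_lt_trans (ler_normB _ _)) // ltrD.
Qed.

Lemma abs_summable_bounded u : abs_summable u ->
  exists2 B : R, 0 <= B & forall J, \sum_(i <- J) normc (u i) <= B.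
Proof.
move=> /abs_summableP[B uB]; exists B => //.
by apply: le_trans (uB fset0); rewrite big_seq_fset0.
Qed.

Lemma abs_summable_le u (m : I -> R) B : (forall i, normc (u i) <= m i) ->
  (forall J, \sum_(i <- J) m i <= B) -> abs_summable u.
Proof.
move=> um mB; apply/abs_summableP; exists B => J.
by apply: le_trans (mB J); apply: ler_sum => i _.
Qed.

Lemma abs_summable_has_csum u : abs_summable u ->
  exists l : C, partial_sum u @ totally --> l.
Proof.
move=> /abs_summableP[B uB].
have [|a ha] := @real_abs_sum (fun i => complex.Re (u i)) B.
  by move=> J; apply: le_trans (uB J); apply: ler_sum => i _; exact: normc_Re.
have [|b hb] := @real_abs_sum (fun i => complex.Im (u i)) B.
  by move=> J; apply: le_trans (uB J); apply: ler_sum => i _; exact: normc_Im.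
exists (a +i* b); apply/has_csumP => e e0.
have e2 : 0 < e / 2 by rewrite divr_gt0.
have [J1 H1] := ha _ e2; have [J2 H2] := hb _ e2.
exists (J1 `|` J2)%fset => J; rewrite fsubUset => /andP[/H1 h1 /H2 h2].
by rewrite (le_lt_trans (normc_ReIm _)) // (splitr e) cReB cImB Re_sum Im_sum ltrD.
Qed.

Lemma has_csum_eq u (l : C) : partial_sum u @ totally --> l -> summability.sum u = l.
Proof. by move=> ul; exact: (cvg_lim (@norm_hausdorff _ _) ul). Qed.

Lemma csumP u : abs_summable u -> partial_sum u @ totally --> summability.sum u.
Proof. by move=> /abs_summable_has_csum[l ul]; rewrite (has_csum_eq ul). Qed.

End OneFamily.
End Summation.

Section SummationRules.
Context {R : realType}.
Local Notation C := R[i].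
Local Notation csum := summability.sum.

Section Rules.
Context {I : choiceType}.
Implicit Types (u v : I -> C) (J : {fset I}).

Lemma abs_summableD u v : abs_summable u -> abs_summable v ->
  abs_summable (fun i => u i + v i).
Proof.
move=> /abs_summableP[A uA] /abs_summableP[B vB].
apply: (@abs_summable_le _ _ _ (fun i => normc (u i) + normc (v i)) (A + B)) => [i|J].
  exact: normcD.
by rewrite big_split lerD /=.
Qed.

Lemma abs_summableZ c u : abs_summable u -> abs_summable (fun i => c * u i).
Proof.
move=> /abs_summableP[A uA].
apply: (@abs_summable_le _ _ _ (fun i => normc c * normc (u i)) (normc c * A)) => [i|J].
  by rewrite normcM.
by rewrite -mulr_sumr ler_wpM2l ?normc_ge0.
Qed.

Lemma abs_summable_dom u v : (forall i, normc (u i) <= normc (v i)) ->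
  abs_summable v -> abs_summable u.
Proof. by move=> uv /abs_summableP[B]; exact: abs_summable_le. Qed.

Lemma abs_summable_mkcond u (p : pred I) : abs_summable u ->
  abs_summable (fun i => if p i then u i else 0).
Proof.
by apply: abs_summable_dom => i; case: ifP; rewrite ?normc0 ?normc_ge0.
Qed.

Lemma csumD u v : abs_summable u -> abs_summable v ->
  csum (fun i => u i + v i) = csum u + csum v.
Proof.
move=> su sv; apply: has_csum_eq.
rewrite (_ : partial_sum _ = fun J => partial_sum u J + partial_sum v J).
  by apply: cvgD; exact: csumP.
by apply/funext => J; rewrite !partial_sumE big_split.
Qed.

Lemma csumZ c u : abs_summable u -> csum (fun i => c * u i) = c * csum u.
Proof.
move=> su; apply: has_csum_eq.
rewrite (_ : partial_sum _ = fun J => c * partial_sum u J).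
  by apply: cvgM; [exact: cvg_cst|exact: csumP].
by apply/funext => J; rewrite !partial_sumE mulr_sumr.
Qed.

Lemma csumB u v : abs_summable u -> abs_summable v ->
  csum (fun i => u i - v i) = csum u - csum v.
Proof.
move=> su sv; rewrite -[- csum v]mulN1r -csumZ // -csumD //; last exact: abs_summableZ.
by congr csum; apply/funext => i; rewrite mulN1r.
Qed.

Lemma csum_le u B : (forall J, \sum_(i <- J) normc (u i) <= B) -> normc (csum u) <= B.
Proof.
move=> uB; have su : abs_summable u by apply/abs_summableP; exists B.
apply/ler_addgt0Pr => e e0.
have [J0 /(_ _ (fsubset_refl _)) h] := (has_csumP _ _).1 (csumP su) e e0.
have := normcB (csum u) (\sum_(i <- J0) u i).
have := uB J0; have := normc_sum (enum_fset J0) xpredT u; rewrite normcBC in h; lra.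
Qed.

(** Finite sums of moduli that are both close to their supremum differ by little. *)
Lemma abs_summable_tail u : abs_summable u -> forall e : R, 0 < e ->
  exists J0 : {fset I}, forall J, [disjoint J & J0]%fset -> \sum_(i <- J) normc (u i) < e.
Proof.
move=> /abs_summableP[B uB] e e0.
have [s hs] := nonneg_sum_sup (fun i => normc_ge0 (u i)) uB.
have e2 : 0 < e / 2 by rewrite divr_gt0.
have [J0 H] := hs _ e2; exists J0 => J JJ0.
have h0 := H _ (fsubset_refl J0).
have := H _ (fsubsetUl J0 J); rewrite (big_fsetID _ (mem J0)) /=.
rewrite (_ : [fset x in (J0 `|` J) | x \in J0]%fset = J0); last first.
  by apply/fsetP => i; rewrite !inE /=; case: (i \in J0); rewrite ?andbF.
rewrite (_ : [fset x in (J0 `|` J) | x \notin J0]%fset = J); last first.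
  apply/fsetP => i; rewrite !inE /=; case: (boolP (i \in J0)) => //= iJ0.
    by apply/esym/negbTE; apply: contraL iJ0 => /(fdisjointP JJ0).
  by rewrite andbT.
move: h0; rewrite !ltr_norml => /andP[a1 a2] /andP[b1 b2]; lra.
Qed.

Lemma csum_fset u J : csum (fun i => if i \in J then u i else 0) = \sum_(i <- J) u i.
Proof.
apply: has_csum_eq; apply/has_csumP => e e0; exists J => J' JJ'.
rewrite (_ : \sum_(i <- J') _ = \sum_(i <- J) u i) ?subrr ?normc0 //.
rewrite -big_mkcond /= [RHS]big_seq_cond /=.
rewrite -big_filter -[RHS]big_filter; apply: perm_big.
apply: uniq_perm; rewrite ?filter_uniq // => i.
rewrite !mem_filter /= andbT andb_idr.
  by rewrite andb_idr // => /(fsubsetP JJ').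
by move=> /(fsubsetP JJ').
Qed.

Lemma csum1 u i0 : csum (fun i => if i == i0 then u i else 0) = u i0.
Proof.
rewrite (_ : u i0 = \sum_(i <- [fset i0]%fset) u i); last by rewrite big_seq_fset1.
rewrite -csum_fset.
by congr csum; apply/funext => i; rewrite inE.
Qed.

Lemma csum_sum (K : Type) (s : seq K) (P : pred K) (w : K -> I -> C) :
  (forall k, abs_summable (w k)) ->
  abs_summable (fun i => \sum_(k <- s | P k) w k i) /\
  csum (fun i => \sum_(k <- s | P k) w k i) = \sum_(k <- s | P k) csum (w k).
Proof.
move=> sw; elim: s => [|k s [IH1 IH2]].
  have s0 : abs_summable (fun i : I => \sum_(k <- [::] | P k) w k i).
    apply: (@abs_summable_le _ _ _ (fun=> 0) 0) => [i|J]; first by rewrite big_nil normc0.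
    by rewrite big1.
  split=> //; rewrite big_nil; apply/eqP; rewrite -normc_eq0 eq_le normc_ge0 andbT.
  by apply: csum_le => J; rewrite big1 // => i _; rewrite big_nil normc0.
case: (boolP (P k)) => Pk.
  split; last first.
    rewrite big_cons Pk -IH2 -csumD //; congr csum; apply/funext => i.
    by rewrite big_cons Pk.
  rewrite (_ : (fun i => _) = fun i => w k i + \sum_(k <- s | P k) w k i).
    exact: abs_summableD.
  by apply/funext => i; rewrite big_cons Pk.
rewrite (_ : (fun i => _) = fun i => \sum_(k <- s | P k) w k i).
  by split=> //; rewrite big_cons (negbTE Pk).
by apply/funext => i; rewrite big_cons (negbTE Pk).
Qed.

End Rules.

Section Fibers.
Context {I K : choiceType} (phi : I -> K).
Implicit Type u : I -> C.

Let fiber u k := csum (fun i => if phi i == k then u i else 0).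

Let fiber_fset u (J : {fset K}) : abs_summable u ->
  \sum_(k <- J) fiber u k = csum (fun i => if phi i \in J then u i else 0).
Proof.
move=> su.
have [_ <-] := @csum_sum I K (enum_fset J) xpredT
  (fun k i => if phi i == k then u i else 0)
  (fun k => @abs_summable_mkcond _ u (fun i => phi i == k) su).
congr csum; apply/funext => i.
case: (boolP (phi i \in J)) => iJ.
  rewrite (bigD1_seq (phi i)) //= eqxx big1 ?addr0 // => k /negbTE.
  by rewrite eq_sym => ->.
rewrite big_seq_cond big1 // => k /andP[kJ _]; case: eqP => // e.
by rewrite e kJ in iJ.
Qed.

(** Rotating the terms of each fibre so that its sum becomes nonnegative reduces
this to the bound on a single sum. *)
Lemma abs_summable_fiber u : abs_summable u -> abs_summable (fiber u).
Proof.
move=> su; have [B B0 uB] := abs_summable_bounded su.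
pose l k := if fiber u k == 0 then 1 else (normc (fiber u k))%:C / fiber u k.
have l1 k : normc (l k) = 1.
  rewrite /l; case: eqP => [_|/eqP h]; first by rewrite normc1.
  by rewrite normcM normcV normc_real ger0_norm ?normc_ge0 // mulfV // normc_eq0.
have lf k : l k * fiber u k = (normc (fiber u k))%:C.
  rewrite /l; case: eqP => [->|/eqP h]; first by rewrite mulr0 normc0.
  by rewrite divfK.
pose v i := l (phi i) * u i.
have vB (J : {fset I}) : \sum_(i <- J) normc (v i) <= B.
  by apply: le_trans (uB J); apply: ler_sum => i _; rewrite normcM l1 mul1r.
have sv : abs_summable v by apply/abs_summableP; exists B.
have fv k : fiber v k = (normc (fiber u k))%:C.
  rewrite -lf /fiber -csumZ; last exact: (@abs_summable_mkcond _ _ (fun i => phi i == k)).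
  by congr csum; apply/funext => i; rewrite /v; case: eqP => [->|]; rewrite ?mulr0.
apply/abs_summableP; exists B => J.
have : normc (\sum_(k <- J) fiber v k) <= B.
  rewrite fiber_fset //; apply: csum_le => J'; apply: le_trans (vB J').
  by apply: ler_sum => i _; case: ifP => //; rewrite normc0 normc_ge0.
under eq_bigr do rewrite fv.
rewrite -rmorph_sum normc_real ger0_norm // sumr_ge0 // => i _; exact: normc_ge0.
Qed.

(** A finite union of fibres that covers a large finite set of indices misses only
a small tail. *)
Lemma csum_fiber u : abs_summable u -> csum (fiber u) = csum u.
Proof.
move=> su; apply: has_csum_eq; apply/has_csumP => e e0.
have e2 : 0 < e / 2 by rewrite divr_gt0.
have [J0 hJ0] := abs_summable_tail su e2.
exists (phi @` J0)%fset => J JJ0.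
rewrite fiber_fset // -csumB //;
  last exact: (@abs_summable_mkcond _ _ (fun i => phi i \in J)).
apply: (@le_lt_trans _ _ (e / 2)); last by rewrite ltr_pdivrMr // ltr_pMr // ltr1n.
apply: csum_le => J'.
rewrite (_ : \sum_(i <- J') _ = \sum_(i <- [fset i in J' | phi i \notin J]%fset) normc (u i)).
  apply/ltW/hJ0; apply/fdisjointP => i; rewrite !inE => /andP[_]; apply: contra => iJ0.
  by apply: (fsubsetP JJ0); exact: in_imfset.
rewrite -big_fset_condE [RHS]big_mkcond /=; apply: eq_bigr => i _.
by case: ifP => /=; rewrite ?subrr ?normc0 // sub0r normcN.
Qed.

End Fibers.

End SummationRules.

Section SummationTools.
Context {R : realType}.
Local Notation C := R[i].
Local Notation csum := summability.sum.

Lemma csum0 (I : choiceType) : csum (fun _ : I => 0 : C) = 0.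
Proof.
have := csum_fset (fun _ : I => 0 : C) fset0; rewrite big_seq_fset0 => {2}<-.
by congr csum; apply/funext => i; rewrite inE.
Qed.

Lemma csum_approx (I : choiceType) (u : I -> C) (J0 : {fset I}) e : abs_summable u ->
  (forall J : {fset I}, [disjoint J & J0]%fset -> \sum_(i <- J) normc (u i) <= e) ->
  normc (csum u - \sum_(i <- J0) u i) <= e.
Proof.
move=> su ue; rewrite -csum_fset -csumB //;
  last exact: (@abs_summable_mkcond _ _ _ (fun i => i \in J0)).
apply: csum_le => J.
rewrite (_ : \sum_(i <- J) _ = \sum_(i <- [fset i in J | i \notin J0]%fset) normc (u i)).
  by apply/ue/fdisjointP => i; rewrite !inE => /andP[].
rewrite -big_fset_condE [RHS]big_mkcond /=; apply: eq_bigr => i _.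
by case: ifP => /=; rewrite ?subrr ?normc0 // subr0.
Qed.

Lemma csum_reindex (I K : choiceType) (h : K -> I) (u : I -> C) : injective h ->
  (forall i, (forall k, h k <> i) -> u i = 0) -> abs_summable (fun k => u (h k)) ->
  abs_summable u /\ csum u = csum (fun k => u (h k)).
Proof.
move=> hI u0 su.
have fE i : csum (fun k => if h k == i then u (h k) else 0) = u i.
  case: (pselect (exists k, h k = i)) => [[k <-]|nk].
    rewrite -(csum1 (fun k => u (h k)) k); congr csum; apply/funext => k'.
    by rewrite (inj_eq hI).
  rewrite u0; last by move=> k hk; apply: nk; exists k.
  rewrite -[RHS](@csum0 K); congr csum; apply/funext => k.
  by case: eqP => // hk; case: nk; exists k.
have := abs_summable_fiber h su; have := csum_fiber h su.
by rewrite (_ : (fun _ => _) = u) //; apply/funext => i; exact: fE.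
Qed.

Lemma fset_sum_pair (I K : choiceType) (m : I * K -> R) B : (forall p, 0 <= m p) ->
  (forall (J1 : {fset I}) (J2 : {fset K}),
     \sum_(i <- J1) \sum_(k <- J2) m (i, k) <= B) ->
  forall J : {fset I * K}, \sum_(p <- J) m p <= B.
Proof.
move=> m0 mB J.
pose J1 := [fset p.1 | p in J]%fset; pose J2 := [fset p.2 | p in J]%fset.
apply: le_trans (mB J1 J2); rewrite pair_big_dep_cond /=.
under [leRHS]eq_bigr do rewrite -surjective_pairing.
apply: fset_sum_subset => //; apply/fsubsetP => -[i k] ik.
apply/imfset2P; exists i => /=.
  by rewrite !inE /= andbT; apply/imfsetP; exists (i, k).
by exists k => //; rewrite !inE /= andbT; apply/imfsetP; exists (i, k).
Qed.

Lemma csum_mul (I K : choiceType) (u : I -> C) (v : K -> C) :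
  abs_summable u -> abs_summable v ->
  abs_summable (fun p : I * K => u p.1 * v p.2) /\
  csum (fun p : I * K => u p.1 * v p.2) = csum u * csum v.
Proof.
move=> su sv.
have sp : abs_summable (fun p : I * K => u p.1 * v p.2).
  have [A A0 uA] := abs_summable_bounded su; have [B B0 vB] := abs_summable_bounded sv.
  apply/abs_summableP; exists (A * B); apply: fset_sum_pair => [p|J1 J2].
    exact: normc_ge0.
  under eq_bigr do under eq_bigr do rewrite /= normcM.
  under eq_bigr do rewrite -mulr_sumr.
  rewrite -mulr_suml ler_pM // ?sumr_ge0 // => i _; exact: normc_ge0.
split=> //; rewrite -(csum_fiber (fun p : I * K => p.1) sp) mulrC -csumZ //.
congr csum; apply/funext => i; rewrite mulrC -csumZ //.
have sk : abs_summable (fun k => u i * v k) by exact: abs_summableZ.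
have := @csum_reindex (I * K)%type K (pair i)
  (fun p => if p.1 == i then u p.1 * v p.2 else 0).
rewrite /= eqxx => H; apply H => //.
  by move=> k k' [].
by move=> [i' k] h; case: eqP => //= e; case: (h k); rewrite e.
Qed.

Lemma fset_nat_bounded (J : {fset nat}) : exists N, forall n, n \in J -> (n < N)%N.
Proof.
exists (\max_(n <- J) n).+1 => n nJ; rewrite ltnS.
by rewrite (big_rem n) //= leq_maxl.
Qed.

Lemma fset_nat_sum_le (m : nat -> R) (J : {fset nat}) : (forall n, 0 <= m n) ->
  exists N, \sum_(n <- J) m n <= \sum_(n < N) m n.
Proof.
move=> m0; have [N hN] := fset_nat_bounded J; exists N.
rewrite (_ : \sum_(n < N) _ = \sum_(n <- [fset val n | n in 'I_N]%fset) m n).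
  apply: fset_sum_subset => //; apply/fsubsetP => n nJ; apply/imfsetP => /=.
  by exists (Ordinal (hN _ nJ)).
by rewrite big_imfset /= ?big_enum // => x y _ _; exact: val_inj.
Qed.

Lemma abs_summable_nat (u : nat -> C) B :
  (forall N, \sum_(n < N) normc (u n) <= B) -> abs_summable u.
Proof.
move=> uB; apply/abs_summableP; exists B => J.
have [N h] := fset_nat_sum_le J (fun n => normc_ge0 (u n)).
exact: le_trans h (uB N).
Qed.

Lemma csum_nat (u : nat -> C) : abs_summable u ->
  (fun N => \sum_(n < N) u n) @ \oo --> csum u.
Proof.
move=> su; apply/cvg_normcP => e e0.
have [J0 hJ0] := (has_csumP _ _).1 (csumP su) e e0.
have [N0 hN0] := fset_nat_bounded J0.
exists N0 => // N /= N0N.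
have := hJ0 [fset val n | n in 'I_N]%fset.
rewrite big_imfset /= ?big_enum; last by move=> x y _ _; exact: val_inj.
apply; apply/fsubsetP => n nJ; apply/imfsetP => /=.
by exists (Ordinal (leq_trans (hN0 _ nJ) N0N)).
Qed.

(** A finite set of multiindices is contained in a cube, over which the sum of the
products is the product of the sums. *)
Lemma midx_sum_prod d (g : 'I_d -> nat -> R) (G : 'I_d -> R) :
  (forall i n, 0 <= g i n) -> (forall i N, \sum_(n < N) g i n <= G i) ->
  forall J : {fset midx d}, \sum_(K <- J) \prod_i g i (K i) <= \prod_i G i.
Proof.
move=> g0 gG J.
pose N := (\max_(K <- J) \max_i K i).+1.
pose e (K : {ffun 'I_d -> 'I_N}) : midx d := [ffun i => val (K i)].
have eI : injective e.
  by move=> x y /ffunP exy; apply/ffunP => i; apply/val_inj; have := exy i; rewrite !ffunE.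
apply: (@le_trans _ _ (\sum_(K <- [fset e K | K in {ffun 'I_d -> 'I_N}]%fset)
    \prod_i g i (K i))).
  apply: fset_sum_subset => [K|]; first exact: prodr_ge0.
  apply/fsubsetP => K KJ; apply/imfsetP => /=.
  have KN i : (K i < N)%N.
    rewrite ltnS (big_rem K) //= leq_max; apply/orP; left.
    by rewrite (bigD1 i) //= leq_maxl.
  by exists [ffun i => Ordinal (KN i)] => //; apply/ffunP => i; rewrite !ffunE.
rewrite big_imfset /= ?big_enum //=; last by move=> x y _ _; exact: eI.
under eq_bigr do under eq_bigr do rewrite ffunE.
rewrite -(bigA_distr_bigA (fun i (n : 'I_N) => g i n)) /=.
by apply: ler_prod => i _; rewrite gG andbT sumr_ge0.
Qed.

(** Tannery's theorem: a finite set of indices carries all of the sums up to a small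
error that is uniform along the filter. *)
Lemma csum_dominated (T : Type) (F : set_system T) (FF : ProperFilter F)
    (I : choiceType) (a : T -> I -> C) (l : I -> C) (m : I -> R) B :
  (forall i, 0 <= m i) ->
  (forall J : {fset I}, \sum_(i <- J) m i <= B) ->
  (forall t i, normc (a t i) <= m i) -> (forall i, a ^~ i @ F --> l i) ->
  (forall i, normc (l i) <= m i) ->
  (fun t => csum (a t)) @ F --> csum l.
Proof.
move=> m0 mB am al lm.
have sm : abs_summable (fun i => (m i)%:C).
  by apply: abs_summable_le mB => i; rewrite normc_real ger0_norm.
apply/cvg_normcP => e e0; have e4 : 0 < e / 4 by rewrite divr_gt0.
have [J0 hJ0] := abs_summable_tail sm e4.
have hJ (v : I -> C) : (forall i, normc (v i) <= m i) ->
    normc (csum v - \sum_(i <- J0) v i) <= e / 4.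
  move=> vm; apply: csum_approx => [|J /hJ0 /ltW]; first exact: abs_summable_le vm mB.
  apply: le_trans; apply: ler_sum => i _; by rewrite normc_real ger0_norm.
have : (fun t => \sum_(i <- J0) a t i) @ F --> \sum_(i <- J0) l i.
  elim: (enum_fset J0) => [|i s IH].
    rewrite big_nil (_ : (fun t => _) = fun=> 0); first exact: cvg_cst.
    by apply/funext => t; rewrite big_nil.
  rewrite big_cons (_ : (fun t => _) = fun t => a t i + \sum_(j <- s) a t j).
    by apply: cvgD; [exact: al|exact: IH].
  by apply/funext => t; rewrite big_cons.
move/cvg_normcP => /(_ _ e4); apply: filterS => t ht.
have h1 := hJ _ (am t); have h2 := hJ _ lm; rewrite normcBC in h2.
set X := \sum_(i <- J0) a t i in ht h1; set Y := \sum_(i <- J0) l i in ht h2.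
rewrite (_ : csum (a t) - csum l = (csum (a t) - X) + ((X - Y) + (Y - csum l))); last by ring.
have := normcD (csum (a t) - X) ((X - Y) + (Y - csum l)).
have := normcD (X - Y) (Y - csum l); lra.
Qed.

End SummationTools.

(** * Integrals of complex functions on an interval *)

Section IntervalIntegral.
Context {R : realType}.
Local Notation C := R[i].
Local Notation mu := (@lebesgue_measure R).
Implicit Types (g h : R -> C) (a b : R).

Lemma cvg_ReIm (T : Type) (F : set_system T) {FF : Filter F} (f : T -> C) (l : C) :
  (f @ F --> l) <-> ((fun x => complex.Re (f x)) @ F --> complex.Re l) /\
                    ((fun x => complex.Im (f x)) @ F --> complex.Im l).
Proof.
rewrite cvg_normcP; split=> [h|[/cvgrPdist_lt h1 /cvgrPdist_lt h2] e e0].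
  split; apply/cvgrPdist_lt => e e0; apply: filterS (h e e0) => x; apply: le_lt_trans.
    by rewrite distrC -cReB normc_Re.
  by rewrite distrC -cImB normc_Im.
have e2 : 0 < e / 2 by rewrite divr_gt0.
move: (h1 _ e2) (h2 _ e2); apply: filterS2 => x a b.
rewrite (le_lt_trans (normc_ReIm _)) // (splitr e) cReB cImB ltrD // distrC //.
Qed.

Lemma continuous_Re (T : topologicalType) (g : T -> C) : continuous g ->
  continuous (fun t => complex.Re (g t)).
Proof. by move=> gc t; have [] := (cvg_ReIm _ _).1 (gc t). Qed.

Lemma continuous_Im (T : topologicalType) (g : T -> C) : continuous g ->
  continuous (fun t => complex.Im (g t)).
Proof. by move=> gc t; have [] := (cvg_ReIm _ _).1 (gc t). Qed.

Lemma ccont_cst (T : topologicalType) (c : C) : continuous (fun _ : T => c).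
Proof. by move=> t; exact: cvg_cst. Qed.

Lemma ccontM (T : topologicalType) (g h : T -> C) : continuous g -> continuous h ->
  continuous (fun t => g t * h t).
Proof. by move=> gc hc t; apply: (cvgM (gc t) (hc t)). Qed.

Lemma ccontD (T : topologicalType) (g h : T -> C) : continuous g -> continuous h ->
  continuous (fun t => g t + h t).
Proof. by move=> gc hc t; apply: (cvgD (gc t) (hc t)). Qed.

Lemma ccontB (T : topologicalType) (g h : T -> C) : continuous g -> continuous h ->
  continuous (fun t => g t - h t).
Proof. by move=> gc hc t; apply: (cvgB (gc t) (hc t)). Qed.

(** Locked, so that rewriting does not unfold integrals into real and imaginary parts. *)
Definition cint a b g : C := locked (cintegral mu `[a, b] g).

Lemma cintE a b g : cint a b g = cintegral mu `[a, b] g.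
Proof. by rewrite /cint -lock. Qed.

Lemma continuous_integrable (x : R -> R) a b : continuous x ->
  mu.-integrable `[a, b] (EFin \o x).
Proof.
move=> xc; apply: continuous_compact_integrable; first exact: segment_compact.
exact: continuous_subspaceT.
Qed.

Lemma eq_cint a b g h : (forall t, a <= t <= b -> g t = h t) -> cint a b g = cint a b h.
Proof.
move=> gh; rewrite !cintE /cintegral; congr (_ +i* _); apply: eq_Rintegral => t;
  by rewrite inE /= in_itv /= => /gh ->.
Qed.

Lemma RintD_cont a b (x y : R -> R) : continuous x -> continuous y ->
  \int[mu]_(t in `[a, b]) (x t + y t) =
  \int[mu]_(t in `[a, b]) x t + \int[mu]_(t in `[a, b]) y t.
Proof. by move=> xc yc; rewrite RintegralD //; exact: continuous_integrable. Qed.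

Lemma RintZ_cont a b c (x : R -> R) : continuous x ->
  \int[mu]_(t in `[a, b]) (c * x t) = c * \int[mu]_(t in `[a, b]) x t.
Proof. by move=> xc; rewrite RintegralZl //; exact: continuous_integrable. Qed.

Lemma continuousZ_real c (x : R -> R) : continuous x -> continuous (fun t => c * x t).
Proof. by move=> xc t; apply: cvgM; [exact: cvg_cst|exact: xc]. Qed.

Lemma cintD a b g h : continuous g -> continuous h ->
  cint a b (fun t => g t + h t) = cint a b g + cint a b h.
Proof.
move=> gc hc; apply/eqP; rewrite !cintE eq_complex cReD cImD; apply/andP; split; apply/eqP => /=.
  rewrite -(RintD_cont a b (continuous_Re gc) (continuous_Re hc)).
  by apply: eq_Rintegral => t _; exact: cReD.
rewrite -(RintD_cont a b (continuous_Im gc) (continuous_Im hc)).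
by apply: eq_Rintegral => t _; exact: cImD.
Qed.

Lemma cintZ a b c g : continuous g -> cint a b (fun t => c * g t) = c * cint a b g.
Proof.
move=> gc; have gr := continuous_Re gc; have gi := continuous_Im gc.
apply/eqP; rewrite !cintE eq_complex cReM cImM; apply/andP; split; apply/eqP => /=.
  rewrite -mulNr -(RintZ_cont _ _ _ gr) -(RintZ_cont _ _ _ gi) -RintD_cont;
    [|exact: continuousZ_real|exact: continuousZ_real].
  by apply: eq_Rintegral => t _; rewrite mulNr; exact: cReM.
rewrite -(RintZ_cont _ _ _ gr) -(RintZ_cont _ _ _ gi) -RintD_cont;
  [|exact: continuousZ_real|exact: continuousZ_real].
by apply: eq_Rintegral => t _; exact: cImM.
Qed.

Lemma cintB a b g h : continuous g -> continuous h ->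
  cint a b (fun t => g t - h t) = cint a b g - cint a b h.
Proof.
move=> gc hc; rewrite -[- cint a b h]mulN1r -(cintZ _ _ _ hc) -(cintD _ _ gc).
  by apply: eq_cint => t _; rewrite mulN1r.
by apply: ccontM; [exact: ccont_cst|exact: hc].
Qed.

Lemma Rint_chasles (x : R -> R) a m b : continuous x -> a <= m -> m <= b ->
  \int[mu]_(t in `[a, b]) x t = \int[mu]_(t in `[a, m]) x t + \int[mu]_(t in `[m, b]) x t.
Proof.
move=> xc am mb.
have xi := continuous_integrable a b xc.
rewrite -(subrK (\int[mu]_(t in `[a, m]) x t) (\int[mu]_(t in `[a, b]) x t)) addrC.
rewrite (@Rintegral_itvB _ _ (BLeft a) (BRight b)) //= Rintegral_itv_obnd_cbnd //.
apply: integrableS (continuous_integrable m b xc) => //.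
by apply: subset_itv; rewrite bnd_simp.
Qed.

Lemma cint_chasles a m b g : continuous g -> a <= m -> m <= b ->
  cint a b g = cint a m g + cint m b g.
Proof.
move=> gc am mb; rewrite !cintE /cintegral.
rewrite (@Rint_chasles (fun t => complex.Re (g t)) a m b) //; last exact: continuous_Re.
by rewrite (@Rint_chasles (fun t => complex.Im (g t)) a m b) //; exact: continuous_Im.
Qed.

Lemma Rint_bound (x : R -> R) a b B : continuous x -> a <= b ->
  (forall t, a <= t <= b -> `|x t| <= B) ->
  `|\int[mu]_(t in `[a, b]) x t| <= (b - a) * B.
Proof.
move=> xc ab xB; have xi := continuous_integrable a b xc.
apply: (le_trans (le_normr_Rintegral _ xi)) => //.
have -> : (b - a) * B = \int[mu]_(t in `[a, b]) (cst B) t.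
  rewrite Rintegral_cst //= lebesgue_measure_itv /= lte_fin.
  case: (ltgtP a b) ab => [ab _|//|-> _]; first by rewrite -EFinD mulrC.
  by rewrite subrr mul0r mulr0.
apply: le_Rintegral; [exact: measurable_itv| | |].
- by apply: continuous_integrable => t; apply: continuous_comp; [exact: xc|exact: norm_continuous].
- by apply: continuous_integrable => t; exact: cst_continuous.
- by move=> t; rewrite /= in_itv /=; exact: xB.
Qed.

Lemma cint_bound a b g B : continuous g -> a <= b ->
  (forall t, a <= t <= b -> normc (g t) <= B) ->
  normc (cint a b g) <= 2 * ((b - a) * B).
Proof.
move=> gc ab gB; rewrite cintE (le_trans (normc_ReIm _)) // mulr_natl mulr2n lerD //=.
  by apply: Rint_bound => //; [exact: continuous_Re|move=> t /gB; apply: le_trans; exact: normc_Re].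
by apply: Rint_bound => //; [exact: continuous_Im|move=> t /gB; apply: le_trans; exact: normc_Im].
Qed.

Lemma Rint_FTC (x X : R -> R) a b : continuous x -> a <= b ->
  (forall t : R, is_derive t 1 X (x t)) -> \int[mu]_(t in `[a, b]) x t = X b - X a.
Proof.
move=> xc; rewrite le_eqVlt => /orP[/eqP ->|ab] Xx.
  by rewrite set_itv1 Rintegral_set1 subrr.
have Xc : continuous X.
  by move=> t; apply/differentiable_continuous/derivable1_diffP; case: (Xx t).
rewrite /Rintegral (@continuous_FTC2 _ x X) //.
- exact: continuous_subspaceT.
- split=> [t _||]; first by case: (Xx t).
  + by apply: cvg_at_right_filter; exact: Xc.
  + by apply: cvg_at_left_filter; exact: Xc.
- by move=> t _; rewrite derive1E; exact: derive_val.
Qed.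

Lemma cint_FTC g G a b : continuous g -> a <= b ->
  (forall t : R, is_derive t 1 (fun s => complex.Re (G s)) (complex.Re (g t))) ->
  (forall t : R, is_derive t 1 (fun s => complex.Im (G s)) (complex.Im (g t))) ->
  cint a b g = G b - G a.
Proof.
move=> gc ab Gr Gi; rewrite !cintE /cintegral.
rewrite (Rint_FTC (continuous_Re gc) ab Gr) (Rint_FTC (continuous_Im gc) ab Gi).
by case: (G b); case: (G a).
Qed.

End IntervalIntegral.

(** * Bisection of rectangles *)

Section Bisection.
Context {R : realType}.
Implicit Types a b c e x t : R.

Lemma nested_intervals (a b : nat -> R) : (forall n, a n <= a n.+1) ->
  (forall n, b n.+1 <= b n) -> (forall n, a n <= b n) ->
  exists x, forall n, a n <= x <= b n.
Proof.
move=> aS bS ab.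
have am n k : a n <= a (n + k)%N.
  by elim: k => [|k IH]; rewrite ?addn0 // addnS (le_trans IH).
have bm n k : b (n + k)%N <= b n.
  by elim: k => [|k IH]; rewrite ?addn0 // addnS (le_trans _ IH).
have abnm n m : a n <= b m.
  by rewrite (le_trans (am n m)) // (le_trans (ab _)) // addnC.
have hS : has_sup (range a) by split; [exists (a 0%N), 0%N|exists (b 0%N) => _ [n _ <-]].
exists (sup (range a)) => n; apply/andP; split.
  by apply: ub_le_sup; [case: hS|exists n].
by apply: ge_sup; [case: hS|move=> _ [m _ <-]].
Qed.

(** Repeated quartering keeps a quarter carrying at least a fourth of the value,
while the area also drops by a factor four; the local hypothesis at the common
point of the nested rectangles then forces the value to vanish. *)
Lemma rect_bisection (D : R -> R -> R -> R -> R) x1 x2 t1 t2 : x1 <= x2 -> t1 <= t2 ->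
  (forall a b c d, x1 <= a -> a <= b -> b <= x2 -> t1 <= c -> c <= d -> d <= t2 ->
     D a b c d <= D a ((a + b) / 2) c ((c + d) / 2) + D ((a + b) / 2) b c ((c + d) / 2) +
       (D a ((a + b) / 2) ((c + d) / 2) d + D ((a + b) / 2) b ((c + d) / 2) d)) ->
  (forall x t, x1 <= x <= x2 -> t1 <= t <= t2 -> forall e, 0 < e ->
     exists2 del, 0 < del & forall a b c d, x1 <= a -> a <= x <= b -> b <= x2 ->
       t1 <= c -> c <= t <= d -> d <= t2 -> b - a < del -> d - c < del ->
       D a b c d <= e * ((b - a) + (d - c)) ^+ 2) ->
  D x1 x2 t1 t2 <= 0.
Proof.
move=> x12 t12 Dsub Dloc; rewrite leNgt; apply/negP => D0.
pose val (q : R * R * R * R) := let: (a, b, c, d) := q in D a b c d.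
pose next (q : R * R * R * R) := let: (a, b, c, d) := q in
  let m := (a + b) / 2 in let n := (c + d) / 2 in
  if val q <= 4 * D a m c n then (a, m, c, n) else
  if val q <= 4 * D m b c n then (m, b, c, n) else
  if val q <= 4 * D a m n d then (a, m, n, d) else (m, b, n, d).
have nextP a b c d : [/\ x1 <= a, a <= b & b <= x2] -> [/\ t1 <= c, c <= d & d <= t2] ->
    let: (a', b', c', d') := next (a, b, c, d) in
    [/\ [/\ a <= a', b' <= b & b' - a' = (b - a) / 2],
        [/\ c <= c', d' <= d & d' - c' = (d - c) / 2] &
        val (a, b, c, d) <= 4 * val (a', b', c', d')].
  move=> [h1 h2 h3] [k1 k2 k3]; have := Dsub _ _ _ _ h1 h2 h3 k1 k2 k3; rewrite /next /=.
  clear Dsub Dloc D0.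
  case: ifPn => [? _|]; [split=> //=; split; lra|rewrite -ltNge => w1].
  case: ifPn => [? _|]; [split=> //=; split; lra|rewrite -ltNge => w2].
  case: ifPn => [? _|]; [split=> //=; split; lra|rewrite -ltNge => w3].
  move=> w4; split; [split; lra|split; lra|lra].
pose q n := iter n next (x1, x2, t1, t2).
pose qa n := (q n).1.1.1; pose qb n := (q n).1.1.2.
pose qc n := (q n).1.2; pose qd n := (q n).2.
have qE n : q n = (qa n, qb n, qc n, qd n).
  by rewrite /qa /qb /qc /qd; case: (q n) => -[[]].
have P n : [/\ [/\ x1 <= qa n, qa n <= qb n & qb n <= x2],
    [/\ t1 <= qc n, qc n <= qd n & qd n <= t2],
    [/\ qa n <= qa n.+1, qb n.+1 <= qb n & qb n.+1 - qa n.+1 = (qb n - qa n) / 2],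
    [/\ qc n <= qc n.+1, qd n.+1 <= qd n & qd n.+1 - qc n.+1 = (qd n - qc n) / 2] &
    val (q n) <= 4 * val (q n.+1)].
  have H m : [/\ x1 <= qa m, qa m <= qb m & qb m <= x2] ->
      [/\ t1 <= qc m, qc m <= qd m & qd m <= t2] ->
    [/\ [/\ qa m <= qa m.+1, qb m.+1 <= qb m & qb m.+1 - qa m.+1 = (qb m - qa m) / 2],
    [/\ qc m <= qc m.+1, qd m.+1 <= qd m & qd m.+1 - qc m.+1 = (qd m - qc m) / 2] &
    val (q m) <= 4 * val (q m.+1)].
    move=> hm km; have := nextP _ _ _ _ hm km.
    by rewrite -qE -[next (q m)]/(q m.+1) (qE m.+1).
  elim: n => [|n [[a1 a2 a3] [b1 b2 b3] [c1 c2 c3] [d1 d2 d3] e]].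
    have A : [/\ x1 <= qa 0, qa 0 <= qb 0 & qb 0 <= x2] by [].
    have B : [/\ t1 <= qc 0, qc 0 <= qd 0 & qd 0 <= t2] by [].
    by have [] := H 0%N A B; split.
  have A : [/\ x1 <= qa n.+1, qa n.+1 <= qb n.+1 & qb n.+1 <= x2].
    by split; [exact: le_trans a1 c1|rewrite -subr_ge0 c3 divr_ge0 // subr_ge0|exact: le_trans c2 a3].
  have B : [/\ t1 <= qc n.+1, qc n.+1 <= qd n.+1 & qd n.+1 <= t2].
    by split; [exact: le_trans b1 d1|rewrite -subr_ge0 d3 divr_ge0 // subr_ge0|exact: le_trans d2 b3].
  by have [] := H _ A B; split.
have [x xP] : exists x, forall n, qa n <= x <= qb n.
  by apply: nested_intervals => n; case: (P n) => -[? ? ?] _ [].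
have [t tP] : exists t, forall n, qc n <= t <= qd n.
  by apply: nested_intervals => n; case: (P n) => _ [? ? ?] _ [].
have lx n : qb n - qa n = (x2 - x1) / 2 ^+ n.
  elim: n => [|n IH]; first by rewrite expr0 divr1.
  by case: (P n) => _ _ [_ _ ->] _ _; rewrite IH exprS; field.
have lt n : qd n - qc n = (t2 - t1) / 2 ^+ n.
  elim: n => [|n IH]; first by rewrite expr0 divr1.
  by case: (P n) => _ _ _ [_ _ ->] _; rewrite IH exprS; field.
have Dn n : D x1 x2 t1 t2 <= 4 ^+ n * val (q n).
  elim: n => [|n IH]; first by rewrite expr0 mul1r.
  apply: (le_trans IH); rewrite exprSr -mulrA ler_wpM2l ?exprn_ge0 //.
  by case: (P n).
pose l := (x2 - x1) + (t2 - t1); have l0 : 0 <= l by rewrite /l; lra.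
pose e := D x1 x2 t1 t2 / (2 * (l + 1) ^+ 2).
have e0 : 0 < e by rewrite /e divr_gt0 // mulr_gt0 // exprn_gt0 //; lra.
have [del del0 hdel] := Dloc x t (xP 0%N) (tP 0%N) e e0.
have [n hn] : exists n, l / 2 ^+ n < del.
  have [n hn] : exists n : nat, l / del < n%:R.
    by exists (Num.trunc (l / del)).+1; rewrite truncnS_gt.
  exists n; rewrite ltr_pdivrMr ?exprn_gt0 // mulrC -ltr_pdivrMr //.
  apply: (lt_trans hn); rewrite -natrX ltr_nat; exact: ltn_expl.
have := Dn n; rewrite qE /= => Dn'.
have p2 : 0 < (2 : R) ^+ n by rewrite exprn_gt0.
have h1 : (x2 - x1) / 2 ^+ n <= l / 2 ^+ n.
  by rewrite ler_pM2r ?invr_gt0 // /l; lra.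
have h2 : (t2 - t1) / 2 ^+ n <= l / 2 ^+ n.
  by rewrite ler_pM2r ?invr_gt0 // /l; lra.
have [[a1 a2 a3] [b1 b2 b3] _ _ _] := P n.
have := hdel _ _ _ _ a1 (xP n) a3 b1 (tP n) b3.
rewrite lx lt => /(_ (le_lt_trans h1 hn) (le_lt_trans h2 hn)).
rewrite -mulrDl -/l => hd.
have : D x1 x2 t1 t2 <= e * l ^+ 2.
  apply: (le_trans Dn'); apply: le_trans (ler_wpM2l (exprn_ge0 n _) hd) _ => //.
  rewrite le_eqVlt; apply/orP; left; apply/eqP.
  have -> : (4 : R) ^+ n = (2 ^+ n) ^+ 2 by rewrite -!natrX -expnM mulnC expnM.
  by field; rewrite gt_eqF.
rewrite leNgt => /negP; apply.
rewrite /e mulrAC ltr_pdivrMr; last by rewrite mulr_gt0 // exprn_gt0 //; lra.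
rewrite ltr_pM2l //; nra.
Qed.

End Bisection.

(** * Complex derivatives in one variable *)

Section ComplexDerivative.
Context {R : realType}.
Local Notation C := R[i].
Implicit Types (F G : C -> C) (w l z : C).

Definition cderiv F w l := forall e : R, 0 < e -> exists2 del : R, 0 < del &
  forall h, normc h < del -> normc (F (w + h) - F w - l * h) <= e * normc h.

Lemma cderiv_continuous F w l : cderiv F w l -> {for w, continuous F}.
Proof.
move=> Fw; apply: (cvg_normcP (FF:=nbhs_filter w) F (F w)).2 => e e0.
have [del del0 hdel] := Fw _ ltr01.
have l1 : 0 < normc l + 1 by have := normc_ge0 l; lra.
apply/nbhs_normcP; exists (Num.min del (e / (normc l + 1))).
  by rewrite lt_min del0 divr_gt0.
move=> z; rewrite lt_min => /andP[z1 z2]; have := hdel _ z1.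
rewrite (addrC w) subrK mul1r => h.
have -> : F z - F w = (F z - F w - l * (z - w)) + l * (z - w) by ring.
apply: (le_lt_trans (normcD _ _)); rewrite normcM.
move: z2; rewrite ltr_pdivlMr //; lra.
Qed.

Lemma cderiv_cst c w : cderiv (fun=> c) w 0.
Proof.
move=> e e0; exists 1 => // h _.
by rewrite subrr mul0r subrr normc0 mulr_ge0 ?normc_ge0 ?ltW.
Qed.

Lemma cderivM F G w l m : cderiv F w l -> cderiv G w m ->
  cderiv (fun z => F z * G z) w (l * G w + F w * m).
Proof.
move=> Fw Gw e e0.
have G1 : 0 < normc (G w) + 1 by have := normc_ge0 (G w); lra.
have l1 : 0 < normc l + 1 by have := normc_ge0 l; lra.
have F1 : 0 < normc (F w) + 1 by have := normc_ge0 (F w); lra.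
have Gc := (cvg_normcP (FF:=nbhs_filter w) G (G w)).1 (cderiv_continuous Gw).
have [d1 d10 h1] := Fw _ (divr_gt0 e0 (mulr_gt0 (ltr0n R 3) (addr_gt0 G1 ltr01))).
have [d2 d20 h2] := Gw _ (divr_gt0 e0 (mulr_gt0 (ltr0n R 3) F1)).
have [d3 d30 h3] := (nbhs_normcP _ _).1 (Gc _ (divr_gt0 e0 (mulr_gt0 (ltr0n R 3) l1))).
have [d4 d40 h4] := (nbhs_normcP _ _).1 (Gc _ ltr01).
exists (Num.min (Num.min d1 d2) (Num.min d3 d4)); first by rewrite !lt_min d10 d20 d30 d40.
move=> h; rewrite !lt_min => /andP[/andP[/h1 k1 /h2 k2] /andP[k3 k4]].
have {}k3 : normc (G (w + h) - G w) < e / (3 * (normc l + 1)).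
  by apply: h3; rewrite addrC addKr.
have {}k4 : normc (G (w + h) - G w) < 1 by apply: h4; rewrite addrC addKr.
have k5 : normc (G (w + h)) <= normc (G w) + 1.
  by have := normcD (G (w + h) - G w) (G w); rewrite subrK; lra.
have -> : F (w + h) * G (w + h) - F w * G w - (l * G w + F w * m) * h =
  (F (w + h) - F w - l * h) * G (w + h) + (l * h * (G (w + h) - G w) +
   F w * (G (w + h) - G w - m * h)) by ring.
apply: (le_trans (normcD _ _)).
apply: (le_trans (lerD (lexx _) (normcD _ _))); rewrite !normcM.
have hh := normc_ge0 h.
have -> : e * normc h = e / 3 * normc h + (e / 3 * normc h + e / 3 * normc h) by field.
have aux (x g : R) : 0 < g -> x <= e / (3 * g) * normc h -> x * g <= e / 3 * normc h.
  move=> g0; rewrite -(ler_pM2r g0) => /le_trans; apply.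
  by rewrite le_eqVlt; apply/orP; left; apply/eqP; field; rewrite gt_eqF.
apply: lerD; last apply: lerD.
- apply: le_trans (aux _ _ (addr_gt0 G1 ltr01) k1).
  by rewrite ler_wpM2l ?normc_ge0 //; lra.
- rewrite mulrAC ler_wpM2r // mulrC; apply: (@le_trans _ _ (normc (G (w + h) - G w) * (normc l + 1))).
    by rewrite ler_wpM2l ?normc_ge0 //; lra.
  apply: ltW; rewrite -ltr_pdivlMr //; apply: (lt_le_trans k3).
  by rewrite invfM mulrA.
- rewrite mulrC; apply: le_trans (aux _ _ F1 k2).
  by rewrite ler_wpM2l ?normc_ge0 //; lra.
Qed.

Lemma cderivV F w l : F w != 0 -> cderiv F w l ->
  cderiv (fun z => (F z)^-1) w (- l / F w ^+ 2).
Proof.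
move=> Fw0 Fw e e0.
have N0 : 0 < normc (F w) by exact: normc_gt0.
set N := normc (F w) in N0.
have l1 : 0 < normc l + 1 by have := normc_ge0 l; lra.
have Fc := (cvg_normcP (FF:=nbhs_filter w) F (F w)).1 (cderiv_continuous Fw).
have e1 : 0 < e * N ^+ 2 / 4 by rewrite divr_gt0 // mulr_gt0 // exprn_gt0.
have e2 : 0 < e * N ^+ 3 / (4 * (normc l + 1)).
  by rewrite divr_gt0 // mulr_gt0 // exprn_gt0.
have [d1 d10 h1] := Fw _ e1.
have [d2 d20 h2] := (nbhs_normcP _ _).1 (Fc _ (divr_gt0 N0 (ltr0n R 2))).
have [d3 d30 h3] := (nbhs_normcP _ _).1 (Fc _ e2).
exists (Num.min d1 (Num.min d2 d3)); first by rewrite !lt_min d10 d20 d30.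
move=> h; rewrite !lt_min => /and3P[/h1 k1 k2 k3].
have {}k2 : normc (F (w + h) - F w) < N / 2 by apply: h2; rewrite addrC addKr.
have {}k3 : normc (F (w + h) - F w) < e * N ^+ 3 / (4 * (normc l + 1)).
  by apply: h3; rewrite addrC addKr.
have Nh : N / 2 <= normc (F (w + h)).
  by have := normcB (F w) (F (w + h)); rewrite normcBC -/N; lra.
have Nh0 : 0 < normc (F (w + h)) by apply: lt_le_trans Nh; rewrite divr_gt0.
have Fh0 : F (w + h) != 0 by rewrite -normc_eq0 gt_eqF.
have -> : (F (w + h))^-1 - (F w)^-1 - - l / F w ^+ 2 * h =
  (- (F (w + h) - F w - l * h) * F w + l * h * (F (w + h) - F w)) /
    (F (w + h) * F w ^+ 2) by field; rewrite Fh0 Fw0.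
rewrite normcM normcV [X in _ / X]normcM normcX -/N.
have D0 : 0 < normc (F (w + h)) * N ^+ 2 by rewrite mulr_gt0 // exprn_gt0.
rewrite ler_pdivrMr //; apply: (le_trans (normcD _ _)); rewrite !normcM normcN -/N.
have hh := normc_ge0 h.
have q1 : normc (F (w + h) - F w - l * h) * N <= e / 4 * N ^+ 3 * normc h.
  apply: (le_trans (ler_wpM2r (ltW N0) k1)).
  by rewrite le_eqVlt; apply/orP; left; apply/eqP; field.
have q2 : normc l * normc h * normc (F (w + h) - F w) <= e / 4 * N ^+ 3 * normc h.
  rewrite mulrAC ler_wpM2r //.
  move: k3; rewrite ltr_pdivlMr ?mulr_gt0 //.
  have := normc_ge0 (F (w + h) - F w); have := normc_ge0 l; nra.
have q3 : e / 2 * N ^+ 3 * normc h <= e * normc h * (normc (F (w + h)) * N ^+ 2).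
  have : 0 <= e * normc h * N ^+ 2 by rewrite !mulr_ge0 ?exprn_ge0 // ltW.
  have -> : e / 2 * N ^+ 3 * normc h = (e * normc h * N ^+ 2) * (N / 2) by field.
  have -> : e * normc h * (normc (F (w + h)) * N ^+ 2) =
    (e * normc h * N ^+ 2) * normc (F (w + h)) by ring.
  by move=> ?; rewrite ler_wpM2l.
apply: le_trans q3; apply: le_trans (lerD q1 q2) _.
by rewrite le_eqVlt; apply/orP; left; apply/eqP; field.
Qed.

Lemma cderiv_affine F (c m w l : C) : cderiv F (c + w * m) l ->
  cderiv (fun z => F (c + z * m)) w (l * m).
Proof.
move=> Fw e e0; have m1 : 0 < normc m + 1 by have := normc_ge0 m; lra.
have [d d0 hd] := Fw _ (divr_gt0 e0 m1).
exists (d / (normc m + 1)); first exact: divr_gt0.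
move=> h hh; have := hd (h * m).
rewrite normcM mulrDl addrA -mulrA [m * h]mulrC.
have hn := normc_ge0 h; have mn := normc_ge0 m.
move: hh; rewrite ltr_pdivlMr // => hh /(_ _)/le_trans; apply; first nra.
rewrite mulrAC ler_pdivrMr //; nra.
Qed.

End ComplexDerivative.

(** * The exponential function and the unit circle *)

Section ComplexExponential.
Context {R : realType}.
Local Notation C := R[i].

Lemma cexpD (z w : C) : cexp (z + w) = cexp z * cexp w.
Proof.
case: z => a b; case: w => c e; rewrite /cexp /= expRD cosD sinD.
by apply/eqP; rewrite eq_complex /=; apply/andP; split; apply/eqP; ring.
Qed.

Lemma cexp0 : cexp (0 : C) = 1.
Proof.
by rewrite /cexp /= expR0 cos0 sin0; apply/eqP; rewrite eq_complex /= !mul0r !mulr0 subr0 addr0 mulr1 !eqxx.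
Qed.

Lemma normc_cexp (z : C) : normc (cexp z) = expR (complex.Re z).
Proof.
rewrite /cexp normcM normc_real ger0_norm ?expR_ge0 //= addrC sin2cos2 subrK.
by rewrite sqrtr1 mulr1.
Qed.

Lemma cexp_real (x : R) : cexp x%:C = (expR x)%:C.
Proof.
by rewrite /cexp /= cos0 sin0; apply/eqP; rewrite eq_complex /= !mul0r !mulr0 subr0 addr0 mulr1 !eqxx.
Qed.

Lemma is_derive_eps (f : R -> R) (x l : R) : is_derive x 1 f l ->
  forall e : R, 0 < e -> exists2 del : R, 0 < del &
    forall h, `|h| < del -> `|f (x + h) - f x - l * h| <= e * `|h|.
Proof.
move=> fx e e0.
have : (fun h => h^-1 *: (f (h + x) - f x)) @ 0^' --> l.
  have [df dl] := fx; rewrite -dl.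
  have -> : (fun h : R => h^-1 *: (f (h + x) - f x)) =
      (fun h : R => h^-1 *: (f (h *: (1 : R) + x) - f x)).
    by apply/funext => h; rewrite -[h *: (1 : R)]/(h * 1) mulr1.
  exact: df.
move/cvgrPdist_lt => /(_ _ e0); rewrite near_withinE => /nbhs_ballP[del /= del0 hdel].
exists del => // h hd; case: (eqVneq h 0) => [->|h0].
  by rewrite addr0 subrr mulr0 subr0 normr0 mulr0.
have := hdel h; rewrite -ball_normE /ball_ /= sub0r normrN => /(_ hd h0).
rewrite distrC -[h^-1 *: _]/(h^-1 * _) addrC => /ltW.
rewrite -(@ler_pM2r _ `|h|) ?normr_gt0 // -normrM; congr (_ <= _); congr (`|_|).
by rewrite [X in f X]addrC; field.
Qed.

(** By [cexpD] it is enough to differentiate at the origin, where the real functions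
[expR], [cos] and [sin] are known to first order. *)
Lemma cderiv_cexp (w : C) : cderiv (@cexp R) w (cexp w).
Proof.
have H0 : cderiv (@cexp R) 0 1.
  move=> e e0.
  have e1 : 0 < Num.min 1 e / 12 by rewrite divr_gt0 // lt_min ltr01.
  have [d1 d10 h1] := is_derive_eps (@is_derive_expR R 0) e1.
  have [d2 d20 h2] := is_derive_eps (@is_derive_cos R 0) e1.
  have [d3 d30 h3] := is_derive_eps (@is_derive_sin R 0) e1.
  exists (Num.min (Num.min 1 (e / 12)) (Num.min d1 (Num.min d2 d3))).
    by rewrite !lt_min ltr01 d10 d20 d30 divr_gt0.
  move=> h; rewrite !lt_min => /andP[/andP[n1 ne] /and3P[nd1 nd2 nd3]].
  have rn := normc_Re h; have im := normc_Im h.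
  move: rn im n1 ne nd1 nd2 nd3; move: (normc h) => N.
  rewrite cexp0 add0r mul1r; pose x := complex.Re h; pose y := complex.Im h.
  rewrite -/x -/y => xN yN n1 ne nd1 nd2 nd3.
  have := h1 _ (le_lt_trans xN nd1); rewrite add0r expR0 mul1r => k1.
  have := h2 _ (le_lt_trans yN nd2); rewrite add0r cos0 sin0 oppr0 mul0r subr0 => k2.
  have := h3 _ (le_lt_trans yN nd3); rewrite add0r cos0 sin0 subr0 mul1r => k3.
  have m1 : Num.min 1 e <= 1 by rewrite ge_min lexx.
  have m2 : Num.min 1 e <= e by rewrite ge_min lexx orbT.
  move: (Num.min 1 e) m1 m2 e1 k1 k2 k3 => m m1 m2 e1 k1 k2 k3.
  have N0 : 0 <= N by apply: le_trans xN.
  have {}k1 : `|expR x - 1 - x| <= m / 12 * N by apply: le_trans k1 _; rewrite ler_wpM2l // ltW.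
  have {}k2 : `|cos y - 1| <= m / 12 * N by apply: le_trans k2 _; rewrite ler_wpM2l // ltW.
  have {}k3 : `|sin y - y| <= m / 12 * N by apply: le_trans k3 _; rewrite ler_wpM2l // ltW.
  have ex : `|expR x - 1| <= 2 * N.
    rewrite (_ : expR x - 1 = expR x - 1 - x + x); last by ring.
    apply: (le_trans (ler_normD _ _)); nra.
  have ex3 : `|expR x| <= 3.
    rewrite (_ : expR x = expR x - 1 + 1); last by ring.
    apply: (le_trans (ler_normD _ _)); rewrite normr1; lra.
  apply: (le_trans (normc_ReIm _)); rewrite !cReB !cImB /cexp cReM cImM /= !mul0r !subr0 addr0 -/x -/y.
  apply: (@le_trans _ _ ((m / 12 * N + 3 * (m / 12 * N)) + (3 * (m / 12 * N) + 2 * N * N))); last first.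
    have : 2 * N * N <= 2 * (e / 12) * N by rewrite ler_wpM2r //; lra.
    have : m * N <= e * N by rewrite ler_wpM2r.
    by have := mulr_ge0 (ltW e0) N0; lra.
  apply: lerD.
    rewrite (_ : _ - 1 - x = (expR x - 1 - x) + expR x * (cos y - 1)); last by ring.
    by apply: (le_trans (ler_normD _ _)); rewrite lerD // normrM ler_pM.
  rewrite (_ : _ - y = expR x * (sin y - y) + (expR x - 1) * y); last by ring.
  by apply: (le_trans (ler_normD _ _)); rewrite lerD // normrM ler_pM.
move=> e e0; have [d d0 hd] := H0 _ (divr_gt0 e0 (expR_gt0 (complex.Re w))).
exists d => // h /hd; rewrite cexp0 add0r mul1r cexpD => k.
rewrite (_ : _ - _ = cexp w * (cexp h - 1 - h)); last by ring.
rewrite normcM normc_cexp mulrC -ler_pdivlMr ?expR_gt0 //.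
by rewrite mulrAC.
Qed.

(** Locked, since reduction would split products into real and imaginary parts. *)
Definition unitc (t : R) : C := locked (cexp (0 +i* t)).

Lemma unitc_cexp t : unitc t = cexp (0 +i* t).
Proof. by rewrite /unitc -lock. Qed.

Lemma unitcE t : unitc t = cos t +i* sin t.
Proof.
by rewrite unitc_cexp /cexp /= expR0; apply/eqP; rewrite eq_complex /= !mul1r !mul0r subr0 addr0 !eqxx.
Qed.

Lemma unitcD s t : unitc (s + t) = unitc s * unitc t.
Proof. by rewrite !unitc_cexp -cexpD; congr cexp; apply/eqP; rewrite eq_complex /= addr0 !eqxx. Qed.

Lemma unitc0 : unitc 0 = 1. Proof. by rewrite unitc_cexp; exact: cexp0. Qed.

Lemma normc_unitc t : normc (unitc t) = 1.
Proof. by rewrite unitc_cexp normc_cexp expR0. Qed.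

Lemma unitc_neq0 t : unitc t != 0.
Proof. by rewrite -normc_eq0 normc_unitc oner_eq0. Qed.

Lemma unitc2pi : unitc (2 * pi) = 1.
Proof.
rewrite unitcE mulr_natl cos2pi sin2pi; by [].
Qed.

Lemma unitcX t n : unitc t ^+ n = unitc (n%:R * t).
Proof.
elim: n => [|n IH]; first by rewrite mul0r unitc0.
by rewrite exprS IH -unitcD -[in RHS]natr1 mulrDl mul1r addrC.
Qed.

Lemma unitcV t : (unitc t)^-1 = unitc (- t).
Proof.
by apply: (mulfI (unitc_neq0 t)); rewrite mulfV ?unitc_neq0 // -unitcD subrr unitc0.
Qed.

Lemma unitc_continuous : continuous unitc.
Proof.
move=> t; apply/cvg_ReIm; split.
  rewrite (_ : (fun x => _) = cos); first by rewrite unitcE /=; exact: continuous_cos.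
  by apply/funext => x; rewrite unitcE.
rewrite (_ : (fun x => _) = sin); first by rewrite unitcE /=; exact: continuous_sin.
by apply/funext => x; rewrite unitcE.
Qed.

Lemma unitc_scale_continuous (x : R) : continuous (fun t => unitc (x * t)).
Proof.
move=> t; apply: (@continuous_comp _ _ _ (fun t => x * t) unitc).
  by apply: cvgM; [exact: cvg_cst|exact: cvg_id].
exact: unitc_continuous.
Qed.

Lemma is_derive_scale (x t : R) : is_derive t 1 ( *%R x) x.
Proof.
have h : is_derive t 1 (x *: (@id R : R -> R)) (x *: (1 : R)) by exact: is_deriveZ.
by rewrite -[X in is_derive _ _ _ X](mulr1 x).
Qed.

Lemma is_derive_unitc_Re (x t : R) :
  is_derive t 1 (fun s : R => complex.Re (unitc (x * s))) (- sin (x * t) * x).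
Proof.
rewrite (_ : (fun s => _) = cos \o ( *%R x)); last by apply/funext => s; rewrite unitcE.
have h := is_derive_scale x t.
exact: is_derive1_comp.
Qed.

Lemma is_derive_unitc_Im (x t : R) :
  is_derive t 1 (fun s : R => complex.Im (unitc (x * s))) (cos (x * t) * x).
Proof.
rewrite (_ : (fun s => _) = sin \o ( *%R x)); last by apply/funext => s; rewrite unitcE.
have h := is_derive_scale x t.
exact: is_derive1_comp.
Qed.

Lemma cint_unitc (x a b : R) : a <= b ->
  cint a b (fun t => (0 +i* x) * unitc (x * t)) = unitc (x * b) - unitc (x * a).
Proof.
move=> ab; apply: (@cint_FTC _ _ (fun t => unitc (x * t))) => //.
- by apply: ccontM; [exact: ccont_cst|exact: unitc_scale_continuous].
- move=> t; rewrite cReM unitcE /= mul0r sub0r -mulNr mulrC mulrN -mulNr.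
  exact: is_derive_unitc_Re.
- move=> t; rewrite cImM unitcE /= mul0r add0r mulrC.
  exact: is_derive_unitc_Im.
Qed.

Lemma expR_ccont : continuous (fun x : R => (expR x)%:C : C).
Proof. by move=> x; apply/cvg_ReIm; split; [exact: continuous_expR|exact: cvg_cst]. Qed.

Lemma cint_expR (a b : R) : a <= b ->
  cint a b (fun x => (expR x)%:C) = (expR b)%:C - (expR a)%:C.
Proof.
move=> ab; apply: (cint_FTC (G := fun x => (expR x)%:C) expR_ccont ab) => t /=.
exact: (is_derive_cst (0 : R) t 1).
Qed.

(** A primitive of a nontrivial character is again periodic. *)
Lemma cint_unitc_period (n m : nat) : n != m ->
  cint 0 (2 * pi) (fun t => unitc ((n%:R - m%:R) * t)) = 0.
Proof.
move=> nm; set x : R := n%:R - m%:R.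
have x0 : x != 0 by rewrite subr_eq0 eqr_nat.
have ix0 : (0 +i* x) != 0 :> C by rewrite eq_complex /= negb_and x0 orbT.
have p0 : (0 : R) <= 2 * pi by rewrite mulr_ge0 // pi_ge0.
apply: (mulfI ix0); rewrite mulr0 -cintZ; last exact: unitc_scale_continuous.
rewrite cint_unitc // mulr0 unitc0 /x mulrBl -mulNr unitcD mulNr -unitcV -(unitcX _ n) -(unitcX _ m).
by rewrite unitc2pi !expr1n invr1 mulr1 subrr.
Qed.

Lemma cint_period_cst (c : C) : cint 0 (2 * pi) (fun=> c) = (2 * pi)%:C * c.
Proof.
have p0 : (0 : R) < 2 * pi by rewrite mulr_gt0 // pi_gt0.
rewrite !cintE /cintegral; case: c => a b /=.
rewrite !Rintegral_cst //= !lebesgue_measure_itv /= !lte_fin p0 -EFinD /= subr0.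
by apply/eqP; rewrite eq_complex /= !mul0r subr0 addr0 ![_ * (2 * pi)]mulrC !eqxx.
Qed.

Lemma unitc_lip s t : normc (unitc t - unitc s) <= 2 * `|t - s|.
Proof.
wlog st : s t / s <= t => [H|].
  have [|/ltW ts] := leP s t; first exact: H.
  by rewrite normcBC distrC; exact: H.
have := cint_unitc 1 st; rewrite !mul1r => <-.
rewrite (ger0_norm _) ?subr_ge0 //.
have := @cint_bound R s t (fun t => (0 +i* 1) * unitc (1 * t)) 1.
rewrite mulr1; apply => //.
  by apply: ccontM; [exact: ccont_cst|exact: unitc_scale_continuous].
move=> u _; rewrite normcM normc_unitc mulr1 /= expr0n /= expr1n add0r sqrtr1 //.
Qed.

Lemma expR_lip (x y : R) : x <= 0 -> y <= 0 -> `|expR x - expR y| <= `|x - y|.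
Proof.
wlog xy : x y / y <= x => [H x0 y0|x0 y0].
  have [|/ltW ts] := leP y x; first by move=> ?; exact: H.
  by rewrite distrC [leRHS]distrC; exact: H.
rewrite !ger0_norm ?subr_ge0 ?ler_expR //.
have h := expR_ge1Dx (y - x); have e := expRD x (y - x).
rewrite addrC subrK in e; have e1 : expR x <= 1 by rewrite -expR0 ler_expR.
have := expR_gt0 x; rewrite e; nra.
Qed.

End ComplexExponential.

(** * Cauchy's formula and Taylor coefficients on a disc *)

Section CauchyDisc.
Context {R : realType}.
Local Notation C := R[i].
Variables (F : C -> C) (s : R) (a : C).
Hypotheses (s0 : 0 < s) (as_ : normc a < s).
Hypothesis Fd : forall w, normc w <= s -> exists l, cderiv F w l.

Let gam t : C := s%:C * unitc t - a.
(** The logarithmic derivative of [gam]. *)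
Let kap t : C := (0 +i* s) * unitc t / gam t.
(** The circle shrunk towards [a] by the factor [e^x]; the cut-off at [x = 0] only
makes the function globally defined. *)
Let W (x t : R) : C := (expR (Num.min x 0))%:C * gam t.
Let Phi (x t : R) : C := F (a + W x t).

Let gam_lb t : s - normc a <= normc (gam t).
Proof.
rewrite /gam; have := normcB (s%:C * unitc t) a.
by rewrite normcM normc_unitc normc_real gtr0_norm // mulr1.
Qed.

Let gam_neq0 t : gam t != 0.
Proof. rewrite -normc_eq0 gt_eqF //; move: (gam_lb t) (as_); lra. Qed.

Let gam_ub t : normc (gam t) <= 2 * s.
Proof.
rewrite /gam; have := normcD (s%:C * unitc t) (- a).
rewrite normcM normc_unitc normc_real gtr0_norm // mulr1 normcN; move: (as_); lra.
Qed.

Let kap_ub t : normc (kap t) <= s / (s - normc a).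
Proof.
rewrite /kap normcM normcV normcM normc_unitc mulr1 /= expr0n /= add0r sqrtr_sqr gtr0_norm //.
rewrite ler_pM2l // lef_pV2 ?gam_lb // posrE ?subr_gt0 //.
by rewrite normc_gt0 ?gam_neq0.
Qed.

Let W_in x t : normc (a + W x t) <= s.
Proof.
set lam := expR (Num.min x 0).
have l0 : 0 <= lam by exact: expR_ge0.
have l1 : lam <= 1 by rewrite -expR0 ler_expR ge_min lexx orbT.
have -> : a + W x t = (1 - lam)%:C * a + (lam * s)%:C * unitc t.
  rewrite /W /gam -/lam rmorphB rmorphM rmorph1; ring.
apply: (le_trans (normcD _ _)); rewrite 2!normcM normc_unitc mulr1 !normc_real.
rewrite (ger0_norm (x := 1 - lam)) ?subr_ge0 // ger0_norm ?mulr_ge0 ?(ltW s0) //.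
move: (normc_ge0 a) (as_) (s0); nra.
Qed.

Let gam_cont : continuous gam.
Proof.
apply: ccontB; last exact: ccont_cst.
by apply: ccontM; [exact: ccont_cst|exact: unitc_continuous].
Qed.

Let kap_cont : continuous kap.
Proof.
move=> t; apply: cvgM; first by apply: cvgM; [exact: cvg_cst|exact: unitc_continuous].
by apply: cvgV; [exact: gam_neq0|exact: gam_cont].
Qed.

Let W_cont_t x : continuous (W x).
Proof. by apply: ccontM; [exact: ccont_cst|exact: gam_cont]. Qed.

Let W_cont_x t : continuous (W ^~ t).
Proof.
apply: ccontM; last exact: ccont_cst.
move=> x; apply/cvg_ReIm; split=> /=; last exact: cvg_cst.
apply: (@continuous_comp R R R (fun x => Num.min x 0) (@expR R) x).
  by apply: continuous_min; [exact: cvg_id|exact: cvg_cst].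
exact: continuous_expR.
Qed.

Let Phi_cont_t x : continuous (Phi x).
Proof.
move=> t; apply: (@continuous_comp _ _ _ (fun t => a + W x t) F).
  by apply: cvgD; [exact: cvg_cst|exact: W_cont_t].
by have [l /cderiv_continuous] := Fd (W_in x t).
Qed.

Let Phi_cont_x t : continuous (Phi ^~ t).
Proof.
move=> x; apply: (@continuous_comp _ _ _ (fun x => a + W x t) F).
  by apply: cvgD; [exact: cvg_cst|exact: W_cont_x].
by have [l /cderiv_continuous] := Fd (W_in x t).
Qed.

(** The integral of [f dlog(w - a)] around the image of a coordinate rectangle. *)
Let bd (f : R -> R -> C) x1 x2 t1 t2 : C :=
  (cint t1 t2 (fun t => f x2 t * kap t) - cint t1 t2 (fun t => f x1 t * kap t)) -
  (cint x1 x2 (f ^~ t2) - cint x1 x2 (f ^~ t1)).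

Let good (f : R -> R -> C) := (forall x, continuous (f x)) /\ (forall t, continuous (f ^~ t)).

Let bd_aux (P1 P2 Q1 Q2 p1 p2 p3 p4 p5 p6 q1 q2 q3 q4 q5 q6 : C) :
  P2 = p1 + p2 -> P1 = p3 + p4 -> Q2 = q1 + q2 -> Q1 = q3 + q4 ->
  P2 - P1 - (Q2 - Q1) =
  p5 - p3 - (q5 - q3) + (p1 - p5 - (q6 - q4)) +
  (p6 - p4 - (q1 - q5) + (p2 - p6 - (q2 - q6))).
Proof. move=> -> -> -> ->; ring. Qed.

Let bd_add f x1 x2 t1 t2 m n : good f -> x1 <= m -> m <= x2 -> t1 <= n -> n <= t2 ->
  bd f x1 x2 t1 t2 = bd f x1 m t1 n + bd f m x2 t1 n + (bd f x1 m n t2 + bd f m x2 n t2).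
Proof.
move=> [fx ft] xm mx tn nt; rewrite /bd.
have ck x : continuous (fun t => f x t * kap t) by exact: (ccontM (fx x) kap_cont).
exact: (bd_aux _ _ _ _ (cint_chasles (ck x2) tn nt) (cint_chasles (ck x1) tn nt)
  (cint_chasles (ft t2) xm mx) (cint_chasles (ft t1) xm mx)).
Qed.

Let bdD_aux (p1 p2 q1 q2 r1 r2 s1 s2 P1 P2 Q1 Q2 : C) :
  P2 = p2 + r2 -> P1 = p1 + r1 -> Q2 = q2 + s2 -> Q1 = q1 + s1 ->
  P2 - P1 - (Q2 - Q1) = p2 - p1 - (q2 - q1) + (r2 - r1 - (s2 - s1)).
Proof. move=> -> -> -> ->; ring. Qed.

Let bdD f g x1 x2 t1 t2 : good f -> good g ->
  bd (fun x t => f x t + g x t) x1 x2 t1 t2 = bd f x1 x2 t1 t2 + bd g x1 x2 t1 t2.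
Proof.
move=> [fx ft] [gx gt]; rewrite /bd.
have ck (h : R -> R -> C) x : continuous (h x) -> continuous (fun t => h x t * kap t).
  by move=> hx; exact: (ccontM hx kap_cont).
have E x : cint t1 t2 (fun t => (f x t + g x t) * kap t) =
    cint t1 t2 (fun t => f x t * kap t) + cint t1 t2 (fun t => g x t * kap t).
  apply: etrans (cintD _ _ (ck f x (fx x)) (ck g x (gx x))).
  by apply: eq_cint => t _; rewrite mulrDl.
exact: (bdD_aux (E x2) (E x1) (cintD _ _ (ft _) (gt _)) (cintD _ _ (ft _) (gt _))).
Qed.

Let bdZ_aux (c p1 p2 q1 q2 P1 P2 Q1 Q2 : C) :
  P2 = c * p2 -> P1 = c * p1 -> Q2 = c * q2 -> Q1 = c * q1 ->
  P2 - P1 - (Q2 - Q1) = c * (p2 - p1 - (q2 - q1)).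
Proof. move=> -> -> -> ->; ring. Qed.

Let bdZ c f x1 x2 t1 t2 : good f ->
  bd (fun x t => c * f x t) x1 x2 t1 t2 = c * bd f x1 x2 t1 t2.
Proof.
move=> [fx ft]; rewrite /bd.
have ck x : continuous (fun t => f x t * kap t) by exact: (ccontM (fx x) kap_cont).
have E x : cint t1 t2 (fun t => (c * f x t) * kap t) = c * cint t1 t2 (fun t => f x t * kap t).
  by apply: etrans (cintZ _ _ c (ck x)); apply: eq_cint => t _; rewrite mulrA.
exact: (bdZ_aux (E x2) (E x1) (cintZ _ _ c (ft _)) (cintZ _ _ c (ft _))).
Qed.

Let good_cst c : good (fun _ _ => c).
Proof. by split=> ?; exact: ccont_cst. Qed.

Let good_W : good W. Proof. by split; [exact: W_cont_t|exact: W_cont_x]. Qed.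

Let goodZ c f : good f -> good (fun x t => c * f x t).
Proof.
move=> [fx ft]; split=> u /=; first exact: (ccontM (@ccont_cst _ _ c) (fx u)).
exact: (ccontM (@ccont_cst _ _ c) (ft u)).
Qed.

Let goodD f g : good f -> good g -> good (fun x t => f x t + g x t).
Proof.
move=> [fx ft] [gx gt]; split=> u /=; first exact: (ccontD (fx u) (gx u)).
exact: (ccontD (ft u) (gt u)).
Qed.

Let bd_cst c x1 x2 t1 t2 : bd (fun _ _ => c) x1 x2 t1 t2 = 0.
Proof. by rewrite /bd [X in X - _]subrr [X in _ - X]subrr subrr. Qed.

(** The boundary integral of [W] is computed from primitives: [W * kap] and [W] are its
derivatives with respect to [t] and [x]. *)
Let bd_W x1 x2 t1 t2 : x1 <= x2 -> x2 <= 0 -> t1 <= t2 -> bd W x1 x2 t1 t2 = 0.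
Proof.
move=> x12 x20 t12; rewrite /bd.
have It x : cint t1 t2 (fun t => W x t * kap t) =
    (expR (Num.min x 0))%:C * (gam t2 - gam t1).
  have -> : gam t2 - gam t1 = s%:C * (unitc (1 * t2) - unitc (1 * t1)).
    by rewrite /gam !mul1r; ring.
  rewrite -(cint_unitc 1 t12) mulrA -cintZ; last first.
    by apply: ccontM; [exact: ccont_cst|exact: unitc_scale_continuous].
  apply: eq_cint => t _; rewrite /W /kap mul1r.
  have -> : (0 +i* s) = s%:C * (0 +i* 1) :> C.
    by apply/eqP; rewrite eq_complex /= !mul0r !mulr0 mulr1 subr0 addr0 !eqxx.
  by field; exact: gam_neq0.
have Ix t : cint x1 x2 (W ^~ t) = ((expR x2)%:C - (expR x1)%:C) * gam t.
  rewrite [RHS]mulrC -(cint_expR x12).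
  apply: etrans (cintZ _ _ (gam t) expR_ccont).
  apply: eq_cint => x /andP[_ xx2]; rewrite /W mulrC; congr (_ * (expR _)%:C).
  by apply/min_idPl/(le_trans xx2).
have {}It x : x <= 0 -> cint t1 t2 (fun t => W x t * kap t) = (expR x)%:C * (gam t2 - gam t1).
  by move=> x0; apply: etrans (It x) _; rewrite (min_idPl x0).
apply: etrans (congr2 (fun u v => u - v) (congr2 (fun u v => u - v) (It x2 x20)
  (It x1 (le_trans x12 x20))) (congr2 (fun u v => u - v) (Ix t2) (Ix t1))) _.
ring.
Qed.

Let bd_bound f x1 x2 t1 t2 B : good f -> x1 <= x2 -> t1 <= t2 ->
  (forall x t, x1 <= x <= x2 -> t1 <= t <= t2 -> normc (f x t) <= B) ->
  normc (bd f x1 x2 t1 t2) <= 4 * (s / (s - normc a) + 1) * B * ((x2 - x1) + (t2 - t1)).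
Proof.
move=> [fx ft] x12 t12 fB; rewrite /bd.
have K0 : 0 < s / (s - normc a) by rewrite divr_gt0 // subr_gt0.
set K := s / _ in K0 *.
have B0 : 0 <= B by apply: le_trans (normc_ge0 _) (fB x1 t1 _ _); rewrite lexx.
have ck x : continuous (fun t => f x t * kap t) by exact: (ccontM (fx x) kap_cont).
have P x : x1 <= x <= x2 -> normc (cint t1 t2 (fun t => f x t * kap t)) <= 2 * ((t2 - t1) * (B * K)).
  move=> xx; apply: (cint_bound (ck x) t12) => t tt; rewrite normcM.
  exact: (ler_pM (normc_ge0 _) (normc_ge0 _) (fB x t xx tt) (kap_ub t)).
have Q t : t1 <= t <= t2 -> normc (cint x1 x2 (f ^~ t)) <= 2 * ((x2 - x1) * B).
  by move=> tt; apply: (cint_bound (ft t) x12) => x xx; exact: (fB x t xx tt).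
have h1 := P x1; have h2 := P x2; have h3 := Q t1; have h4 := Q t2.
rewrite !lexx ?x12 ?t12 /= in h1 h2 h3 h4.
have {h1 h2 h3 h4} := conj (h1 isT) (conj (h2 isT) (conj (h3 isT) (h4 isT))).
set p1 := cint t1 t2 _; set p2 := cint t1 t2 _; set q1 := cint x1 x2 _; set q2 := cint x1 x2 _.
move=> [h1 [h2 [h3 h4]]].
have := normcD (p2 - p1) (- (q2 - q1)); have := normcD p2 (- p1); have := normcD q2 (- q1).
rewrite !normcN => k1 k2 k3.
have u : 0 <= (x2 - x1) * (B * K) by rewrite mulr_ge0 ?subr_ge0 // mulr_ge0 // ltW.
have v : 0 <= (t2 - t1) * B by rewrite mulr_ge0 ?subr_ge0.
rewrite [leRHS](_ : _ = 4 * ((x2 - x1) * (B * K)) + 4 * ((t2 - t1) * (B * K)) +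
   4 * ((x2 - x1) * B) + 4 * ((t2 - t1) * B)); last by ring.
lra.
Qed.

Let W_lip x1 t1 x2 t2 : x1 <= 0 -> x2 <= 0 ->
  normc (W x2 t2 - W x1 t1) <= 2 * s * (`|x2 - x1| + `|t2 - t1|).
Proof.
move=> x10 x20; rewrite /W !(min_idPl _) //.
have -> : (expR x2)%:C * gam t2 - (expR x1)%:C * gam t1 =
  ((expR x2)%:C - (expR x1)%:C) * gam t2 + (expR x1)%:C * (gam t2 - gam t1) by ring.
have -> : gam t2 - gam t1 = s%:C * (unitc t2 - unitc t1) by rewrite /gam; ring.
apply: (le_trans (normcD _ _)); rewrite !normcM -rmorphB !normc_real.
rewrite mulrDr [2 * s * `|x2 - x1|]mulrC; apply: lerD.
  by apply: ler_pM; rewrite ?normc_ge0 ?gam_ub ?expR_lip.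
rewrite (gtr0_norm s0) gtr0_norm ?expR_gt0 // mulrA.
have e1 : expR x1 <= 1 by rewrite -expR0 ler_expR.
have := unitc_lip t1 t2; have := expR_gt0 x1.
set U := normc _ => e0 uU; apply: (@le_trans _ _ (s * U)); last first.
  by rewrite (mulrC 2) -mulrA ler_wpM2l // ltW.
by rewrite ler_wpM2r ?normc_ge0 // ler_piMl // ltW.
Qed.

(** Goursat: up to an affine function, for which the boundary integral vanishes,
[F] is small near each point compared with the size of the rectangle. *)
Let bd_Phi x1 t1 t2 : x1 <= 0 -> t1 <= t2 -> bd Phi x1 0 t1 t2 = 0.
Proof.
move=> x10 t12; apply/eqP; rewrite -normc_eq0 eq_le normc_ge0 andbT.
have gP : good Phi by split; [exact: Phi_cont_t|exact: Phi_cont_x].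
apply: (@rect_bisection _ (fun x1 x2 t1 t2 => normc (bd Phi x1 x2 t1 t2))) => //.
  move=> p q c d _ pq _ _ cd _.
  rewrite (@bd_add Phi p q c d ((p + q) / 2) ((c + d) / 2)) //; try lra.
  by apply: (le_trans (normcD _ _)); apply: lerD; exact: normcD.
move=> x t /andP[_ x0] tt e e0.
have [l Fl] := Fd (W_in x t).
have K0 : 0 < s / (s - normc a) + 1.
  have : 0 < s / (s - normc a) by rewrite divr_gt0 // subr_gt0.
  lra.
set K := s / (s - normc a) + 1 in K0.
have M0 : 0 < 8 * s * K by rewrite !mulr_gt0.
have [del del0 hdel] := Fl _ (divr_gt0 e0 M0).
exists (del / (4 * s)); first by rewrite divr_gt0 // mulr_gt0.
move=> p q c d px /andP[px' xq] q0 tc /andP[ct td] dt qp dc.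
pose psi x' t' := Phi x' t' + (- (Phi x t - l * W x t) + - l * W x' t').
have g2 : good (fun x' t' => - (Phi x t - l * W x t) + - l * W x' t').
  exact: (goodD (good_cst _) (goodZ (- l) good_W)).
have gpsi : good psi by exact: (goodD gP g2).
have pq : p <= q by lra.
have cd : c <= d by lra.
have -> : bd Phi p q c d = bd psi p q c d.
  apply/esym; apply: etrans (bdD p q c d gP g2) _.
  suff -> : bd (fun x' t' => - (Phi x t - l * W x t) + - l * W x' t') p q c d = 0.
    by rewrite addr0.
  apply: etrans (bdD p q c d (good_cst _) (goodZ (- l) good_W)) _.
  by rewrite bd_cst add0r (bdZ (- l) p q c d good_W) (bd_W pq q0 cd) mulr0.
pose S := (q - p) + (d - c).
have S0 : 0 <= S by rewrite /S; lra.
have psiB x' t' : p <= x' <= q -> c <= t' <= d ->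
    normc (psi x' t') <= e / (8 * s * K) * (2 * s * S).
  move=> /andP[x'1 x'2] /andP[t'1 t'2].
  have WS : normc (W x' t' - W x t) <= 2 * s * S.
    apply: le_trans (W_lip _ _ _ _) _; [lra|lra|].
    apply: ler_wpM2l; first by rewrite mulr_ge0 // ltW.
    rewrite /S; apply: lerD; rewrite ler_norml; apply/andP; split; lra.
  have Wd : normc (W x' t' - W x t) < del.
    apply: (le_lt_trans WS); rewrite mulrC -ltr_pdivlMr ?mulr_gt0 //.
    rewrite (_ : del / (2 * s) = del / (4 * s) + del / (4 * s)); last by field; rewrite gt_eqF.
    rewrite /S; lra.
  have := hdel _ Wd.
  rewrite (_ : a + W x t + (W x' t' - W x t) = a + W x' t'); last by ring.
  rewrite (_ : F _ - F _ - _ = psi x' t'); last by rewrite /psi /Phi; ring.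
  move=> h; apply: (le_trans h); rewrite ler_wpM2l // ltW // divr_gt0 //.
apply: (le_trans (bd_bound gpsi pq cd psiB)).
rewrite -/S -/K le_eqVlt; apply/orP; left; apply/eqP; field.
by rewrite !gt_eqF.
Qed.

Let p0 : (0 : R) <= 2 * pi. Proof. by rewrite mulr_ge0 // pi_ge0. Qed.

(** The boundary integral over [x <= x' <= 0], [0 <= t <= 2 * pi] vanishes, and its two
sides at [t = 0] and [t = 2 * pi] cancel by periodicity. Hence the circle may be
shrunk to [a], where [F] is continuous. *)
Lemma cauchy_kernel_formula :
  cint 0 (2 * pi) (fun t => F (s%:C * unitc t) * kap t) =
  F a * cint 0 (2 * pi) kap.
Proof.
have Phi0 t : Phi 0 t = F (s%:C * unitc t).
  by rewrite /Phi /W minxx expR0 /gam; congr F; ring.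
have shrink x : x <= 0 -> cint 0 (2 * pi) (fun t => F (s%:C * unitc t) * kap t) =
    cint 0 (2 * pi) (fun t => Phi x t * kap t).
  move=> x0.
  have Q : cint x 0 (Phi ^~ (2 * pi)) = cint x 0 (Phi ^~ 0).
    by apply: eq_cint => y _; rewrite /Phi /W /gam unitc2pi unitc0.
  have aux (A B q1 q2 : C) : A - B - (q1 - q2) = 0 -> q1 = q2 -> A = B.
    by move=> h q12; move: h; rewrite q12 subrr subr0 => /eqP; rewrite subr_eq0 => /eqP.
  apply: etrans (aux _ _ _ _ (bd_Phi x0 p0) Q).
  by apply: eq_cint => t _; rewrite Phi0.
rewrite -(cintZ _ _ _ kap_cont); apply/eqP; rewrite -subr_eq0 -normc_eq0.
rewrite eq_le normc_ge0 andbT; apply/ler_addgt0Pr => e e0; rewrite add0r.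
have K0 : 0 < s / (s - normc a) by rewrite divr_gt0 // subr_gt0.
set K := s / (s - normc a) in K0.
have p0' : (0 : R) < 2 * pi by rewrite mulr_gt0 ?pi_gt0.
have pp : 0 < 2 * ((2 * pi) * K) by exact: (mulr_gt0 (ltr0Sn R 1) (mulr_gt0 p0' K0)).
have [l /cderiv_continuous Fc] : exists l, cderiv F a l by apply: Fd; exact: ltW.
have {}Fc := (cvg_normcP (FF:=nbhs_filter a) F (F a)).1 Fc _ (divr_gt0 e0 pp).
have [del del0 hdel] := (nbhs_normcP _ _).1 Fc.
pose x := Num.min 0 (ln (del / (4 * s))).
have x0 : x <= 0 by rewrite /x ge_min lexx.
have ex : expR x * (2 * s) < del.
  have : expR x <= del / (4 * s).
    rewrite -[leRHS]lnK ?posrE ?divr_gt0 ?mulr_gt0 // ler_expR.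
    by rewrite /x ge_min lexx orbT.
  rewrite ler_pdivlMr ?mulr_gt0 // => h.
  have : 0 < expR x * (2 * s) by rewrite mulr_gt0 ?expR_gt0 // mulr_gt0.
  lra.
rewrite (shrink x x0).
rewrite -(cintB _ _ (ccontM (@Phi_cont_t x) kap_cont) (ccontM (@ccont_cst _ _ (F a)) kap_cont)).
have bc : continuous (fun t => Phi x t * kap t - F a * kap t).
  exact: (ccontB (ccontM (@Phi_cont_t x) kap_cont) (ccontM (@ccont_cst _ _ (F a)) kap_cont)).
apply: le_trans (cint_bound (B := e / (2 * ((2 * pi) * K)) * K) bc p0 _) _.
- move=> t _; rewrite -mulrBl normcM ler_pM ?normc_ge0 ?kap_ub //.
  apply: ltW; apply: hdel; rewrite addrC addKr /W normcM normc_real.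
  rewrite gtr0_norm ?expR_gt0 // (min_idPl x0); apply: le_lt_trans ex.
  by rewrite ler_wpM2l ?expR_ge0.
- rewrite subr0 le_eqVlt; apply/orP; left; apply/eqP.
  by have := pi_gt0 R; move: (@pi R) => q q0; field; rewrite (gt_eqF K0) (gt_eqF q0).
Qed.

Let kap_geometric t N : kap t - \sum_(n < N) (0 +i* 1) * a ^+ n / (s%:C * unitc t) ^+ n =
  (a / (s%:C * unitc t)) ^+ N * kap t.
Proof.
have w0 : s%:C * unitc t != 0.
  by rewrite mulf_neq0 ?unitc_neq0 // -normc_eq0 normc_real normr_eq0 gt_eqF.
have -> : kap t = (0 +i* 1) * (s%:C * unitc t) / gam t.
  rewrite /kap mulrA; congr (_ * _ / _).
  by apply/eqP; rewrite eq_complex /= !mul0r !mulr0 mul1r subr0 add0r !eqxx.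
have g0 := gam_neq0 t; move: g0; rewrite /gam; set w := s%:C * unitc t in w0 * => g0.
elim: N => [|N IH]; first by rewrite big_ord0 subr0 expr0 mul1r.
rewrite big_ord_recr /= opprD addrA IH exprSr !expr_div_n.
have := expf_neq0 N w0; move: (w ^+ N) (a ^+ N) => wN aN wN0.
by field; rewrite g0 w0 wN0.
Qed.

(** The geometric series of the Cauchy kernel, with its remainder. *)
Lemma kap_int_expand (G : C -> C) B N : continuous (fun t => G (s%:C * unitc t)) ->
  (forall w, normc w = s -> normc (G w) <= B) ->
  normc (cint 0 (2 * pi) (fun t => G (s%:C * unitc t) * kap t) -
     \sum_(n < N) ((0 +i* 1) * a ^+ n) *
        cint 0 (2 * pi) (fun t => G (s%:C * unitc t) / (s%:C * unitc t) ^+ n)) <=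
  2 * ((2 * pi) * (B * ((normc a / s) ^+ N * (s / (s - normc a))))).
Proof.
move=> Gc GB.
have w0 t : s%:C * unitc t != 0.
  by rewrite mulf_neq0 ?unitc_neq0 // -normc_eq0 normc_real normr_eq0 gt_eqF.
have wc : continuous (fun t => s%:C * unitc t).
  by apply: ccontM; [exact: ccont_cst|exact: unitc_continuous].
have wnc n : continuous (fun t => (s%:C * unitc t) ^+ n).
  elim: n => [|n IH]; first exact: ccont_cst.
  have -> : (fun t => (s%:C * unitc t) ^+ n.+1) =
      (fun t => (s%:C * unitc t) * (s%:C * unitc t) ^+ n) by apply/funext => t; rewrite exprS.
  exact: (ccontM wc IH).
have qc n : continuous (fun t => G (s%:C * unitc t) / (s%:C * unitc t) ^+ n).
  apply: (ccontM Gc) => t; apply: cvgV; [exact: expf_neq0|exact: wnc].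
pose q n t := G (s%:C * unitc t) / (s%:C * unitc t) ^+ n.
have Sc M : continuous (fun t => \sum_(n < M) ((0 +i* 1) * a ^+ n) * q n t) /\
    \sum_(n < M) ((0 +i* 1) * a ^+ n) * cint 0 (2 * pi) (q n) =
    cint 0 (2 * pi) (fun t => \sum_(n < M) ((0 +i* 1) * a ^+ n) * q n t).
  elim: M => [|M [IH1 IH2]].
    split; first by rewrite (_ : (fun t => _) = fun=> 0); [exact: ccont_cst|
      apply/funext => t; rewrite big_ord0].
    transitivity (cint 0 (2 * pi) (fun=> 0 : C)).
      by rewrite big_ord0 cint_period_cst mulr0.
    by apply: eq_cint => t _; rewrite big_ord0.
  have tc : continuous (fun t => ((0 +i* 1) * a ^+ M) * q M t).
    exact: (ccontM (@ccont_cst _ _ _) (qc M)).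
  split.
    rewrite (_ : (fun t => _) = fun t => \sum_(n < M) ((0 +i* 1) * a ^+ n) * q n t +
      ((0 +i* 1) * a ^+ M) * q M t); first exact: (ccontD IH1 tc).
    by apply/funext => t; rewrite big_ord_recr.
  rewrite big_ord_recr /= IH2 -(cintZ _ _ _ (qc M)) -(cintD _ _ IH1 tc).
  by apply: eq_cint => t _; rewrite big_ord_recr.
have [Sc1 ->] := Sc N.
have Gk : continuous (fun t => G (s%:C * unitc t) * kap t) by exact: (ccontM Gc kap_cont).
rewrite -(cintB _ _ Gk Sc1).
have p2 : (0 : R) <= 2 * pi by exact: p0.
rewrite -[X in X * (B * _)](subr0 (2 * pi)).
apply: (cint_bound (ccontB Gk Sc1) p2) => t _.
rewrite (_ : _ - _ = G (s%:C * unitc t) * ((a / (s%:C * unitc t)) ^+ N * kap t)); last first.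
  rewrite -kap_geometric mulrBr mulr_sumr; congr (_ - _); apply: eq_bigr => n _.
  by rewrite /q mulrCA mulrA.
have nw : normc (s%:C * unitc t) = s by rewrite normcM normc_unitc normc_real gtr0_norm ?mulr1.
rewrite normcM; apply: ler_pM (normc_ge0 _) (normc_ge0 _) (GB _ nw) _.
rewrite normcM normcX normcM normcV nw; apply: ler_wpM2l (kap_ub t).
by apply: exprn_ge0; apply: divr_ge0 (normc_ge0 _) (ltW s0).
Qed.

Let ratio_lim (A : R) : (forall e : R, 0 < e -> \forall N \near \oo, A * (normc a / s) ^+ N < e).
Proof.
move=> e e0; have q1 : `|normc a / s| < 1.
  by rewrite ger0_norm ?divr_ge0 ?normc_ge0 ?(ltW s0) // ltr_pdivrMr // mul1r.
have := @cvg_geometric R A _ q1; move/cvgrPdist_lt => /(_ _ e0).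
apply: filterS => N; rewrite /geometric /= sub0r normrN; apply: le_lt_trans; exact: ler_norm.
Qed.

(** The expansion [kap_int_expand] of the constant [1], where only the term of degree [0]
survives. *)
Lemma kap_int : cint 0 (2 * pi) kap = (0 +i* 1) * (2 * pi)%:C.
Proof.
apply/eqP; rewrite -subr_eq0 -normc_eq0 eq_le normc_ge0 andbT.
apply/ler_addgt0Pr => e e0; rewrite add0r.
have [N0 _ hN] := ratio_lim (2 * ((2 * pi) * (s / (s - normc a)))) e0.
have := @kap_int_expand (fun=> 1) 1 N0.+1 (@ccont_cst _ _ _).
have n1 (w : C) : normc w = s -> normc (1 : C) <= 1 by rewrite normc1.
move=> /(_ n1); rewrite big_ord_recl /= expr0 mulr1 big1 ?addr0; last first.
  move=> n _; rewrite (_ : cint _ _ _ = 0) ?mulr0 //.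
  rewrite -(mulr0 (s%:C ^- n.+1)) -(@cint_unitc_period R 0 n.+1) // -cintZ;
    last exact: unitc_scale_continuous.
  apply: eq_cint => t _; rewrite mul1r /= exprMn invfM sub0r mulNr -unitcV -unitcX //.
rewrite (_ : cint _ _ (fun t => 1 / _) = (2 * pi)%:C); last first.
  rewrite -[RHS]mulr1 -cint_period_cst; apply: eq_cint => t _.
  by rewrite expr0 divr1.
rewrite (_ : cint _ _ (fun t => 1 * kap t) = cint 0 (2 * pi) kap); last first.
  by apply: eq_cint => t _; rewrite mul1r.
move/le_trans; apply; apply/ltW; have := hN N0.+1 (leqnSn _).
by congr (_ < _); rewrite mul1r; ring.
Qed.

Definition circle_coef n : C :=
  (2 * pi)%:C^-1 * cint 0 (2 * pi) (fun t => F (s%:C * unitc t) / (s%:C * unitc t) ^+ n).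

(** [cauchy_kernel_formula] followed by the expansion of the kernel. *)
Lemma circle_coef_series B : (forall w, normc w <= s -> normc (F w) <= B) ->
  (fun N => \sum_(n < N) circle_coef n * a ^+ n) @ \oo --> F a.
Proof.
move=> FB; apply/cvg_normcP => e e0.
have P0 : 0 < 2 * @pi R by rewrite mulr_gt0 ?pi_gt0.
have Pn : (2 * pi)%:C != 0 :> C by rewrite -normc_eq0 normc_real normr_eq0 gt_eqF.
have in0 : (0 +i* 1) != 0 :> C by rewrite eq_complex /= oner_eq0 andbF.
apply: filterS (ratio_lim (2 * (B * (s / (s - normc a)))) e0) => N; apply: le_lt_trans.
have FB' w : normc w = s -> normc (F w) <= B by move=> ws; apply: FB; rewrite ws.
have Fc : continuous (fun t => F (s%:C * unitc t)).
  have -> : (fun t => F (s%:C * unitc t)) = Phi 0.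
    by apply/funext => t; rewrite /Phi /W minxx expR0 /gam; congr F; ring.
  exact: Phi_cont_t.
have := kap_int_expand N Fc FB'; rewrite cauchy_kernel_formula kap_int.
have -> : F a * ((0 +i* 1) * (2 * pi)%:C) -
  \sum_(n < N) (0 +i* 1) * a ^+ n *
     cint 0 (2 * pi) (fun t => F (s%:C * unitc t) / (s%:C * unitc t) ^+ n) =
  (0 +i* 1) * (2 * pi)%:C * (F a - \sum_(n < N) circle_coef n * a ^+ n).
  rewrite mulrBr [X in X - _ = _]mulrC mulr_sumr; congr (_ - _); apply: eq_bigr => n _.
  rewrite /circle_coef; move: (cint _ _ _) => I0; move: Pn in0.
  move: (2 * pi)%:C (0 +i* 1) => p i Pn _; by field.
rewrite normcM normcM (_ : normc (0 +i* 1) = 1); last by rewrite /= expr0n /= add0r expr1n sqrtr1.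
rewrite mul1r normc_real gtr0_norm // [normc (F a - _)]normcBC => h.
rewrite -(ler_pM2l P0); apply: (le_trans h).
by rewrite le_eqVlt; apply/orP; left; apply/eqP; ring.
Qed.

End CauchyDisc.

Lemma circle_coef_bound {R : realType} (F : R[i] -> R[i]) (s : R) B n : 0 < s ->
  (forall w, normc w <= s -> exists l, cderiv F w l) ->
  (forall w, normc w <= s -> normc (F w) <= B) ->
  normc (circle_coef F s n) * s ^+ n <= 2 * B.
Proof.
move=> s0 Fd FB; rewrite /circle_coef normcM normcV normc_real.
have P0 : 0 < 2 * @pi R by rewrite mulr_gt0 ?pi_gt0.
rewrite gtr0_norm //.
have ub t : normc (s%:C * unitc t) = s by rewrite normcM normc_unitc normc_real gtr0_norm ?mulr1.
have w0 t : s%:C * unitc t != 0 by rewrite -normc_eq0 ub gt_eqF.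
have wc : continuous (fun t => s%:C * unitc t).
  by apply: ccontM; [exact: ccont_cst|exact: unitc_continuous].
have Fc : continuous (fun t => F (s%:C * unitc t)).
  move=> t; apply: (@continuous_comp _ _ _ (fun t => s%:C * unitc t) F); first exact: wc.
  by have [|l /cderiv_continuous] := Fd (s%:C * unitc t); rewrite ?ub.
have wnc m : continuous (fun t => (s%:C * unitc t) ^+ m).
  elim: m => [|m IH]; first exact: ccont_cst.
  have -> : (fun t => (s%:C * unitc t) ^+ m.+1) =
      (fun t => (s%:C * unitc t) * (s%:C * unitc t) ^+ m) by apply/funext => t; rewrite exprS.
  exact: (ccontM wc IH).
have qc : continuous (fun t => F (s%:C * unitc t) / (s%:C * unitc t) ^+ n).
  apply: (ccontM Fc) => t; apply: cvgV; [exact: expf_neq0|exact: wnc].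
have := @cint_bound R 0 (2 * pi) _ (B / s ^+ n) qc (ltW P0).
rewrite subr0 => h.
apply: (@le_trans _ _ ((2 * pi)^-1 * (2 * ((2 * pi) * (B / s ^+ n))) * s ^+ n)).
  apply: ler_wpM2r; first by rewrite exprn_ge0 // ltW.
  apply: ler_wpM2l; first by rewrite invr_ge0 ltW.
  apply: h => t _; rewrite normcM normcV normcX ub.
  by apply: ler_wpM2r; rewrite ?invr_ge0 ?exprn_ge0 ?(ltW s0) // FB ?ub.
rewrite le_eqVlt; apply/orP; left; apply/eqP; move: P0; move: (2 * pi) => p P0.
by field; rewrite expf_neq0 ?gt_eqF.
Qed.

(** * Ultralimits and averages over roots of unity *)

Section Ultralimits.
Context {R : realType}.
Local Notation C := R[i].

(** The limit is the supremum of the [x] such that [x <= a n] for [U]-almost all [n]. *)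
Lemma ultra_bounded_cvg (T : Type) (U : set_system T) (UU : UltraFilter U)
    (a : T -> R) (M : R) : (forall n, `|a n| <= M) -> exists l : R, a @ U --> l.
Proof.
move=> aM; pose S := [set x : R | U [set n | x <= a n]].
have hS : has_sup S.
  split.
    exists (- M); rewrite /S /= (_ : [set n | _] = setT); first exact: filterT.
    by apply/seteqP; split=> // n _ /=; have := aM n; rewrite ler_norml => /andP[].
  exists M => x xS; have [n /= xa] := filter_ex xS.
  by rewrite (le_trans xa) // (le_trans (ler_norm _)).
exists (sup S); apply/cvgrPdist_lt => e e0.
have [x xS xl] := sup_adherent e0 hS.
have lS : U [set n | a n < sup S + e].
  have [h|] := in_ultra_setVsetC [set n | sup S + e <= a n] UU.
    have : sup S + e <= sup S by apply: ub_le_sup => //; case: hS.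
    by rewrite leNgt ltrDl e0.
  by apply: filterS => n /= /negP; rewrite -ltNge.
have xS' : U [set n | x <= a n] by [].
move: xS' lS; apply: filterS2 => n /= h1 h2; rewrite ltr_norml; apply/andP; split; lra.
Qed.

Lemma ultra_bounded_ccvg (T : Type) (U : set_system T) (UU : UltraFilter U)
    (a : T -> C) (M : R) : (forall n, normc (a n) <= M) ->
  exists2 l : C, a @ U --> l & normc l <= M.
Proof.
move=> aM.
have [x hx] : exists x : R, (fun n => complex.Re (a n)) @ U --> x.
  by apply: (ultra_bounded_cvg UU (M := M)) => n; rewrite (le_trans (normc_Re _)).
have [y hy] : exists y : R, (fun n => complex.Im (a n)) @ U --> y.
  by apply: (ultra_bounded_cvg UU (M := M)) => n; rewrite (le_trans (normc_Im _)).
have al : a @ U --> (x +i* y) by apply/cvg_ReIm.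
exists (x +i* y) => //; apply/ler_addgt0Pr => e e0.
have [n h] := filter_ex ((cvg_normcP (F := U) a (x +i* y)).1 al e e0).
have {}h : normc (a n - (x +i* y)) < e := h.
have := normcB (x +i* y) (a n); rewrite normcBC; have := aM n; lra.
Qed.

End Ultralimits.

Section FourierAverages.
Context {R : realType}.
Local Notation C := R[i].
Local Notation csum := summability.sum.

Definition zeta N : C := unitc (2 * pi / N%:R).

Lemma zetaX N : (0 < N)%N -> zeta N ^+ N = 1.
Proof.
move=> N0; rewrite /zeta unitcX mulrC divfK ?unitc2pi //.
by rewrite pnatr_eq0 -lt0n.
Qed.

Lemma normc_zeta N : normc (zeta N) = 1. Proof. exact: normc_unitc. Qed.

Lemma zeta_neq0 N : zeta N != 0. Proof. exact: unitc_neq0. Qed.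

Lemma zetaX_neq1 N j : (0 < j < N)%N -> zeta N ^+ j != 1.
Proof.
move=> /andP[j0 jN]; rewrite /zeta unitcX unitcE eq_complex negb_and /=.
have N0 : (0 : R) < N%:R by rewrite ltr0n (leq_ltn_trans _ jN).
set x := j%:R * pi / N%:R : R.
have -> : j%:R * (2 * pi / N%:R) = x *+ 2 :> R.
  by rewrite /x -mulr_natl; move: (@pi R) => p; field; rewrite gt_eqF.
have sx : 0 < sin x.
  apply: sin_gt0_pi; apply/andP; split.
    by rewrite /x divr_gt0 // mulr_gt0 ?pi_gt0 ?ltr0n.
  by rewrite ltr_pdivrMr // mulrC ltr_pM2l ?pi_gt0 // ltr_nat.
rewrite cos_mulr2n; apply/orP; left; rewrite lt_eqF //.
have h : 0 < sin x ^+ 2 by exact: exprn_gt0.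
rewrite cos2sin2 mulr2n; lra.
Qed.

Lemma sum_root_of_unity (z : C) N : z ^+ N = 1 -> z != 1 -> \sum_(k < N) z ^+ k = 0.
Proof.
move=> zN z1; have := subrX1 z N; rewrite zN subrr => /esym/eqP.
by rewrite mulf_eq0 subr_eq0 (negbTE z1) /= => /eqP.
Qed.

(** Discrete approximation of the [n]-th Taylor coefficient from [N] points of the
circle of radius [rho]. *)
Definition dft (rho : R) (phi : C -> C) n N : C :=
  N%:R^-1 * \sum_(k < N) phi (rho%:C * zeta N ^+ k) / (rho%:C * zeta N ^+ k) ^+ n.

Lemma dft_kernel_bound N n m :
  normc (N%:R^-1 * \sum_(k < N) (zeta N ^+ k) ^+ m / (zeta N ^+ k) ^+ n) <= 1.
Proof.
case: N => [|N]; first by rewrite big_ord0 mulr0 normc0.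
rewrite normcM normcV normc_nat ler_pdivrMl ?ltr0n // mulr1.
apply: (le_trans (normc_sum _ _ _)).
rewrite (eq_bigr (fun=> 1)); first by rewrite sumr_const card_ord.
by move=> k _; rewrite normcM normcV !normcX normc_zeta !expr1n invr1 mulr1.
Qed.

Lemma dft_kernel N n m : (n < N)%N -> (m < N)%N ->
  N%:R^-1 * \sum_(k < N) (zeta N ^+ k) ^+ m / (zeta N ^+ k) ^+ n = (m == n)%:R.
Proof.
move=> nN mN; have N0 : (0 < N)%N by apply: leq_ltn_trans nN.
have Nn : N%:R != 0 :> C by rewrite -normc_eq0 normc_nat pnatr_eq0 -lt0n.
have zk k : zeta N ^+ k != 0 by rewrite expf_neq0 // zeta_neq0.
case: (ltngtP m n) => [mn|nm|->].
- rewrite (eq_bigr (fun k : 'I_N => ((zeta N)^-1 ^+ (n - m)) ^+ k)).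
    rewrite sum_root_of_unity ?mulr0 //.
      by rewrite -exprM mulnC exprM exprVn zetaX // invr1 expr1n.
    rewrite exprVn invr_eq1 zetaX_neq1 // subn_gt0 mn /=.
    by rewrite (leq_ltn_trans (leq_subr _ _)).
  move=> k _; rewrite -{1}(subnK (ltnW mn)) exprD invfM mulrCA mulfV ?(expf_neq0 _ (zk _)) // mulr1.
  by rewrite -!exprM mulnC !exprVn.
- rewrite (eq_bigr (fun k : 'I_N => (zeta N ^+ (m - n)) ^+ k)).
    rewrite sum_root_of_unity ?mulr0 //.
      by rewrite -exprM mulnC exprM zetaX // expr1n.
    by rewrite zetaX_neq1 // subn_gt0 nm /= (leq_ltn_trans (leq_subr _ _)).
  move=> k _; rewrite -{1}(subnK (ltnW nm)) exprD mulfK ?(expf_neq0 _ (zk _)) //.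
  by rewrite -!exprM mulnC.
- rewrite (eq_bigr (fun=> 1)); last by move=> k _; rewrite mulfV ?(expf_neq0 _ (zk _)).
  by rewrite sumr_const card_ord mulVf.
Qed.

Lemma geometric_bound (q : R) N : 0 <= q -> q < 1 -> \sum_(n < N) q ^+ n <= (1 - q)^-1.
Proof.
move=> q0 q1; rewrite -[leRHS]mul1r ler_pdivlMr ?subr_gt0 //.
have := subrX1 q N; have : 0 <= q ^+ N by exact: exprn_ge0.
move: (q ^+ N) (\sum_(i < N) q ^+ i) => u v; nra.
Qed.

(** Averaging the term of degree [m] gives [0] or [g n], once [N] exceeds [m] and [n], by
orthogonality of characters; dominated convergence allows the limit term by term. *)
Lemma dft_cvg (g : nat -> C) (phi : C -> C) (rho s B : R) n :
  0 < rho -> rho < s -> (forall m, normc (g m) * s ^+ m <= B) ->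
  (forall w, normc w = rho -> csum (fun m => g m * w ^+ m) = phi w) ->
  (fun N => dft rho phi n N) @ \oo --> g n.
Proof.
move=> r0 rs gB gphi; have s0 : 0 < s by exact: lt_trans rs.
have q0 : 0 <= rho / s by rewrite divr_ge0 ?ltW.
have q1 : rho / s < 1 by rewrite ltr_pdivrMr // mul1r.
have B0 : 0 <= B by apply: le_trans (gB 0%N); rewrite mulr_ge0 ?normc_ge0 ?exprn_ge0 // ltW.
have rC : rho%:C != 0 :> C by rewrite -normc_eq0 normc_real normr_eq0 gt_eqF.
pose m_ m := B * (rho / s) ^+ m / rho ^+ n.
have gm m : normc (g m) * rho ^+ m <= B * (rho / s) ^+ m.
  rewrite expr_div_n mulrA ler_pdivlMr ?exprn_gt0 // mulrAC ler_wpM2r //.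
  by rewrite exprn_ge0 // ltW.
have nC m : normc (rho%:C ^+ m) = rho ^+ m by rewrite normcX normc_real gtr0_norm.
pose ker N m := N%:R^-1 * \sum_(k < N) (zeta N ^+ k) ^+ m / (zeta N ^+ k) ^+ n.
pose a N m := g m * rho%:C ^+ m / rho%:C ^+ n * ker N m.
have sg (w : C) : normc w = rho -> abs_summable (fun m => g m * w ^+ m).
  move=> wr; apply: (@abs_summable_nat _ _ (B * (1 - rho / s)^-1)) => N.
  apply: le_trans (ler_wpM2l B0 (geometric_bound N q0 q1)); rewrite mulr_sumr.
  by apply: ler_sum => m _; rewrite normcM normcX wr.
have aE N : csum (a N) = dft rho phi n N.
  have nz k : normc (rho%:C * zeta N ^+ k) = rho.
    by rewrite normcM normcX normc_zeta expr1n mulr1 normc_real gtr0_norm.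
  rewrite /dft (eq_bigr (fun k : 'I_N => csum (fun m =>
    ((rho%:C * zeta N ^+ k) ^+ n)^-1 * (g m * (rho%:C * zeta N ^+ k) ^+ m)))); last first.
    by move=> k _; rewrite (csumZ _ (sg _ (nz k))) gphi // mulrC.
  have [sw <-] := @csum_sum R _ _ (index_enum 'I_N) xpredT (fun (k : 'I_N) m =>
    ((rho%:C * zeta N ^+ k) ^+ n)^-1 * (g m * (rho%:C * zeta N ^+ k) ^+ m))
    (fun k => abs_summableZ _ (sg _ (nz k))).
  rewrite -csumZ //; congr csum; apply/funext => m.
  rewrite /a /ker mulrCA; congr (_ * _); rewrite mulr_sumr; apply: eq_bigr => k _.
  rewrite !exprMn invfM; move: (zeta N ^+ k) => z.
  move: (z ^+ m) (z ^- n) (rho%:C ^+ m) (rho%:C ^- n) => z1 z2 r1 r2; ring.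
rewrite (_ : (fun N => dft rho phi n N) = (fun N => csum (a N))); last first.
  by apply/funext => N; rewrite aE.
have -> : g n = csum (fun m => if m == n then g m else 0) by rewrite csum1.
have rn0 : 0 < rho ^+ n by rewrite exprn_gt0.
have base m : normc (g m * rho%:C ^+ m / rho%:C ^+ n) <= m_ m.
  rewrite normcM normcM normcV !nC ler_pM2r ?invr_gt0 //; exact: gm.
apply: (@csum_dominated R nat \oo _ nat a _ m_ (B * (1 - rho / s)^-1 / rho ^+ n)).
- by move=> m; apply: le_trans (base m); exact: normc_ge0.
- move=> J; have [N h] := @fset_nat_sum_le R m_ J (fun m => le_trans (normc_ge0 _) (base m)).
  apply: (le_trans h); rewrite -mulr_suml ler_pM2r ?invr_gt0 // -mulr_sumr.
  by rewrite ler_wpM2l // geometric_bound.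
- move=> N m; rewrite /a normcM -[leRHS]mulr1.
  by rewrite ler_pM ?normc_ge0 ?dft_kernel_bound.
- move=> m; apply/cvg_normcP => e e0.
  exists (maxn n m).+1 => // N /=; rewrite gtn_max => /andP[nN mN].
  rewrite /a /ker dft_kernel //; case: eqP => [->|_].
    by rewrite mulr1 mulfK ?expf_neq0 // subrr normc0.
  by rewrite mulr0 subrr normc0.
- move=> m; case: eqP => [->|_]; last by rewrite normc0; apply: le_trans (base m); exact: normc_ge0.
  by have := base n; rewrite mulfK ?expf_neq0.
Qed.

End FourierAverages.

(** * Power series expansion on a polydisc *)

Section IteratedSums.
Context {R : realType}.
Local Notation C := R[i].
Local Notation csum := summability.sum.

(** The rows are the fibres of the first projection. *)
Lemma csum_iter (I K : choiceType) (u : I * K -> C) : abs_summable u ->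
  csum (fun i => csum (fun k => u (i, k))) = csum u.
Proof.
move=> su; rewrite -(csum_fiber (fun p : I * K => p.1) su); congr csum; apply/funext => i.
have sk : abs_summable (fun k => u (i, k)).
  have /abs_summableP[B uB] := su; apply/abs_summableP; exists B => J.
  have := uB [fset (i, k) | k in J]%fset; rewrite big_imfset //= => k k' _ _ [].
  by [].
have := @csum_reindex R (I * K)%type K (pair i) (fun p => if p.1 == i then u p else 0).
rewrite /= eqxx => H; apply/esym; apply H => //; first by move=> k k' [].
by move=> [i' k] h; case: eqP => //= e; case: (h k); rewrite e.
Qed.

Lemma mpow_geometric d (rho : 'I_d -> R) (v : 'rV[C]_d) :
  (forall i, 0 < rho i) -> (forall i, normc (v 0 i) < rho i) ->
  forall J : {fset midx d}, \sum_(K <- J) \prod_i (normc (v 0 i) / rho i) ^+ K i <=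
    \prod_i (1 - normc (v 0 i) / rho i)^-1.
Proof.
move=> r0 vr; apply: (midx_sum_prod (g := fun i n => (normc (v 0 i) / rho i) ^+ n)).
  by move=> i n; rewrite exprn_ge0 // divr_ge0 ?normc_ge0 ?ltW.
move=> i N; apply: geometric_bound; first by rewrite divr_ge0 ?normc_ge0 ?ltW.
by rewrite ltr_pdivrMr // mul1r.
Qed.

Lemma normc_mpow d (v : 'rV[C]_d) (K : midx d) :
  normc (mpow v K) = \prod_i normc (v 0 i) ^+ K i.
Proof. by rewrite /mpow normc_prod; apply: eq_bigr => i _; rewrite normcX. Qed.

(** Cauchy-type bounds on the coefficients dominate the terms by a product of geometric
series. *)
Lemma coef_bound_summable d (c : midx d -> C) (rho : 'I_d -> R) B (v : 'rV[C]_d) :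
  (forall i, 0 < rho i) -> (forall K, normc (c K) * \prod_i rho i ^+ K i <= B) ->
  (forall i, normc (v 0 i) < rho i) ->
  (forall K, normc (c K * mpow v K) <= B * \prod_i (normc (v 0 i) / rho i) ^+ K i) /\
  abs_summable (fun K => c K * mpow v K).
Proof.
move=> r0 cB vr.
have h K : normc (c K * mpow v K) <= B * \prod_i (normc (v 0 i) / rho i) ^+ K i.
  rewrite normcM normc_mpow; under [X in _ <= B * X]eq_bigr do rewrite expr_div_n.
  have p0 : 0 < \prod_i rho i ^+ K i by apply: prodr_gt0 => i _; rewrite exprn_gt0.
  rewrite prodf_div mulrA ler_pdivlMr // mulrAC ler_wpM2r ?cB //.
  by apply: prodr_ge0 => i _; rewrite exprn_ge0 ?normc_ge0.
split=> //.
have B0 : 0 <= B.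
  apply: le_trans (cB [ffun=> 0%N]); rewrite mulr_ge0 ?normc_ge0 //.
  by apply: prodr_ge0 => i _; rewrite exprn_ge0 // ltW.
apply: (abs_summable_le h (B := B * \prod_i (1 - normc (v 0 i) / rho i)^-1)) => J.
by rewrite -mulr_sumr ler_wpM2l // mpow_geometric.
Qed.

End IteratedSums.

Section PolydiscExpansion.
Context {R : realType} {d : nat}.
Local Notation C := R[i].
Local Notation csum := summability.sum.
Variables (F : 'rV[C]_d -> C) (rad rho : 'I_d -> R) (B : R).
Hypotheses (rho0 : forall i, 0 < rho i) (rho_rad : forall i, rho i < rad i).
Hypothesis FB : forall z : 'rV[C]_d, (forall j, normc (z 0 j) < rad j) -> normc (F z) <= B.
Hypothesis Fd : forall z : 'rV[C]_d, (forall j, normc (z 0 j) < rad j) ->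
  forall i, exists l, cderiv (fun w => F (set_coord z i w)) (z 0 i) l.

Let inside (z : 'rV[C]_d) := forall j, normc (z 0 j) < rad j.
Let mix (s : seq 'I_d) (v z : 'rV[C]_d) : 'rV[C]_d :=
  \row_j if j \in s then v 0 j else z 0 j.
Let supp_in (s : seq 'I_d) (K : midx d) := [forall i, (i \notin s) ==> (K i == 0%N)].

Lemma set_coordE (z : 'rV[C]_d) i w j : set_coord z i w 0 j = if j == i then w else z 0 j.
Proof. by rewrite mxE. Qed.

Lemma set_coord_set_coord (z : 'rV[C]_d) i w w' :
  set_coord (set_coord z i w) i w' = set_coord z i w'.
Proof. by apply/rowP => j; rewrite !set_coordE; case: eqP. Qed.

Let inside_set z i w : inside z -> normc w < rad i -> inside (set_coord z i w).
Proof. by move=> zi wi j; rewrite set_coordE; case: eqP => [->|]. Qed.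

Let expansion s (z : 'rV[C]_d) (c : midx d -> C) :=
  [/\ forall K, ~~ supp_in s K -> c K = 0,
      forall K, normc (c K) * \prod_i rho i ^+ K i <= B &
      forall v : 'rV[C]_d, (forall i, normc (v 0 i) < rho i) ->
        csum (fun K => c K * mpow v K) = F (mix s v z)].

Let B0 : 0 <= B.
Proof.
apply: le_trans (normc_ge0 (F 0)) (FB _) => j.
by rewrite mxE normc0 (lt_trans (rho0 j) (rho_rad j)).
Qed.

Let expansion_nil z : inside z -> exists c, expansion [::] z c.
Proof.
move=> zi; exists (fun K => if K == [ffun=> 0%N] then F z else 0); split.
- move=> K; case: eqP => // -> /negP; case; apply/forallP => i.
  by rewrite ffunE implybT.
- move=> K; case: eqP => [->|_]; last by rewrite normc0 mul0r.
  by rewrite big1 ?mulr1 ?FB // => i _; rewrite ffunE.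
- move=> v _; rewrite (_ : mix _ _ _ = z); last by apply/rowP => j; rewrite mxE in_nil.
  transitivity (csum (fun K : midx d => if K == [ffun=> 0%N] then F z else 0)); last first.
    exact: (csum1 (fun=> F z)).
  congr csum; apply/funext => K.
  case: eqP => [->|_]; last by rewrite mul0r.
  by rewrite /mpow big1 ?mulr1 // => i _; rewrite ffunE expr0.
Qed.

Let mid i : R := (rho i + rad i) / 2.
Let rho_mid i : rho i < mid i. Proof. by rewrite /mid; have := rho_rad i; lra. Qed.
Let mid_rad i : mid i < rad i. Proof. by rewrite /mid; have := rho_rad i; lra. Qed.
Let mid0 i : 0 < mid i. Proof. exact: lt_trans (rho0 i) (rho_mid i). Qed.

Let mix_inside s (v z : 'rV[C]_d) i w : inside z -> (forall i, normc (v 0 i) < rho i) -> normc w < rad i ->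
  inside (mix s v (set_coord z i w)).
Proof.
move=> zi vr wr j; rewrite mxE; case: ifP => _; first exact: lt_trans (vr j) (rho_rad j).
exact: inside_set.
Qed.

(** The expansions in the variables [s] depend on the new variable [w] in a way of which
nothing is known but the uniform bound, so that they cannot be integrated over a
circle. Averages over the [N]-th roots of unity are finite sums and commute with them;
an ultrafilter provides limits of the averaged coefficients, dominated convergence
identifies their sum with a Taylor coefficient in [w], and the bound [B] is kept. *)
Let expansion_cons i s (z : 'rV[C]_d) : i \notin s ->
  (forall z, inside z -> exists c, expansion s z c) ->
  inside z -> exists c, expansion (i :: s) z c.
Proof.
move=> is_ IH zi.
have [c0 hc0] : exists c0 : C -> midx d -> C, forall w, normc w < rad i ->
    expansion s (set_coord z i w) (c0 w).
  have h w : exists c, normc w < rad i -> expansion s (set_coord z i w) c.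
    have [wr|wr] := ltP (normc w) (rad i); last by exists (fun=> 0).
    by have [c hc] := IH _ (inside_set zi wr); exists c.
  by exists (fun w => xget (fun=> 0) [set c | normc w < rad i -> expansion s (set_coord z i w) c])
    => w wr; case: xgetP => [c _ /=|/(_ _)]; [exact|case: (h w) => c hc /(_ c)].
pose phi (v : 'rV[C]_d) w := F (mix s v (set_coord z i w)).
pose gam (v : 'rV[C]_d) n := circle_coef (phi v) (mid i) n.
have mixE (v : 'rV[C]_d) w : mix s v (set_coord z i w) = set_coord (mix s v z) i w.
  by apply/rowP => j; rewrite !mxE; case: eqP => // ->; rewrite (negbTE is_).
have phid (v : 'rV[C]_d) w : (forall i, normc (v 0 i) < rho i) -> normc w <= mid i ->
    exists l, cderiv (phi v) w l.
  move=> vr wm; have wr := le_lt_trans wm (mid_rad i).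
  have [l hl] := Fd (mix_inside s zi vr wr) i; exists l; move: hl.
  rewrite mixE set_coordE eqxx.
  rewrite (_ : (fun w' => _) = phi v) //; apply/funext => w'.
  by rewrite /phi mixE set_coord_set_coord.
have phiB (v : 'rV[C]_d) w : (forall i, normc (v 0 i) < rho i) -> normc w <= mid i -> normc (phi v w) <= B.
  by move=> vr wm; apply: FB; apply: mix_inside => //; exact: le_lt_trans wm (mid_rad i).
have gamB (v : 'rV[C]_d) n : (forall i, normc (v 0 i) < rho i) -> normc (gam v n) * mid i ^+ n <= 2 * B.
  move=> vr; apply: circle_coef_bound => // w wm; [exact: phid|exact: phiB].
have gam_sum (v : 'rV[C]_d) w : (forall i, normc (v 0 i) < rho i) -> normc w < mid i ->
    abs_summable (fun n => gam v n * w ^+ n) /\ csum (fun n => gam v n * w ^+ n) = phi v w.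
  move=> vr wm.
  have q0 : 0 <= normc w / mid i by rewrite divr_ge0 ?normc_ge0 ?ltW.
  have q1 : normc w / mid i < 1 by rewrite ltr_pdivrMr // mul1r.
  have sg : abs_summable (fun n => gam v n * w ^+ n).
    apply: (@abs_summable_nat _ _ (2 * B * (1 - normc w / mid i)^-1)) => N.
    have B20 : 0 <= 2 * B by rewrite mulr_ge0.
    apply: le_trans (ler_wpM2l B20 (geometric_bound N q0 q1)); rewrite mulr_sumr.
    apply: ler_sum => m _; rewrite normcM normcX expr_div_n mulrA ler_pdivlMr ?exprn_gt0 //.
    by rewrite mulrAC ler_wpM2r ?exprn_ge0 ?normc_ge0 // gamB.
  split=> //; apply: (cvg_unique (@norm_hausdorff _ C^o) (csum_nat sg)).
  exact: (@circle_coef_series R (phi v) (mid i) w (mid0 i) wm (fun w => @phid v w vr) B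
    (fun w => @phiB v w vr)).
have [U [UU NU]] := ultraFilterLemma (@eventually_filter).
pose cN n N (K : midx d) : C := N%:R^-1 * \sum_(k < N)
  c0 ((rho i)%:C * zeta N ^+ k) K / ((rho i)%:C * zeta N ^+ k) ^+ n.
have nz N k : normc ((rho i)%:C * zeta N ^+ k : C) = rho i.
  by rewrite normcM normcX normc_zeta expr1n mulr1 normc_real gtr0_norm.
have nz' N k : normc ((rho i)%:C * zeta N ^+ k : C) < rad i by rewrite nz.
have PK0 (K : midx d) : 0 < \prod_j rho j ^+ K j by apply: prodr_gt0 => j _; rewrite exprn_gt0.
pose M n (K : midx d) : R := B / rho i ^+ n / \prod_j rho j ^+ K j.
have cNB n N K : normc (cN n N K) <= M n K.
  case: N => [|N].
    rewrite /cN big_ord0 mulr0 normc0 /M !divr_ge0 ?exprn_ge0 ?(ltW (PK0 K)) //.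
    exact/ltW.
  rewrite /cN normcM normcV normc_nat ler_pdivrMl ?ltr0n //.
  apply: (le_trans (normc_sum _ _ _)).
  rewrite -[X in _ <= X%:R * _](card_ord N.+1) mulr_natl -sumr_const.
  apply: ler_sum => k _; rewrite normcM normcV normcX nz /M.
  rewrite mulrAC ler_wpM2r ?invr_ge0 ?exprn_ge0 ?(ltW (rho0 i)) //.
  rewrite ler_pdivlMr //; by have [_ h _] := hc0 _ (nz' N.+1 k); exact: h.
have [cL hcL] : exists cL : nat -> midx d -> C, forall n K,
    (fun N => cN n N K) @ U --> cL n K /\ normc (cL n K) <= M n K.
  have h (p : nat * midx d) : exists l : C, (fun N => cN p.1 N p.2) @ U --> l /\ normc l <= M p.1 p.2.
    have [l h1 h2] := ultra_bounded_ccvg UU (fun N => cNB p.1 N p.2).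
    by exists l.
  have [g hg] := choice h.
  by exists (fun n K => g (n, K)) => n K; exact: (hg (n, K)).
have Msum n (v : 'rV[C]_d) : (forall j, normc (v 0 j) < rho j) -> forall J : {fset midx d},
    \sum_(K <- J) M n K * normc (mpow v K) <=
      B / rho i ^+ n * \prod_j (1 - normc (v 0 j) / rho j)^-1.
  move=> vr J.
  rewrite (eq_bigr (fun K : midx d => B / rho i ^+ n * \prod_j (normc (v 0 j) / rho j) ^+ K j)).
    rewrite -mulr_sumr ler_wpM2l ?mpow_geometric // divr_ge0 ?exprn_ge0 //; exact: ltW.
  move=> K _; rewrite /M -mulrA normc_mpow; congr (_ * _).
  by under [RHS]eq_bigr do rewrite expr_div_n; rewrite prodf_div mulrC.
have cLsum n (v : 'rV[C]_d) : (forall j, normc (v 0 j) < rho j) ->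
    csum (fun K => cL n K * mpow v K) = gam v n.
  move=> vr.
  have M0 K : 0 <= M n K * normc (mpow v K).
    rewrite mulr_ge0 ?normc_ge0 //; apply: le_trans (cNB n 0%N K); exact: normc_ge0.
  have h1 : (fun N => csum (fun K => cN n N K * mpow v K)) @ U --> csum (fun K => cL n K * mpow v K).
    apply: (csum_dominated _ M0 (Msum n v vr)).
    - by move=> N K; rewrite normcM ler_wpM2r ?normc_ge0.
    - move=> K; apply: cvgM; [exact: (hcL n K).1|exact: cvg_cst].
    - by move=> K; rewrite normcM ler_wpM2r ?normc_ge0 //; exact: (hcL n K).2.
  have h2 : (fun N => csum (fun K => cN n N K * mpow v K)) @ U --> gam v n.
    rewrite (_ : (fun N => _) = (fun N => dft (rho i) (phi v) n N)).
      have h : (fun N => dft (rho i) (phi v) n N) @ \oo --> gam v n.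
        apply: (@dft_cvg R (gam v) (phi v) (rho i) (mid i) (2 * B)) => //.
          by move=> m; exact: gamB.
        by move=> w wr; apply: (gam_sum v w vr _).2; rewrite wr.
      by apply: cvg_trans h; exact: cvg_app.
    apply/funext => N; rewrite /cN /dft.
    have sk (k : 'I_N) : abs_summable (fun K => c0 ((rho i)%:C * zeta N ^+ k) K * mpow v K).
      have [_ h _] := hc0 _ (nz' N k).
      by have [] := coef_bound_summable rho0 h vr.
    rewrite (eq_bigr (fun k : 'I_N => csum (fun K => (((rho i)%:C * zeta N ^+ k) ^+ n)^-1 *
        (c0 ((rho i)%:C * zeta N ^+ k) K * mpow v K)))); last first.
      move=> k _; rewrite (csumZ _ (sk k)) mulrC; congr (_ * _).
      by have [_ _ ->] := hc0 _ (nz' N k).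
    have [sw <-] := @csum_sum R _ _ (index_enum 'I_N) xpredT (fun (k : 'I_N) K =>
      (((rho i)%:C * zeta N ^+ k) ^+ n)^-1 * (c0 ((rho i)%:C * zeta N ^+ k) K * mpow v K))
      (fun k => abs_summableZ _ (sk k)).
    rewrite -csumZ //; congr csum; apply/funext => K.
    rewrite -mulrA; congr (_ * _); rewrite mulr_suml; apply: eq_bigr => k _.
    by rewrite mulrAC mulrC.
  exact: (cvg_unique (@norm_hausdorff _ C^o) h1 h2).
have cLsupp n K : ~~ supp_in s K -> cL n K = 0.
  move=> sK; have [h1 _] := hcL n K.
  apply: (cvg_unique (@norm_hausdorff _ C^o) h1).
  rewrite (_ : (fun N => _) = fun=> 0); first exact: cvg_cst.
  apply/funext => N; rewrite /cN big1 ?mulr0 // => k _.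
  by have [h _ _] := hc0 _ (nz' N k); rewrite h // mul0r.
pose drop (K : midx d) : midx d := [ffun j => if j == i then 0%N else K j].
pose put (n : nat) (K : midx d) : midx d := [ffun j => if j == i then (K j + n)%N else K j].
have mono_put (x : 'I_d -> R) n K : \prod_j x j ^+ put n K j = x i ^+ n * \prod_j x j ^+ K j.
  rewrite (bigD1 i) //= [in RHS](bigD1 i) //= ffunE eqxx exprD.
  rewrite mulrA [x i ^+ n * _]mulrC; congr (_ * _).
  by apply: eq_bigr => j /negbTE ji; rewrite ffunE ji.
have mono_putC (v : 'rV[C]_d) n K : mpow v (put n K) = v 0 i ^+ n * mpow v K.
  rewrite /mpow (bigD1 i) //= [in RHS](bigD1 i) //= ffunE eqxx exprD.
  rewrite mulrA [v 0 i ^+ n * _]mulrC; congr (_ * _).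
  by apply: eq_bigr => j /negbTE ji; rewrite ffunE ji.
have put_drop (K : midx d) : put (K i) (drop K) = K.
  by apply/ffunP => j; rewrite !ffunE; case: eqP => // ->.
have supp_i n (K : midx d) : cL n K != 0 -> K i = 0%N.
  move=> h; have : supp_in s K by apply: contraNT h => /cLsupp ->.
  by move/forallP => /(_ i); rewrite is_ => /eqP.
exists (fun K : midx d => cL (K i) (drop K)); split.
- move=> K; apply: contraNeq => h; have : supp_in s (drop K).
    by apply: contraNT h => /cLsupp ->.
  move/forallP => hs; apply/forallP => j; rewrite inE negb_or; apply/implyP => /andP[ji js].
  by have := hs j; rewrite js ffunE (negbTE ji).
- move=> K.
  have -> : \prod_j rho j ^+ K j = rho i ^+ K i * \prod_j rho j ^+ drop K j.
    by rewrite -mono_put put_drop.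
  have := (hcL (K i) (drop K)).2; rewrite /M ler_pdivlMr // ler_pdivlMr ?exprn_gt0 //.
  by rewrite mulrA mulrAC.
- move=> v vr; pose u (p : nat * midx d) := v 0 i ^+ p.1 * (cL p.1 p.2 * mpow v p.2).
  have qi0 : 0 <= normc (v 0 i) / rho i by rewrite divr_ge0 ?normc_ge0 ?ltW.
  have qi1 : normc (v 0 i) / rho i < 1 by rewrite ltr_pdivrMr // mul1r.
  have su : abs_summable u.
    have s1 : abs_summable (fun n => (B * (normc (v 0 i) / rho i) ^+ n)%:C : C).
      apply: (@abs_summable_nat _ _ (B * (1 - normc (v 0 i) / rho i)^-1)) => N.
      apply: le_trans (ler_wpM2l B0 (geometric_bound N qi0 qi1)); rewrite mulr_sumr.
      by apply: ler_sum => n _; rewrite normc_real ger0_norm // mulr_ge0 ?exprn_ge0.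
    have s2 : abs_summable (fun K : midx d => (\prod_j (normc (v 0 j) / rho j) ^+ K j)%:C : C).
      apply: abs_summable_le (mpow_geometric rho0 vr) => K.
      rewrite normc_real ger0_norm // prodr_ge0 // => j _.
      by rewrite exprn_ge0 // divr_ge0 ?normc_ge0 ?ltW.
    have [s3 _] := csum_mul s1 s2; apply: abs_summable_dom s3 => -[n K].
    rewrite /u [(n, K).1]/= [(n, K).2]/= normcM [X in _ * X]normcM normcX [leRHS]normcM !normc_real.
    rewrite !ger0_norm ?mulr_ge0 ?exprn_ge0 //; last first.
      by apply: prodr_ge0 => j _; rewrite exprn_ge0 // divr_ge0 ?normc_ge0 ?ltW.
    apply: (@le_trans _ _ (normc (v 0 i) ^+ n * (M n K * normc (mpow v K)))).
      rewrite ler_wpM2l ?exprn_ge0 ?normc_ge0 // ler_wpM2r ?normc_ge0 //.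
      exact: (hcL n K).2.
    rewrite /M normc_mpow le_eqVlt; apply/orP; left; apply/eqP.
    under [in RHS]eq_bigr do rewrite expr_div_n.
    by rewrite prodf_div expr_div_n; ring.
  transitivity (csum u).
    rewrite -(csum_fiber (fun p : nat * midx d => put p.1 p.2) su); congr csum.
    apply/funext => K.
    have -> : mpow v K = v 0 i ^+ K i * mpow v (drop K) by rewrite -mono_putC put_drop.
    rewrite mulrCA -[LHS]/(u (K i, drop K)).
    rewrite -(csum1 u (K i, drop K)); congr csum; apply/funext => -[n K'].
    case: eqP => [[-> ->]|ne] /=; first by rewrite put_drop eqxx.
    case: eqP => // pK; case: (eqVneq (cL n K') 0) => [h|/supp_i h].
      by rewrite /u /= h mul0r mulr0.
    case: ne; rewrite -pK /put /drop !ffunE eqxx h; congr (_, _).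
    by apply/ffunP => j; rewrite !ffunE; case: eqP => // ->.
  rewrite -csum_iter // /u /=.
  have -> : mix (i :: s) v z = mix s v (set_coord z i (v 0 i)).
    by apply/rowP => j; rewrite !mxE inE; case: eqP => // ->; rewrite orTb; case: ifP.
  apply: etrans (gam_sum v (v 0 i) vr (lt_trans (vr i) (rho_mid i))).2.
  congr csum; apply/funext => n; rewrite csumZ ?cLsum 1?mulrC //.
  have hb K : normc (cL n K) * \prod_j rho j ^+ K j <= B / rho i ^+ n.
    by have := (hcL n K).2; rewrite /M ler_pdivlMr.
  by have [] := coef_bound_summable rho0 hb vr.
Qed.

(** The variables are treated one at a time, the others being held fixed; a bound and
differentiability in each variable are all that passes from one step to the next. *)
Theorem polydisc_expansion : exists c : midx d -> C,
  (forall K, normc (c K) * \prod_i rho i ^+ K i <= B) /\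
  (forall z : 'rV[C]_d, (forall i, normc (z 0 i) < rho i) ->
     csum (fun K => c K * mpow z K) = F z).
Proof.
have h s : uniq s -> forall z, inside z -> exists c, expansion s z c.
  elim: s => [_ z|i s IH /= /andP[is_ us] z]; first exact: expansion_nil.
  exact: expansion_cons is_ (IH us).
have z0 : inside 0 by move=> j; rewrite mxE normc0 (lt_trans (rho0 j) (rho_rad j)).
have [c [_ h1 h2]] := h _ (enum_uniq 'I_d) _ z0; exists c; split=> // z zr.
rewrite h2 //; congr F; apply/rowP => j; by rewrite mxE mem_enum.
Qed.

End PolydiscExpansion.

(** * First-order expansions with quadratic errors *)

Section Gradients.
Context {R : realType} {d : nat}.
Local Notation C := R[i].
Implicit Types (F g : 'rV[C]_d -> C) (z h : 'rV[C]_d) (P p : 'I_d -> C) (del S b : R).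

Lemma ge0_Re (x : C) : 0 <= x -> x = (complex.Re x)%:C.
Proof. by move=> x0; rewrite RRe_real // ger0_real. Qed.

Definition rnorm h : R := complex.Re `|h|.

Lemma rnormE h : `|h| = (rnorm h)%:C.
Proof. exact: ge0_Re. Qed.

Lemma rnorm_ge0 h : 0 <= rnorm h.
Proof. by rewrite -lecR -rnormE normr_ge0. Qed.

Lemma coord_le_rnorm h i : normc (h 0 i) <= rnorm h.
Proof.
rewrite -lecR -rnormE -normc_norm -[ `|h| ]/(mx_norm h) mx_normE.
by rewrite -[leLHS]nngE num_le; exact: (le_bigmax _ _ (0, i)).
Qed.

Lemma rnorm_le h (e : R) : 0 <= e -> (forall i, normc (h 0 i) <= e) -> rnorm h <= e.
Proof.
move=> e0 he; have [h0|h0] := eqVneq (mx_norm h) 0.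
  by rewrite /rnorm -[ `|h| ]/(mx_norm h) h0.
have [[i j] hij] := mx_norm_neq0 h0.
rewrite -lecR -rnormE -[ `|h| ]/(mx_norm h) hij /= normc_norm lecR.
by rewrite (ord1 i).
Qed.

Lemma ex_real_gt0 (e : C) : 0 < e -> exists2 e1 : R, 0 < e1 & e = e1%:C.
Proof.
by move=> e0; exists (complex.Re e); [rewrite -ltcR -ge0_Re // ltW|rewrite -ge0_Re // ltW].
Qed.

(** A quadratic bound on the error of the first-order expansion at [z] along [P], in
the polydisc of radius [del]. *)
Definition has_grad F z del P S := forall (s : R) h, 0 <= s <= 1 ->
  (forall i, normc (h 0 i) <= s * del) ->
  normc (F (z + h) - F z - \sum_i P i * h 0 i) <= s ^+ 2 * S.

Lemma ccont_sum (T : topologicalType) (I : Type) (s : seq I) (f : I -> T -> C) :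
  (forall i, continuous (f i)) -> continuous (fun t => \sum_(i <- s) f i t).
Proof.
move=> fc; elim: s => [|i s IH].
  by rewrite (_ : (fun t => _) = fun=> 0);
    [exact: ccont_cst|apply/funext => t; rewrite big_nil].
rewrite (_ : (fun t => _) = fun t => f i t + \sum_(j <- s) f j t).
  exact: (ccontD (fc i) IH).
by apply/funext => t; rewrite big_cons.
Qed.

Definition gradform P h : C := \sum_i P i * h 0 i.

Lemma gradform_linear P : linear (gradform P : 'rV[C]_d -> C).
Proof.
move=> a u v; rewrite /gradform -[a *: \sum_i _]/(a * \sum_i P i * u 0 i) mulr_sumr -big_split; apply: eq_bigr => i _.
by rewrite !mxE /=; ring.
Qed.

HB.instance Definition _ P :=
  GRing.isLinear.Build C 'rV[C]_d C _ (gradform P) (gradform_linear P).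

Lemma gradform_continuous P : continuous (gradform P).
Proof.
apply: ccont_sum => i.
exact: (ccontM (@ccont_cst _ _ (P i)) (@coord_continuous C 1 d 0 i)).
Qed.

(** The scaling parameter [s] of [has_grad] is the ratio of [|h|] to [del]. *)
Lemma has_grad_diff F z del P S : 0 < del -> has_grad F z del P S ->
  differentiable F z /\ forall h, 'd F z h = gradform P h.
Proof.
move=> del0 FP.
have S0 : 0 <= S.
  have := FP 1 0; rewrite ler01 lexx expr1n !mul1r => /(_ isT) H.
  apply: le_trans (H _); first exact: normc_ge0.
  by move=> i; rewrite mxE normc0 ltW.
have e1 : F \o shift z = cst (F z) + (gradform P : 'rV[C]_d -> C) +o_ (0 : 'rV[C]_d) (@id 'rV[C]_d).
  apply/eqaddoP => e' /ex_real_gt0[e e0 ->].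
  have m0 : 0 < Num.min del (e * del ^+ 2 / (S + 1)).
    by rewrite lt_min del0 divr_gt0 ?mulr_gt0 ?exprn_gt0 //; lra.
  apply/nbhs_ballP; exists (Num.min del (e * del ^+ 2 / (S + 1)))%:C; first by rewrite /= ltcR.
  move=> h; rewrite -ball_normE /ball_ /= sub0r normrN rnormE ltcR lt_min => /andP[h1 h2].
  change (`|F (h + z) - (F z + gradform P h)| <= e%:C * (rnorm h)%:C).
  rewrite normc_norm -rmorphM lecR opprD addrA [h + z]addrC.
  apply: le_trans (FP (rnorm h / del) h _ _) _.
  - by rewrite divr_ge0 ?rnorm_ge0 ?(ltW del0) //= ler_pdivrMr // mul1r ltW.
  - by move=> i; rewrite divfK ?gt_eqF // coord_le_rnorm.
  - have h0 := rnorm_ge0 h.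
    rewrite expr_div_n mulrAC ler_pdivrMr ?exprn_gt0 //.
    rewrite (_ : e * _ * _ = rnorm h * (e * del ^+ 2)); last by ring.
    rewrite expr2 -mulrA ler_wpM2l //.
    by move: h2; rewrite ltr_pdivlMr; lra.
have e2 := diff_unique (@gradform_continuous P) e1.
split; last by move=> h; rewrite e2.
by apply/diff_locallyP; rewrite e2; split=> //; exact: gradform_continuous.
Qed.

Lemma gradform_delta P i : gradform P (delta_mx 0 i) = P i.
Proof.
rewrite /gradform (bigD1 i) //= mxE !eqxx mulr1 big1 ?addr0 // => j /negbTE ji.
by rewrite mxE ji andbF mulr0.
Qed.

Lemma has_grad_derive F z del P S i : 0 < del -> has_grad F z del P S ->
  'D_(delta_mx 0 i) F z = P i.
Proof.
move=> del0 /(has_grad_diff del0)[Fd dF].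
by rewrite deriveE // dF gradform_delta.
Qed.

Lemma set_coord_delta z i (w : C) : set_coord z i (z 0 i + w) = w *: delta_mx 0 i + z.
Proof.
apply/rowP => j; rewrite !mxE eqxx /=; case: eqP => [->|_].
  by rewrite mulr1 addrC.
by rewrite mulr0 add0r.
Qed.

Lemma differentiable_cderiv F z i : differentiable F z ->
  cderiv (fun w => F (set_coord z i w)) (z 0 i) ('D_(delta_mx 0 i) F z).
Proof.
move=> Fd e e0.
have /diff_locally/eqaddoP/(_ e%:C) := Fd; rewrite ltcR => /(_ e0) /nbhs_ballP[r' /ex_real_gt0[r r0 ->]] H.
exists r => // w wr.
have := H (w *: delta_mx 0 i).
have nd : rnorm (w *: (delta_mx 0 i : 'rV[C]_d)) <= normc w.
  apply: rnorm_le => [|j]; first exact: normc_ge0.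
  rewrite !mxE eqxx /=; case: eqP => _; rewrite ?mulr1 // mulr0 normc0; exact: normc_ge0.
rewrite -ball_normE /ball_ /= sub0r normrN rnormE ltcR => /(_ (le_lt_trans nd wr)).
change (`|F (w *: delta_mx 0 i + z) - (F z + 'd F z (w *: delta_mx 0 i))| <=
  e%:C * (rnorm (w *: (delta_mx 0 i : 'rV[C]_d)))%:C -> normc (F (set_coord z i (z 0 i + w)) -
    F (set_coord z i (z 0 i)) - 'D_(delta_mx 0 i) F z * w) <= e * normc w).
rewrite linearZ /= -deriveE // -set_coord_delta normc_norm -rmorphM lecR.
rewrite (_ : set_coord z i (z 0 i) = z); last first.
  by apply/rowP => j; rewrite mxE; case: eqP => // ->.
rewrite opprD addrA [_ *: _]mulrC => /le_trans; apply.
by rewrite ler_wpM2l // ltW.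
Qed.

Lemma cderiv_unique (f : C -> C) w l m : cderiv f w l -> cderiv f w m -> l = m.
Proof.
move=> fl fm; apply/eqP; rewrite -subr_eq0 -normc_eq0 eq_le normc_ge0 andbT.
apply/ler_addgt0Pr => e e0; rewrite add0r.
have e2 : 0 < e / 2 by rewrite divr_gt0.
have [d1 d10 h1] := fl _ e2; have [d2 d20 h2] := fm _ e2.
pose h : R := Num.min d1 d2 / 2.
have m0 : 0 < Num.min d1 d2 by rewrite lt_min d10.
have h0 : 0 < h by rewrite divr_gt0.
have nh : normc (h%:C : C) = h by rewrite normc_real gtr0_norm.
have hm : h < Num.min d1 d2 by rewrite /h; lra.
move: hm; rewrite lt_min => /andP[hd1 hd2].
have k1 := h1 h%:C; have k2 := h2 h%:C; rewrite nh in k1 k2.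
rewrite -(ler_pM2r h0) -{1}nh -normcM.
have -> : (l - m) * h%:C = (f (w + h%:C) - f w - m * h%:C) - (f (w + h%:C) - f w - l * h%:C) by ring.
apply: (le_trans (normcD _ _)); rewrite normcN.
by have := k1 hd1; have := k2 hd2; lra.
Qed.

Lemma differentiable_derive_unique F z i l : differentiable F z ->
  cderiv (fun w => F (set_coord z i w)) (z 0 i) l -> 'D_(delta_mx 0 i) F z = l.
Proof. by move=> Fd; apply: cderiv_unique; exact: differentiable_cderiv. Qed.

(** A gradient together with bounds [A], [L], [E] on the value, the linear part and
the quadratic error. The sum of the three is submultiplicative, as it is for the
power series in one variable with these coefficients. *)
Definition jet g z del p b := exists A L E : R,
  [/\ 0 <= A /\ 0 <= L /\ 0 <= E, A + L + E <= b, normc (g z) <= A,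
      (\sum_i normc (p i)) * del <= L & has_grad g z del p E].

Lemma jet_cst (c : C) z del : jet (fun=> c) z del (fun=> 0) (normc c).
Proof.
exists (normc c), 0, 0; split; rewrite ?normc_ge0 ?addr0 //.
  by rewrite big1 ?mul0r // => i _; rewrite normc0.
move=> s h _ _; rewrite subrr sub0r big1 ?oppr0 ?normc0 ?mulr0 // => i _.
by rewrite mul0r.
Qed.

Lemma sum_grad_bound p h del s : 0 < del -> 0 <= s -> (forall i, normc (h 0 i) <= s * del) ->
  normc (\sum_i p i * h 0 i) <= s * ((\sum_i normc (p i)) * del).
Proof.
move=> del0 s0 hs; apply: (le_trans (normc_sum _ _ _)).
rewrite mulrCA mulr_suml; apply: ler_sum => i _.
by rewrite normcM ler_wpM2l ?normc_ge0 // .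
Qed.

Lemma jet_mul f g z del p q b b' : 0 < del -> jet f z del p b -> jet g z del q b' ->
  jet (fun x => f x * g x) z del (fun i => f z * q i + g z * p i) (b * b').
Proof.
move=> del0 [A [L [E [[A0 [L0 E0]] AB fA pL fE]]]] [A' [L' [E' [[A0' [L0' E0']] AB' gA qL gE]]]].
exists (A * A'), (A * L' + L * A'), (A * E' + L * L' + L * E' + E * A' + E * L' + E * E'); split.
- by rewrite !addr_ge0 ?mulr_ge0.
- rewrite [leLHS](_ : _ = (A + L + E) * (A' + L' + E')); last by ring.
  by rewrite ler_pM ?addr_ge0.
- by rewrite normcM ler_pM ?normc_ge0.
- apply: (@le_trans _ _ (A * ((\sum_i normc (q i)) * del) + ((\sum_i normc (p i)) * del) * A')).
    rewrite mulrA [_ * del * A']mulrAC -mulrDl ler_wpM2r ?(ltW del0) //.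
    rewrite mulr_sumr mulr_suml -big_split /=; apply: ler_sum => i _.
    apply: (le_trans (normcD _ _)); rewrite !normcM [normc (g z) * _]mulrC.
    by rewrite lerD // ?ler_wpM2r ?ler_wpM2l ?normc_ge0.
  by rewrite lerD // ?ler_wpM2r ?ler_wpM2l.
- move=> s h /andP[s0 s1] hs.
  have s01 : 0 <= s <= 1 by rewrite s0.
  have := fE s h s01 hs; have := gE s h s01 hs.
  have := sum_grad_bound p del0 s0 hs; have := sum_grad_bound q del0 s0 hs.
  set lf := \sum_i p i * h 0 i; set lg := \sum_i q i * h 0 i.
  have -> : \sum_i (f z * q i + g z * p i) * h 0 i = f z * lg + g z * lf.
    by rewrite /lf /lg !mulr_sumr -big_split; apply: eq_bigr => i _ /=; ring.
  set ef := f (z + h) - f z - lf; set eg := g (z + h) - g z - lg => hlg hlf heg hef.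
  have -> : f (z + h) * g (z + h) - f z * g z - (f z * lg + g z * lf) =
     f z * eg + (lf * lg + (lf * eg + (ef * g z + (ef * lg + ef * eg)))).
    rewrite /ef /eg; ring.
  have {}hlf : normc lf <= s * L by apply: (le_trans hlf); rewrite ler_wpM2l.
  have {}hlg : normc lg <= s * L' by apply: (le_trans hlg); rewrite ler_wpM2l.
  have s2 : s ^+ 2 <= s by rewrite expr2 ler_piMr.
  have s20 : 0 <= s ^+ 2 by rewrite exprn_ge0.
  have hlf1 : normc lf <= L by apply: (le_trans hlf); rewrite ler_piMl.
  have hlg1 : normc lg <= L' by apply: (le_trans hlg); rewrite ler_piMl.
  have heg1 : normc eg <= E' by apply: (le_trans heg); rewrite ler_piMl // (le_trans s2).
  rewrite (_ : s ^+ 2 * _ = A * (s ^+ 2 * E') + ((s * L) * (s * L') + (L * (s ^+ 2 * E') +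
    ((s ^+ 2 * E) * A' + ((s ^+ 2 * E) * L' + (s ^+ 2 * E) * E'))))); last by ring.
  do 5 (apply: (le_trans (normcD _ _)); apply: lerD; first by rewrite normcM ler_pM ?normc_ge0).
  by rewrite normcM ler_pM ?normc_ge0.
Qed.

Lemma jet_coord z del i : 0 < del ->
  jet (fun x => x 0 i) z del (fun j => (j == i)%:R) (normc (z 0 i) + del).
Proof.
move=> del0; exists (normc (z 0 i)), del, 0; split; rewrite ?normc_ge0 ?addr0 ?(ltW del0) //.
  rewrite (bigD1 i) //= eqxx normc1 big1 ?addr0 ?mul1r // => j /negbTE ->.
  by rewrite normc0.
move=> s h _ _; rewrite (bigD1 i) //= eqxx mul1r big1 => [|j /negbTE ->]; last by rewrite mul0r.
rewrite mxE addr0 (_ : _ - _ - _ = 0) ?normc0 ?mulr0 //; ring.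
Qed.

(** The bound is the sum of the geometric series of [1 / (z + h)] at the modulus [del]. *)
Lemma jet_inv_coord z del i : 0 < del -> del < normc (z 0 i) ->
  exists p, jet (fun x => (x 0 i)^-1) z del p (normc (z 0 i) - del)^-1.
Proof.
move=> del0 delz; set N := normc (z 0 i) in delz *.
have N0 : 0 < N by exact: lt_trans delz.
have Nd : 0 < N - del by rewrite subr_gt0.
have z0 : z 0 i != 0 by rewrite -normc_eq0 gt_eqF.
exists (fun j => (j == i)%:R * - (z 0 i) ^- 2).
have sumE h : \sum_j (j == i)%:R * - (z 0 i) ^- 2 * h 0 j = - h 0 i / (z 0 i) ^+ 2.
  rewrite (bigD1 i) //= eqxx mul1r big1 ?addr0 => [|j /negbTE ->]; last by rewrite !mul0r.
  by rewrite mulNr mulrC mulNr.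
exists N^-1, (del / N ^+ 2), (del ^+ 2 / (N ^+ 2 * (N - del))); split.
- by rewrite invr_ge0 !divr_ge0 ?mulr_ge0 ?exprn_ge0 ?(ltW del0) ?(ltW N0) ?(ltW Nd).
- rewrite le_eqVlt; apply/orP; left; apply/eqP; field.
  by rewrite !gt_eqF.
- by rewrite normcV.
- rewrite (bigD1 i) //= eqxx mul1r normcN normcV normcX -/N big1 ?addr0 ?[_ * del]mulrC //.
  by move=> j /negbTE ->; rewrite mul0r normc0.
- move=> s h /andP[s0 s1] hs; rewrite sumE mxE.
  have hi := hs i; set w := h 0 i in hi *.
  have wN : normc w <= del by apply: (le_trans hi); rewrite ler_piMl // ltW.
  have zw : N - del <= normc (z 0 i + w).
    by have := normcD (z 0 i + w) (- w); rewrite addrK normcN -/N; lra.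
  have zw0 : z 0 i + w != 0 by rewrite -normc_eq0 gt_eqF // (lt_le_trans Nd).
  rewrite (_ : _ - _ - _ = w ^+ 2 / ((z 0 i) ^+ 2 * (z 0 i + w))); last first.
    by field; rewrite z0 zw0.
  rewrite normcM normcX normcV normcM normcX -/N mulrA -exprMn.
  apply: ler_pM; rewrite ?exprn_ge0 ?normc_ge0 ?invr_ge0 ?mulr_ge0 ?exprn_ge0 ?normc_ge0 ?(ltW N0) //.
    by rewrite lerXn2r ?nnegrE ?normc_ge0 // mulr_ge0 // ltW.
  rewrite lef_pV2 ?posrE ?mulr_gt0 ?exprn_gt0 //; last exact: lt_le_trans zw.
  by rewrite ler_wpM2l ?exprn_ge0 // ltW.
Qed.

Lemma jet_exp g z del p b n : 0 < del -> jet g z del p b ->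
  exists q, jet (fun x => g x ^+ n) z del q (b ^+ n).
Proof.
move=> del0 gj; elim: n => [|n [q IH]].
  by exists (fun=> 0); have := jet_cst 1 z del; rewrite normc1.
exists (fun i => g z * q i + g z ^+ n * p i); rewrite exprS.
rewrite (_ : (fun x => g x ^+ n.+1) = (fun x => g x * g x ^+ n)); first exact: jet_mul.
by apply/funext => x; rewrite exprS.
Qed.

Lemma jet_prod (I : Type) (s : seq I) (g : I -> 'rV[C]_d -> C) z del (b : I -> R) : 0 < del ->
  (forall i, exists p, jet (g i) z del p (b i)) ->
  exists q, jet (fun x => \prod_(i <- s) g i x) z del q (\prod_(i <- s) b i).
Proof.
move=> del0 gj; elim: s => [|i s [q IH]].
  exists (fun=> 0); have := jet_cst 1 z del; rewrite normc1 big_nil.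
  by rewrite (_ : (fun x => \prod_(i <- [::]) g i x) = fun=> 1) //;
    apply/funext => x; rewrite big_nil.
have [p hp] := gj i; exists (fun j => g i z * q j + (\prod_(i <- s) g i z) * p j); rewrite big_cons.
rewrite (_ : (fun x => \prod_(j <- i :: s) g j x) =
  (fun x => g i x * \prod_(j <- s) g j x)); first exact: jet_mul.
by apply/funext => x; rewrite big_cons.
Qed.

End Gradients.

(** * Power series and their partial derivatives *)

Section PowerSeries.
Context {R : realType} {d : nat}.
Local Notation C := R[i].
Local Notation csum := summability.sum.
Implicit Types (F : 'rV[C]_d -> C) (z h : 'rV[C]_d) (c : midx d -> C) (rho : 'I_d -> R).

Lemma jet_value_bound (g : 'rV[C]_d -> C) z del p b h : 0 < del -> jet g z del p b ->
  (forall i, normc (h 0 i) <= del) -> normc (g (z + h)) <= b.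
Proof.
move=> del0 [A [L [E [[A0 [L0 E0]] AB gA pL gE]]]] hd.
have := gE 1 h; rewrite ler01 lexx expr1n !mul1r => /(_ isT) H.
have h1 i : normc (h 0 i) <= 1 * del by rewrite mul1r.
have := sum_grad_bound p del0 ler01 h1; rewrite mul1r => H2.
have {}H : normc (g (z + h) - g z - \sum_i p i * h 0 i) <= E.
  by apply: H => i; have := hd i.
have -> : g (z + h) = (g (z + h) - g z - \sum_i p i * h 0 i) + (g z + \sum_i p i * h 0 i) by ring.
apply: (le_trans (normcD _ _)); have := normcD (g z) (\sum_i p i * h 0 i); lra.
Qed.

Lemma jet_grad_bound (g : 'rV[C]_d -> C) z del p b i : 0 < del -> jet g z del p b ->
  normc (p i) <= b / del.
Proof.
move=> del0 [A [L [E [[A0 [L0 E0]] AB _ pL _]]]].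
rewrite ler_pdivlMr //; apply: (@le_trans _ _ L); last by lra.
apply: le_trans pL; rewrite ler_wpM2r ?(ltW del0) // (bigD1 i) //= lerDl.
by apply: sumr_ge0 => j _; exact: normc_ge0.
Qed.

(** The quadratic errors of the terms add up to a quadratic error of the sum. *)
Lemma csum_has_grad (I : choiceType) (g : I -> 'rV[C]_d -> C) (p : I -> 'I_d -> C)
    (b : I -> R) (c : I -> C) S F z del : 0 < del ->
  (forall k, jet (g k) z del (p k) (b k)) ->
  (forall J : {fset I}, \sum_(k <- J) normc (c k) * b k <= S) ->
  (forall h, (forall i, normc (h 0 i) <= del) -> F (z + h) = csum (fun k => c k * g k (z + h))) ->
  (forall i, abs_summable (fun k => c k * p k i)) /\
  has_grad F z del (fun i => csum (fun k => c k * p k i)) S.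
Proof.
move=> del0 gj cb FE.
have sp i : abs_summable (fun k => c k * p k i).
  apply: (@abs_summable_le _ _ _ (fun k => normc (c k) * b k / del) (S / del)) => [k|J].
    rewrite normcM -mulrA ler_wpM2l ?normc_ge0 //; exact: jet_grad_bound (gj k).
  by rewrite -mulr_suml ler_wpM2r // invr_ge0 ltW.
split=> // s h /andP[s0 s1] hs.
have hd i : normc (h 0 i) <= del.
  by apply: (le_trans (hs i)); rewrite ler_piMl // ltW.
have sg h' : (forall i, normc (h' 0 i) <= del) -> abs_summable (fun k => c k * g k (z + h')).
  move=> h'd; apply: abs_summable_le cb => k; rewrite normcM ler_wpM2l ?normc_ge0 //.
  exact: jet_value_bound (gj k) h'd.
have h0 i : normc ((0 : 'rV[C]_d) 0 i) <= del by rewrite mxE normc0 ltW.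
have F0 : F z = csum (fun k => c k * g k z) by have := FE 0 h0; rewrite addr0.
have s0' : abs_summable (fun k => c k * g k z) by have := sg 0 h0; rewrite addr0.
rewrite FE // F0 -csumB //; last exact: sg.
have [sl lE] := @csum_sum R I _ (index_enum 'I_d) xpredT (fun i k => h 0 i * (c k * p k i))
  (fun i => abs_summableZ _ (sp i)).
rewrite (eq_bigr (fun i => csum (fun k => h 0 i * (c k * p k i)))); last first.
  by move=> i _; rewrite (csumZ _ (sp i)) mulrC.
rewrite -lE -csumB //; last first.
  have := abs_summableD (sg h hd) (abs_summableZ (-1) s0').
  by congr abs_summable; apply/funext => k; rewrite mulN1r.
apply: csum_le => J; apply: le_trans (ler_wpM2l (exprn_ge0 2 s0) (cb J)).
rewrite mulr_sumr; apply: ler_sum => k _.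
have -> : c k * g k (z + h) - c k * g k z - \sum_(i < d) h 0 i * (c k * p k i) =
    c k * (g k (z + h) - g k z - \sum_i p k i * h 0 i).
  rewrite !mulrBr mulr_sumr; congr (_ - _); apply: eq_bigr => i _; ring.
rewrite normcM mulrCA ler_wpM2l ?normc_ge0 //.
have [A [L [E [[A0 [L0 E0]] AB _ pL gE]]]] := gj k.
apply: (le_trans (gE s h _ hs)); first by rewrite s0.
by rewrite ler_wpM2l ?exprn_ge0 //; lra.
Qed.

Lemma ex_margin (a b : 'I_d -> R) : (forall i, a i < b i) ->
  exists2 del : R, 0 < del & forall i, a i + del < b i.
Proof.
move=> ab; suff [del d0 h] : exists2 del : R, 0 < del & forall i, i \in enum 'I_d -> a i + del < b i.
  by exists del => // i; apply: h; rewrite mem_enum.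
elim: (enum 'I_d) => [|i s [del d0 IH]]; first by exists 1.
have ai : 0 < b i - a i by rewrite subr_gt0.
exists (Num.min del ((b i - a i) / 2)); first by rewrite lt_min d0 divr_gt0.
have m1 : Num.min del ((b i - a i) / 2) <= (b i - a i) / 2 by rewrite ge_min lexx orbT.
have m2 : Num.min del ((b i - a i) / 2) <= del by rewrite ge_min lexx.
move=> j; rewrite inE => /orP[/eqP ->|/IH]; lra.
Qed.

Definition has_ps F c rho := forall z, (forall i, normc (z 0 i) < rho i) ->
  abs_summable (fun K => c K * mpow z K) /\ F z = csum (fun K => c K * mpow z K).

Definition addat (i : 'I_d) (n : nat) (K : midx d) : midx d :=
  [ffun j => if j == i then (K j + n)%N else K j].

Definition rowr (x : 'I_d -> R) : 'rV[C]_d := \row_i (x i)%:C.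

Lemma mpow_rowr (x : 'I_d -> R) (K : midx d) : mpow (rowr x) K = (\prod_i x i ^+ K i)%:C.
Proof. by rewrite rmorph_prod /=; apply: eq_bigr => i _; rewrite mxE rmorphXn. Qed.

Lemma jet_mpow z del (K : midx d) : 0 < del ->
  exists p, jet (fun x : 'rV[C]_d => mpow x K) z del p (\prod_i (normc (z 0 i) + del) ^+ K i).
Proof.
move=> del0; apply: (jet_prod (index_enum 'I_d) (g := fun i x => x 0 i ^+ K i)) => // i.
by apply: jet_exp => //; exact: jet_coord.
Qed.

Lemma cderiv_exp (w : C) n : cderiv (fun x => x ^+ n) w (n%:R * w ^+ n.-1).
Proof.
elim: n => [|n IH]; first by rewrite mul0r; exact: cderiv_cst.
rewrite (_ : (fun x : C => x ^+ n.+1) = (fun x => x * x ^+ n)); last first.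
  by apply/funext => x; rewrite exprS.
have -> : n.+1%:R * w ^+ n.+1.-1 = 1 * w ^+ n + w * (n%:R * w ^+ n.-1) :> C.
  case: n IH => [|n] _ /=; first by rewrite !mul0r mulr0 addr0.
  by rewrite -(natr1 n.+1) exprS; ring.
apply: (cderivM (F := id)) => //.
move=> e e0; exists 1 => // h _; rewrite (_ : _ - _ - _ = 0); last by rewrite /=; ring.
by rewrite normc0 mulr_ge0 ?normc_ge0 // ltW.
Qed.

Lemma cderivZ (f : C -> C) (a w l : C) : cderiv f w l -> cderiv (fun x => a * f x) w (a * l).
Proof.
by move=> fl; have := cderivM (cderiv_cst a w) fl; rewrite mul0r add0r.
Qed.

Lemma derive_mpow z i (K : midx d) : differentiable (fun x : 'rV[C]_d => mpow x K) z /\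
  'D_(delta_mx 0 i) (fun x : 'rV[C]_d => mpow x K) z =
  (K i)%:R * z 0 i ^+ (K i).-1 * \prod_(j | j != i) z 0 j ^+ K j.
Proof.
have [p [A [L [E [_ _ _ _ hp]]]]] := jet_mpow z K ltr01.
have [dz _] := has_grad_diff ltr01 hp; split=> //.
apply: differentiable_derive_unique => //; rewrite mulrC.
rewrite (_ : (fun w => _) = (fun w => (\prod_(j | j != i) z 0 j ^+ K j) * w ^+ K i)).
  exact/cderivZ/cderiv_exp.
apply/funext => w; rewrite /mpow (bigD1 i) //= set_coordE eqxx mulrC; congr (_ * _).
by apply: eq_bigr => j /negbTE ji; rewrite set_coordE ji.
Qed.

Lemma abs_summable_inj (I K : choiceType) (h : K -> I) (u : I -> C) : injective h ->
  abs_summable u -> abs_summable (fun k => u (h k)).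
Proof.
move=> hI /abs_summableP[B uB]; apply/abs_summableP; exists B => J.
by have := uB [fset h k | k in J]%fset; rewrite big_imfset //= => x y _ _; exact: hI.
Qed.

Lemma addat_inj i n : injective (addat i n).
Proof.
move=> x y /ffunP xy; apply/ffunP => j; have := xy j; rewrite !ffunE.
by case: eqP => // _ /addIn.
Qed.

(** The bounds of the jets of the monomials are the monomials at the larger radii
[|z| + del], where the series still converges absolutely. *)
Lemma has_ps_derive F c rho i : (forall j, 0 < rho j) -> has_ps F c rho ->
  (forall z, (forall j, normc (z 0 j) < rho j) -> differentiable F z) /\
  has_ps (fun z => 'D_(delta_mx 0 i) F z) (fun K => (K i).+1%:R * c (addat i 1 K)) rho.
Proof.
move=> rho0 Fc; suff H z : (forall j, normc (z 0 j) < rho j) -> differentiable F z /\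
   (abs_summable (fun K : midx d => ((K i).+1%:R * c (addat i 1 K)) * mpow z K) /\
   'D_(delta_mx 0 i) F z = csum (fun K : midx d => ((K i).+1%:R * c (addat i 1 K)) * mpow z K)).
  by split=> z /H[].
move=> zr; have [del del0 hdel] := ex_margin zr.
have [p hp] := choice (fun K => jet_mpow z K del0).
pose y := rowr (fun j => normc (z 0 j) + del).
have y0 j : 0 <= normc (z 0 j) + del by rewrite addr_ge0 ?normc_ge0 // ltW.
have yr j : normc (y 0 j) < rho j by rewrite mxE normc_real ger0_norm.
have [/abs_summable_bounded[S S0 hS] _] := Fc _ yr.
have cb (J : {fset midx d}) :
    \sum_(K <- J) normc (c K) * \prod_i (normc (z 0 i) + del) ^+ K i <= S.
  apply: le_trans (hS J); apply: ler_sum => K _.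
  rewrite normcM mpow_rowr normc_real ger0_norm //; apply: prodr_ge0 => j _.
  by rewrite exprn_ge0.
have FE h : (forall j, normc (h 0 j) <= del) -> F (z + h) = csum (fun K => c K * mpow (z + h) K).
  move=> hd; have zh j : normc ((z + h) 0 j) < rho j.
    rewrite mxE (le_lt_trans (normcD _ _)) //; have := hd j; have := hdel j; lra.
  by have [_ ->] := Fc _ zh.
have [sp hg] := csum_has_grad del0 hp cb FE.
have [Fd _] := has_grad_diff del0 hg; split=> //.
rewrite (has_grad_derive i del0 hg).
have pE K : p K i = (K i)%:R * z 0 i ^+ (K i).-1 * \prod_(j | j != i) z 0 j ^+ K j.
  have [A [L [E [_ _ _ _ hpK]]]] := hp K.
  by have [_ <-] := derive_mpow z i K; rewrite (has_grad_derive i del0 hpK).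
have uE : (fun K : midx d => ((K i).+1%:R * c (addat i 1 K)) * mpow z K) =
    (fun K => c (addat i 1 K) * p (addat i 1 K) i).
  apply/funext => K; rewrite pE ffunE eqxx addn1 /= /mpow (bigD1 i) //=.
  rewrite [_%:R * c _]mulrC -!mulrA; congr (_ * (_ * (_ * _))).
  by apply: eq_bigr => j /negbTE ji; rewrite ffunE ji.
have su : abs_summable (fun K => c (addat i 1 K) * p (addat i 1 K) i).
  exact: (abs_summable_inj (@addat_inj i 1) (sp i)).
rewrite uE; split=> //.
have [] // := @csum_reindex R (midx d) (midx d) (addat i 1) (fun K => c K * p K i) (@addat_inj i 1).
move=> K hK; rewrite pE; case E : (K i) => [|n]; first by rewrite !mul0r mulr0.
case: (hK [ffun j => if j == i then n else K j]); apply/ffunP => j; rewrite !ffunE.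
by case: eqP => // ->; rewrite E addn1.
Qed.

Lemma has_ps_iter_derive F c rho i n : (forall j, 0 < rho j) -> has_ps F c rho ->
  has_ps (iter n (fun (g : 'rV[C]_d -> C) z => 'D_(delta_mx 0 i) g z) F)
    (fun K => ((K i + n) ^_ n)%:R * c (addat i n K)) rho.
Proof.
move=> rho0 Fc; elim: n => [|n IH].
  rewrite /= (_ : (fun K => _) = c) //; apply/funext => K; rewrite ffactn0 mul1r; congr c.
  by apply/ffunP => j; rewrite ffunE addn0 if_same.
have [_] := has_ps_derive i rho0 IH; rewrite iterS.
rewrite (_ : (fun K => _) = (fun K : midx d => ((K i + n.+1) ^_ n.+1)%:R * c (addat i n.+1 K))) //.
apply/funext => K; rewrite mulrA -natrM; congr (_%:R * c _).
  by rewrite ffunE eqxx addn1 addSnnS ffactnSr addnS -addSn addnK mulnC.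
by apply/ffunP => j; rewrite !ffunE; case: eqP => // _; rewrite -addnA add1n.
Qed.

(** Each block of derivatives shifts the coefficients and multiplies them by falling
factorials; at the origin only the constant coefficient remains. *)
Lemma has_ps_mpartial F c rho (K : midx d) : (forall j, 0 < rho j) -> has_ps F c rho ->
  mpartial K F 0 = (mfact K)%:R * c K.
Proof.
move=> rho0 Fc.
pose shift (s : seq 'I_d) (L : midx d) : midx d := [ffun j => (L j + (if j \in s then K j else 0))%N].
have H s : uniq s -> has_ps (foldr (fun i => iter (K i) (fun (g : 'rV[C]_d -> C) z => 'D_(delta_mx 0 i) g z)) F s)
    (fun L => (\prod_(j <- s) (L j + K j) ^_ (K j))%N%:R * c (shift s L)) rho.
  elim: s => [_|i s IH /= /andP[is_ us]].
    rewrite /= (_ : (fun L => _) = c) //; apply/funext => L.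
    rewrite big_nil mul1r; congr c; apply/ffunP => j; by rewrite ffunE in_nil addn0.
  have := has_ps_iter_derive i (K i) rho0 (IH us).
  rewrite (_ : (fun L : midx d => _) = (fun L : midx d =>
    (\prod_(j <- i :: s) (L j + K j) ^_ (K j))%N%:R * c (shift (i :: s) L))) //.
  apply/funext => L; rewrite mulrA -natrM big_cons; congr (_%:R * c _).
    congr (_ * _)%N; apply: eq_big_seq => j js; rewrite ffunE.
    by case: eqP => // ji; rewrite ji (negbTE is_) in js.
  apply/ffunP => j; rewrite !ffunE inE; case: eqP => [->|_] //=.
  by rewrite (negbTE is_) addn0.
have z0 j : normc ((0 : 'rV[C]_d) 0 j) < rho j by rewrite mxE normc0.
have [_] := H _ (enum_uniq 'I_d) 0 z0; rewrite -/(mpartial K F 0) => ->.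
rewrite (_ : (fun L => _) = (fun L => if L == [ffun=> 0%N] then (mfact K)%:R * c K else 0)).
  exact: (csum1 (fun=> (mfact K)%:R * c K)).
apply/funext => L; case: eqP => [->|L0].
  have -> : mpow (0 : 'rV[C]_d) [ffun=> 0%N] = 1.
    by rewrite /mpow big1 // => i _; rewrite ffunE expr0.
  rewrite mulr1.
  congr (_%:R * c _); last by apply/ffunP => j; rewrite !ffunE mem_enum.
  rewrite /mfact big_enum /=; apply: eq_bigr => j _; by rewrite ffunE ffactnn.
suff -> : mpow (0 : 'rV[C]_d) L = 0 by rewrite mulr0.
have [i Li] : exists i, L i != 0%N.
  apply: contra_notP L0 => h; apply/ffunP => i; rewrite ffunE; apply/eqP.
  by apply: contra_notT h => Li; exists i.
by rewrite /mpow (bigD1 i) //= mxE expr0n (negbTE Li) mul0r.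
Qed.

(** The coefficients are, up to factorials, partial derivatives at the origin. *)
Lemma has_ps_unique F c c' rho : (forall j, 0 < rho j) -> has_ps F c rho -> has_ps F c' rho ->
  c =1 c'.
Proof.
move=> rho0 h1 h2 K.
have n0 : (mfact K)%:R != 0 :> C.
  rewrite -normc_eq0 normc_nat pnatr_eq0 -lt0n.
  by apply: prodn_gt0 => i; exact: fact_gt0.
apply: (mulfI n0).
by rewrite -(has_ps_mpartial K rho0 h1) -(has_ps_mpartial K rho0 h2).
Qed.

Lemma has_ps_subset F c rho rho' : (forall i, rho' i <= rho i) -> has_ps F c rho -> has_ps F c rho'.
Proof. by move=> rr Fc z zr; apply: Fc => i; exact: lt_le_trans (zr i) (rr i). Qed.

Lemma polydisc_has_ps F rad rho B : (forall i, 0 < rho i) -> (forall i, rho i < rad i) ->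
  (forall z, (forall j, normc (z 0 j) < rad j) -> normc (F z) <= B) ->
  (forall z, (forall j, normc (z 0 j) < rad j) ->
     forall i, exists l, cderiv (fun w => F (set_coord z i w)) (z 0 i) l) ->
  exists2 c, has_ps F c rho & forall K, normc (c K) * \prod_i rho i ^+ K i <= B.
Proof.
move=> rho0 rr FB Fd; have [c [cB cF]] := polydisc_expansion rho0 rr FB Fd.
exists c => // z zr; have [_ sc] := coef_bound_summable rho0 cB zr.
by split=> //; rewrite cF.
Qed.

End PowerSeries.

(** * Measurability and integration of dominated series *)

Section ComplexMeasurable.
Context {R : realType} {disp : measure_display} {T : measurableType disp}.
Local Notation C := R[i].
Implicit Types (D : set T) (u v : T -> C).

Definition cmeas D u := measurable_fun D (fun x => complex.Re (u x)) /\
  measurable_fun D (fun x => complex.Im (u x)).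

Lemma cmeas_cst D (c : C) : cmeas D (fun=> c).
Proof. by split; exact: measurable_cst. Qed.

Lemma cmeas_real D (x : T -> R) : measurable_fun D x -> cmeas D (fun t => (x t)%:C).
Proof. by move=> mx; split=> //; exact: measurable_cst. Qed.

Lemma cmeasD D u v : cmeas D u -> cmeas D v -> cmeas D (fun x => u x + v x).
Proof.
move=> [ur ui] [vr vi]; split.
  rewrite (_ : (fun x => _) = (fun x => complex.Re (u x) + complex.Re (v x))).
    exact: measurable_funD.
  by apply/funext => x; rewrite cReD.
rewrite (_ : (fun x => _) = (fun x => complex.Im (u x) + complex.Im (v x))).
  exact: measurable_funD.
by apply/funext => x; rewrite cImD.
Qed.

Lemma cmeasM D u v : cmeas D u -> cmeas D v -> cmeas D (fun x => u x * v x).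
Proof.
move=> [ur ui] [vr vi]; split.
  rewrite (_ : (fun x => _) = (fun x => complex.Re (u x) * complex.Re (v x) -
    complex.Im (u x) * complex.Im (v x))).
    by apply: measurable_funB; exact: measurable_funM.
  by apply/funext => x; rewrite cReM.
rewrite (_ : (fun x => _) = (fun x => complex.Re (u x) * complex.Im (v x) +
  complex.Im (u x) * complex.Re (v x))).
  by apply: measurable_funD; exact: measurable_funM.
by apply/funext => x; rewrite cImM.
Qed.

Lemma cmeasB D u v : cmeas D u -> cmeas D v -> cmeas D (fun x => u x - v x).
Proof.
move=> mu_ mv; rewrite (_ : (fun x => _) = (fun x => u x + (-1) * v x)).
  by apply: cmeasD => //; apply: cmeasM => //; exact: cmeas_cst.
by apply/funext => x; rewrite mulN1r.
Qed.

Lemma cmeasX D u n : cmeas D u -> cmeas D (fun x => u x ^+ n).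
Proof.
move=> mu_; elim: n => [|n IH]; first exact: cmeas_cst.
rewrite (_ : (fun x => _) = (fun x => u x * u x ^+ n)); first exact: cmeasM.
by apply/funext => x; rewrite exprS.
Qed.

Lemma cmeas_prod D (I : Type) (s : seq I) (u : I -> T -> C) : (forall i, cmeas D (u i)) ->
  cmeas D (fun x => \prod_(i <- s) u i x).
Proof.
move=> mu_; elim: s => [|i s IH].
  by rewrite (_ : (fun x => _) = fun=> 1); [exact: cmeas_cst|apply/funext => x; rewrite big_nil].
rewrite (_ : (fun x => _) = (fun x => u i x * \prod_(j <- s) u j x)); first exact: cmeasM.
by apply/funext => x; rewrite big_cons.
Qed.

Lemma cmeas_sum D (I : Type) (s : seq I) (u : I -> T -> C) : (forall i, cmeas D (u i)) ->
  cmeas D (fun x => \sum_(i <- s) u i x).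
Proof.
move=> mu_; elim: s => [|i s IH].
  by rewrite (_ : (fun x => _) = fun=> 0); [exact: cmeas_cst|apply/funext => x; rewrite big_nil].
rewrite (_ : (fun x => _) = (fun x => u i x + \sum_(j <- s) u j x)); first exact: cmeasD.
by apply/funext => x; rewrite big_cons.
Qed.

Lemma cmeas_normc D u : cmeas D u -> measurable_fun D (fun x => normc (u x)).
Proof.
move=> [ur ui]; rewrite (_ : (fun x => _) =
  (@Num.sqrt R) \o (fun x => complex.Re (u x) ^+ 2 + complex.Im (u x) ^+ 2)).
  apply: (@measurableT_comp _ _ _ _ _ _ (@Num.sqrt R)).
    by apply: continuous_measurable_fun; exact: sqrt_continuous.
  by apply: measurable_funD; exact: measurable_funX.
by apply/funext => x /=; case: (u x).
Qed.

Lemma cmeas_cvg D (h : nat -> T -> C) u : (forall n, cmeas D (h n)) ->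
  (forall x, D x -> (fun n => h n x) @ \oo --> u x) -> cmeas D u.
Proof.
move=> mh hu; split.
  apply: (@measurable_fun_cvg _ _ _ _ (fun n x => complex.Re (h n x))) => [n|x Dx].
    by have [] := mh n.
  by have /cvg_ReIm[] := hu x Dx.
apply: (@measurable_fun_cvg _ _ _ _ (fun n x => complex.Im (h n x))) => [n|x Dx].
  by have [] := mh n.
by have /cvg_ReIm[] := hu x Dx.
Qed.

End ComplexMeasurable.

Section SumIntegral.
Context {R : realType} {disp : measure_display} {T : measurableType disp}.
Local Notation C := R[i].
Local Notation csum := summability.sum.
Variables (mu : {measure set T -> \bar R}) (D : set T) (mD : measurable D).

(** An exhausting sequence of finite sets, to which results on limits of sequences of
measurable functions apply. *)
Definition code_below (I : countType) N : {fset I} :=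
  [fset i in pmap (@pickle_inv I) (iota 0 N)]%fset.

Arguments code_below : clear implicits.

Lemma in_code_below (I : countType) N (i : I) : (i \in code_below I N) = (choice.pickle i < N)%N.
Proof.
rewrite inE /= mem_pmap; apply/mapP/idP => [[n]|iN].
  rewrite mem_iota /= add0n => nN /esym h.
  by have := @pickle_invK I n; rewrite h /= => ->.
by exists (choice.pickle i); rewrite ?mem_iota ?pickleK_inv.
Qed.

Lemma code_below_exhausts (I : countType) (J : {fset I}) :
  exists N, forall M, (N <= M)%N -> (J `<=` code_below I M)%fset.
Proof.
have [N hN] := fset_nat_bounded [fset choice.pickle i | i in J]%fset.
exists N => M NM; apply/fsubsetP => i iJ; rewrite in_code_below (leq_trans _ NM) //.
by apply: hN; apply/imfsetP; exists i.
Qed.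

Lemma csum_code_below (I : countType) (v : I -> C) : abs_summable v ->
  (fun N => \sum_(i <- code_below I N) v i) @ \oo --> csum v.
Proof.
move=> sv; apply/cvg_normcP => e e0.
have [J0 hJ0] := (has_csumP _ _).1 (csumP sv) e e0.
have [N hN] := code_below_exhausts J0.
by exists N => // M /= /hN; exact: hJ0.
Qed.

Definition cint_on D u := mu.-integrable D (fun x => (complex.Re (u x))%:E) /\
  mu.-integrable D (fun x => (complex.Im (u x))%:E).

Lemma cint_on_dom (u : T -> C) (G : T -> R) : cmeas D u -> mu.-integrable D (EFin \o G) ->
  (forall x, D x -> normc (u x) <= G x) -> cint_on D u.
Proof.
move=> [ur ui] iG uG; split; apply: (le_integrable mD _ _ iG) => [|x Dx] /=.
- exact/measurable_EFinP.
- by rewrite lee_fin (le_trans (normc_Re _)) // (le_trans (uG x Dx)) // ler_norm.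
- exact/measurable_EFinP.
- by rewrite lee_fin (le_trans (normc_Im _)) // (le_trans (uG x Dx)) // ler_norm.
Qed.

Lemma cintegralB (u v : T -> C) : cint_on D u -> cint_on D v ->
  cintegral mu D (fun x => u x - v x) = cintegral mu D u - cintegral mu D v.
Proof.
move=> [ur ui] [vr vi]; apply/eqP; rewrite eq_complex cReB cImB; apply/andP; split; apply/eqP => /=.
  by rewrite -RintegralB //; apply: eq_Rintegral => x _; exact: cReB.
by rewrite -RintegralB //; apply: eq_Rintegral => x _; exact: cImB.
Qed.

Lemma cintegralZ c (u : T -> C) : cint_on D u ->
  cintegral mu D (fun x => c * u x) = c * cintegral mu D u.
Proof.
move=> [ur ui].
have ir k := integrableZl mD k ur; have ii k := integrableZl mD k ui.
apply/eqP; rewrite eq_complex cReM cImM; apply/andP; split; apply/eqP => /=.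
  rewrite -!RintegralZl // -RintegralB //; last 2 first.
  - exact: ir.
  - exact: ii.
  by apply: eq_Rintegral => x _; exact: cReM.
rewrite -!RintegralZl // -RintegralD //; last 2 first.
- exact: ii.
- exact: ir.
by apply: eq_Rintegral => x _; exact: cImM.
Qed.

Lemma cintegral0 : cintegral mu D (fun=> 0) = 0.
Proof. by rewrite /cintegral /Rintegral /= integral0. Qed.

Lemma cintegral_norm (u : T -> C) (G : T -> R) : cmeas D u -> mu.-integrable D (EFin \o G) ->
  (forall x, D x -> normc (u x) <= G x) ->
  normc (cintegral mu D u) <= 2 * \int[mu]_(x in D) G x.
Proof.
move=> mu_ iG uG; have [ir ii] := cint_on_dom mu_ iG uG.
rewrite (le_trans (normc_ReIm _)) // mulr_natl mulr2n; apply: lerD => /=.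
  apply: (le_trans (le_normr_Rintegral mD ir)); apply: le_Rintegral => //.
    exact: (integrable_norm ir).
  by move=> x Dx; rewrite (le_trans (normc_Re _)) // uG.
apply: (le_trans (le_normr_Rintegral mD ii)); apply: le_Rintegral => //.
  exact: (integrable_norm ii).
by move=> x Dx; rewrite (le_trans (normc_Im _)) // uG.
Qed.

Variables (I : countType) (u : I -> T -> C) (G : T -> R).
Hypothesis mu_ : forall i, cmeas D (u i).
Hypothesis iG : mu.-integrable D (EFin \o G).
Hypothesis uG : forall x, D x -> forall J : {fset I}, \sum_(i <- J) normc (u i x) <= G x.

Let su x : D x -> abs_summable (u ^~ x).
Proof. by move=> Dx; apply/abs_summableP; exists (G x); exact: uG. Qed.

Let nu i x : C := (normc (u i x))%:C.

Let snu x : D x -> abs_summable (nu ^~ x).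
Proof.
move=> Dx; apply: abs_summable_dom (su Dx) => i.
by rewrite normc_real ger0_norm ?normc_ge0.
Qed.

Let tot x : R := complex.Re (csum (nu ^~ x)).

Let tail N x : R := tot x - \sum_(i <- code_below I N) normc (u i x).

Let sum_nu x (J : {fset I}) : \sum_(i <- J) nu i x = (\sum_(i <- J) normc (u i x))%:C.
Proof. by rewrite rmorph_sum. Qed.

Let tot_cvg x : D x -> (fun N => \sum_(i <- code_below I N) normc (u i x)) @ \oo --> tot x.
Proof.
move=> Dx; have /cvg_ReIm[+ _] := csum_code_below (snu Dx).
by under eq_fun do rewrite sum_nu.
Qed.

Let tot_ge x (J : {fset I}) : D x -> \sum_(i <- J) normc (u i x) <= tot x.
Proof.
move=> Dx; apply/ler_addgt0Pr => e e0.
have /cvgrPdist_lt/(_ e e0)[N _ hN] := tot_cvg Dx.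
have [M hM] := code_below_exhausts J.
have := hN (maxn N M) (leq_maxl _ _); rewrite ltr_norml => /andP[h _].
have := @fset_sum_subset _ _ (fun i => normc (u i x)) _ _ (fun i => normc_ge0 _)
  (hM _ (leq_maxr N M)).
move: h; rewrite /=; lra.
Qed.

Let tot_le x : D x -> tot x <= G x.
Proof.
move=> Dx; rewrite -(cvg_lim (@Rhausdorff R) (tot_cvg Dx)); apply: limr_le.
  by apply/cvg_ex; exists (tot x); exact: tot_cvg.
by apply: nearW => N; exact: uG.
Qed.

Let tail_ge0 N x : D x -> 0 <= tail N x.
Proof. by move=> Dx; rewrite subr_ge0 tot_ge. Qed.

Let tail_le N x : D x -> tail N x <= G x.
Proof.
move=> Dx; apply: le_trans (tot_le Dx); rewrite lerBlDr lerDl sumr_ge0 // => i _.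
exact: normc_ge0.
Qed.

Let rem_le N x (J : {fset I}) : D x -> (code_below I N `<=` J)%fset ->
  normc (csum (u ^~ x) - \sum_(i <- J) u i x) <= tail N x.
Proof.
move=> Dx NJ; apply: csum_approx (su Dx) _ => J' JJ'.
rewrite lerBrDr; apply: le_trans (tot_ge (J `|` J')%fset Dx).
rewrite [leRHS](big_fsetID _ (mem J)) /= addrC; apply: lerD.
  apply: fset_sum_subset; first by move=> i; exact: normc_ge0.
  apply/fsubsetP => i iJ'; rewrite !inE /= iJ' orbT /=.
  exact: (fdisjointP JJ' _ iJ').
apply: fset_sum_subset; first by move=> i; exact: normc_ge0.
by apply/fsubsetP => i iN; have iJ := fsubsetP NJ _ iN; rewrite !inE /= iJ.
Qed.

Let mtot : measurable_fun D tot.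
Proof.
apply: (@measurable_fun_cvg _ _ _ _ (fun N x => \sum_(i <- code_below I N) normc (u i x))).
  by move=> N; apply: measurable_sum => i; exact: cmeas_normc.
exact: tot_cvg.
Qed.

Let mtail N : measurable_fun D (tail N).
Proof.
apply: measurable_funB => //; apply: measurable_sum => i; exact: cmeas_normc.
Qed.

Let itail N : mu.-integrable D (EFin \o tail N).
Proof.
apply: (le_integrable mD _ _ iG) => [|x Dx] /=; first exact/measurable_EFinP.
by rewrite lee_fin ger0_norm ?tail_ge0 // (le_trans (tail_le N Dx)) // ler_norm.
Qed.

Lemma cmeas_csum : cmeas D (fun x => csum (u ^~ x)).
Proof.
apply: (@cmeas_cvg _ _ _ _ (fun N x => \sum_(i <- code_below I N) u i x)).
  by move=> N; exact: cmeas_sum.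
by move=> x Dx; exact: csum_code_below (su Dx).
Qed.

Let tail_int : (fun N => \int[mu]_(x in D) tail N x) @ \oo --> 0.
Proof.
have h1 : {ae mu, forall x, D x -> (fun N => (EFin \o tail N) x) @ \oo --> (cst 0%E : T -> \bar R) x}.
  apply: aeW => x Dx /=; apply: cvg_EFin; first by apply: nearW.
  change ((fun N => tail N x) @ \oo --> (0 : R)); rewrite -(subrr (tot x)).
  by apply: cvgB; [exact: cvg_cst|exact: tot_cvg].
have h2 : {ae mu, forall x N, D x -> (`|(EFin \o tail N) x| <= (EFin \o G) x)%E}.
  by apply: aeW => x N Dx /=; rewrite lee_fin ger0_norm ?tail_ge0 ?tail_le.
have [_ _] := @dominated_convergence _ _ _ mu D mD (fun N => EFin \o tail N) (cst 0%E) (EFin \o G)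
  (fun N => (measurable_EFinP _ _).2 (@mtail N)) (measurable_cst _) h1 iG h2.
rewrite integral0 => H; exact: (fine_cvg H).
Qed.

(** [t] is the remainder of the series of moduli, whose integral tends to [0] by dominated
convergence. *)
Lemma sum_L1_tail (e : R) : 0 < e -> exists J0 : {fset I}, forall J, (J0 `<=` J)%fset ->
  exists2 t : T -> R, mu.-integrable D (EFin \o t) & \int[mu]_(x in D) t x < e /\
    forall x, D x -> 0 <= t x /\ normc (csum (u ^~ x) - \sum_(i <- J) u i x) <= t x.
Proof.
move=> e0; have /cvgrPdist_lt/(_ e e0)[N _ hN] := tail_int.
exists (code_below I N) => J NJ; exists (tail N) => //; split; last first.
  by move=> x Dx; split; [exact: tail_ge0|exact: rem_le].
have := hN N (leqnn N); rewrite /= sub0r normrN; apply: le_lt_trans; exact: ler_norm.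
Qed.

Lemma csum_cint_on : cint_on D (fun x => csum (u ^~ x)).
Proof.
apply: (@cint_on_dom _ G) => //; first exact: cmeas_csum.
move=> x Dx; apply: csum_le => J; exact: uG.
Qed.

Lemma term_cint_on i : cint_on D (u i).
Proof.
apply: (@cint_on_dom _ G) => // x Dx.
by have := uG Dx [fset i]%fset; rewrite big_seq_fset1.
Qed.

Let cintegral_fsum (J : seq I) : cint_on D (fun x => \sum_(i <- J) u i x) /\
  cintegral mu D (fun x => \sum_(i <- J) u i x) = \sum_(i <- J) cintegral mu D (u i).
Proof.
elim: J => [|i J [IH1 IH2]].
  rewrite (_ : (fun x => _) = fun=> 0); last by apply/funext => x; rewrite big_nil.
  by rewrite cintegral0 big_nil; split=> //; split; exact: integrable0.
have eq1 : (fun x => \sum_(j <- i :: J) u j x) = (fun x => u i x - - \sum_(j <- J) u j x).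
  by apply/funext => x; rewrite big_cons opprK.
have [ir ii] := term_cint_on i; have [jr ji] := IH1.
have hN : cint_on D (fun x => - \sum_(j <- J) u j x) /\
    cintegral mu D (fun x => - \sum_(j <- J) u j x) = - \sum_(j <- J) cintegral mu D (u j).
  have z0 : cint_on D (fun=> 0) by split; exact: integrable0.
  have := cintegralB z0 IH1; rewrite cintegral0 sub0r IH2.
  rewrite (_ : (fun x => 0 - _) = (fun x => - \sum_(j <- J) u j x)); last first.
    by apply/funext => x; rewrite sub0r.
  move=> ->; split=> //; split.
    rewrite (_ : (fun x => _) = (fun x => - (complex.Re (\sum_(j <- J) u j x))%:E)%E).
      exact: integrableN.
    by apply/funext => x; rewrite -[- _]sub0r cReB sub0r.
  rewrite (_ : (fun x => _) = (fun x => - (complex.Im (\sum_(j <- J) u j x))%:E)%E).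
    exact: integrableN.
  by apply/funext => x; rewrite -[- _]sub0r cImB sub0r.
have [[nr ni] nE] := hN.
split; last by rewrite eq1 cintegralB ?nE ?opprK ?big_cons //; exact: term_cint_on.
rewrite eq1; split.
  rewrite (_ : (fun x => _) = ((fun x => (complex.Re (u i x))%:E) \-
     (fun x => (complex.Re (- \sum_(j <- J) u j x))%:E))%E); first exact: integrableB.
  by apply/funext => x; rewrite cReB.
rewrite (_ : (fun x => _) = ((fun x => (complex.Im (u i x))%:E) \-
     (fun x => (complex.Im (- \sum_(j <- J) u j x))%:E))%E); first exact: integrableB.
by apply/funext => x; rewrite cImB.
Qed.

Lemma abs_summable_cintegral : abs_summable (fun i => cintegral mu D (u i)).
Proof.
have n_le i x : D x -> normc (u i x) <= G x.
  by move=> Dx; have := uG Dx [fset i]%fset; rewrite big_seq_fset1.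
have n_int i : mu.-integrable D (EFin \o (fun x => normc (u i x))).
  apply: (le_integrable mD _ _ iG) => [|x Dx] /=.
    exact/measurable_EFinP/cmeas_normc.
  by rewrite lee_fin ger0_norm ?normc_ge0 // (le_trans (n_le i x Dx)) // ler_norm.
have sumE (J : seq I) : mu.-integrable D (EFin \o (fun x => \sum_(i <- J) normc (u i x))) /\
    \int[mu]_(x in D) (\sum_(i <- J) normc (u i x)) = \sum_(i <- J) \int[mu]_(x in D) normc (u i x).
  elim: J => [|i J [IH1 IH2]].
    rewrite (_ : (fun x => _) = fun=> 0); last by apply/funext => x; rewrite big_nil.
    by split; [exact: integrable0|rewrite big_nil /Rintegral /= integral0].
  rewrite (_ : (fun x => _) = (fun x => normc (u i x) + \sum_(j <- J) normc (u j x))); last first.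
    by apply/funext => x; rewrite big_cons.
  rewrite big_cons -IH2 -RintegralD //; split=> //; exact: (integrableD mD (n_int i) IH1).
apply/abs_summableP; exists (2 * \int[mu]_(x in D) G x) => J.
apply: (@le_trans _ _ (\sum_(i <- J) 2 * \int[mu]_(x in D) normc (u i x))).
  by apply: ler_sum => i _; apply: cintegral_norm.
rewrite -mulr_sumr ler_wpM2l //; have [iJ <-] := sumE (enum_fset J).
by apply: le_Rintegral => // x Dx; exact: uG.
Qed.

(** The remainder of the integrals is at most twice the integral of the remainder, which
[sum_L1_tail] makes small. *)
Lemma cintegral_csum : partial_sum (fun i => cintegral mu D (u i)) @ totally -->
  cintegral mu D (fun x => csum (u ^~ x)).
Proof.
apply/has_csumP => e e0.
have [J0 hJ0] := sum_L1_tail (divr_gt0 e0 (ltr0n R 3)).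
exists J0 => J /hJ0[t it [te ht]].
have [h1 h2] := cintegral_fsum J; rewrite -h2 normcBC -cintegralB //; last exact: csum_cint_on.
apply: le_lt_trans (cintegral_norm _ it _) _.
- by apply: cmeasB; [exact: cmeas_csum|exact: cmeas_sum].
- by move=> x /ht[].
- lra.
Qed.

Lemma summable_integrals : summable [set: I] (fun i => \int[mu]_(x in D) (normc (u i x))%:E)%E.
Proof.
rewrite /summable; apply: (@le_lt_trans _ _ (\int[mu]_(x in D) `|(G x)%:E|)%E); last first.
  by case/integrableP : iG.
apply: ge_ereal_sup => _ [A [fA _] <-].
rewrite fsbig_finite //=.
have m i : measurable_fun D (fun x => (normc (u i x))%:E).
  by apply/measurable_EFinP; exact: cmeas_normc.
under eq_bigr => i _.
  rewrite gee0_abs; last by apply: integral_ge0 => x _; rewrite lee_fin normc_ge0.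
  over.
rewrite -ge0_integral_sum //; last by move=> i x _; rewrite lee_fin normc_ge0.
apply: ge0_le_integral => //.
- by move=> x _; apply: sume_ge0 => i _; rewrite lee_fin normc_ge0.
- by apply: emeasurable_sum.
- apply/measurable_EFinP; apply: measurableT_comp => //.
  by apply/measurable_EFinP; case/integrableP : iG.
- by move=> x Dx; rewrite sumEFin lee_fin (le_trans (uG Dx _)) // ler_norm.
Qed.

Lemma L1_cvg_totally :
  (fun J : {fset I} => \int[mu]_(x in D) (normc (csum (u ^~ x) - partial_sum (u ^~ x) J))%:E)%E
    @ totally --> 0%E.
Proof.
have H (e : R) : 0 < e -> exists J0 : {fset I}, forall J, (J0 `<=` J)%fset ->
   (0 <= \int[mu]_(x in D) (normc (csum (u ^~ x) - partial_sum (u ^~ x) J))%:E < e%:E)%E.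
  move=> e0; have [J0 hJ0] := sum_L1_tail e0.
  exists J0 => J /hJ0[t it [te ht]].
  rewrite integral_ge0 /=; last by move=> x _; rewrite lee_fin normc_ge0.
  apply: (@le_lt_trans _ _ (\int[mu]_(x in D) (t x)%:E)%E); last first.
    by rewrite -[ltLHS]fineK ?lte_fin // integrable_fin_num.
  apply: ge0_le_integral => //.
  - by move=> x _; rewrite lee_fin normc_ge0.
  - apply/measurable_EFinP/cmeas_normc/cmeasB; first exact: cmeas_csum.
    under eq_fun do rewrite partial_sumE; exact: cmeas_sum.
  - by case/integrableP : it.
  - by move=> x Dx; rewrite lee_fin partial_sumE; have [] := ht x Dx.
apply/fine_cvgP; split.
  have [J0 hJ0] := H 1 ltr01; exists J0 => // J /= /hJ0 /andP[h1 h2].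
  by rewrite ge0_fin_numE // (lt_trans h2) // ltry.
apply/cvgrPdist_lt => e e0; have [J0 hJ0] := H e e0; exists J0 => // J /= /hJ0 /andP[h1 h2].
rewrite sub0r normrN ger0_norm ?fine_ge0 //.
by rewrite -lte_fin fineK // ge0_fin_numE // (lt_trans h2) // ltry.
Qed.

End SumIntegral.

(** * The exponential series *)

Section ExponentialSeries.
Context {R : realType} {d : nat}.
Local Notation C := R[i].
Local Notation csum := summability.sum.
Implicit Types (x z : 'rV[C]_d) (K : midx d).

Lemma nonneg_sum_le_csum (I : choiceType) (v : I -> R) (J : {fset I}) : (forall i, 0 <= v i) ->
  abs_summable (fun i => (v i)%:C) -> \sum_(i <- J) v i <= complex.Re (csum (fun i => (v i)%:C)).
Proof.
move=> v0 sv; apply/ler_addgt0Pr => e e0.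
have [J0 hJ0] := (has_csumP _ _).1 (csumP sv) e e0.
have := hJ0 (J0 `|` J)%fset (fsubsetUl _ _); rewrite -rmorph_sum.
set s := csum _ => h.
have := le_lt_trans (normc_Re _) h; rewrite cReB /= ltr_norml => /andP[_ h2].
have := fset_sum_subset v0 (fsubsetUr J0 J); lra.
Qed.

Lemma normc_cexp_le x z :
  normc (cexp (dotc z x)) <= expR (\sum_i normc (z 0 i) * normc (x 0 i)).
Proof.
rewrite normc_cexp ler_expR; apply: (le_trans (ler_norm _)); apply: (le_trans (normc_Re _)).
by apply: (le_trans (normc_sum _ _ _)); apply: ler_sum => i _; rewrite normcM.
Qed.

Lemma cderiv_exp_slice x z i :
  cderiv (fun w => cexp (dotc (set_coord z i w) x)) (z 0 i) (cexp (dotc z x) * x 0 i).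
Proof.
have E w : dotc (set_coord z i w) x = (\sum_(j | j != i) z 0 j * x 0 j) + w * x 0 i.
  rewrite /dotc (bigD1 i) //= set_coordE eqxx addrC; congr (_ + _).
  by apply: eq_bigr => j /negbTE ji; rewrite set_coordE ji.
rewrite (_ : (fun w => _) =
  (fun w => cexp ((\sum_(j | j != i) z 0 j * x 0 j) + w * x 0 i))); last first.
  by apply/funext => w; rewrite E.
rewrite (_ : dotc z x = (\sum_(j | j != i) z 0 j * x 0 j) + z 0 i * x 0 i).
  by apply: cderiv_affine; exact: cderiv_cexp.
by rewrite -E; congr dotc; apply/rowP => j; rewrite set_coordE; case: eqP => // ->.
Qed.

Lemma mpow0 x : mpow x [ffun=> 0%N] = 1.
Proof. by rewrite /mpow big1 // => i _; rewrite ffunE expr0. Qed.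

Lemma mfact0 : mfact ([ffun=> 0%N] : midx d) = 1%N.
Proof. by rewrite /mfact big1 // => i _; rewrite ffunE fact0. Qed.

Lemma mfact_neq0 K : (mfact K)%:R != 0 :> C.
Proof.
rewrite -normc_eq0 normc_nat pnatr_eq0 -lt0n.
by apply: prodn_gt0 => i; exact: fact_gt0.
Qed.

Lemma mpow_addat x i n K : mpow x (addat i n K) = x 0 i ^+ n * mpow x K.
Proof.
rewrite /mpow (bigD1 i) //= [in RHS](bigD1 i) //= ffunE eqxx exprD.
rewrite mulrA [x 0 i ^+ n * _]mulrC; congr (_ * _).
by apply: eq_bigr => j /negbTE ji; rewrite ffunE ji.
Qed.

Lemma mfact_addat1 i K : mfact (addat i 1 K) = ((K i).+1 * mfact K)%N.
Proof.
rewrite /mfact (bigD1 i) //= [in RHS](bigD1 i) //= ffunE eqxx addn1 factS -mulnA.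
by congr (_ * (_ * _))%N; apply: eq_bigr => j /negbTE ji; rewrite ffunE ji.
Qed.

Lemma midx_ind (Q : midx d -> Prop) : Q [ffun=> 0%N] ->
  (forall i K, Q K -> Q (addat i 1 K)) -> forall K, Q K.
Proof.
move=> Q0 QS K; have [n] := ubnP (\sum_i K i); elim: n K => // n IH K; rewrite ltnS => Kn.
have [[i Ki]|K0] := pselect (exists i, K i != 0%N); last first.
  rewrite (_ : K = [ffun=> 0%N]) //; apply/ffunP => i; rewrite ffunE; apply/eqP.
  by apply: contra_notT K0 => Li; exists i.
pose K' : midx d := [ffun j => if j == i then (K i).-1 else K j].
have -> : K = addat i 1 K'.
  by apply/ffunP => j; rewrite !ffunE; case: eqP => // ->; rewrite addn1 prednK // lt0n.
apply: QS; apply: IH; apply: leq_trans Kn.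
rewrite (bigD1 i) //= [X in (_ < X)%N](bigD1 i) //= ffunE eqxx.
rewrite (eq_bigr (fun j => K j)) => [|j /negbTE ji]; last by rewrite ffunE ji.
by rewrite ltn_add2r ltn_predL lt0n.
Qed.

(** The power series of the exponential, from its differential equation and the
uniqueness of the coefficients. *)
Lemma exp_has_ps x (rho : 'I_d -> R) : (forall i, 0 < rho i) ->
  has_ps (fun th => cexp (dotc th x)) (fun K => mpow x K / (mfact K)%:R) rho.
Proof.
move=> rho0; set F := fun th => _.
have rho1 i : rho i < rho i + 1 by rewrite ltrDl.
have FB z : (forall j, normc (z 0 j) < rho j + 1) ->
    normc (F z) <= expR (\sum_i (rho i + 1) * normc (x 0 i)).
  move=> zr; apply: (le_trans (normc_cexp_le x z)); rewrite ler_expR; apply: ler_sum => i _.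
  by rewrite ler_wpM2r ?normc_ge0 // ltW.
have Fd z : (forall j, normc (z 0 j) < rho j + 1) ->
    forall i, exists l, cderiv (fun w => F (set_coord z i w)) (z 0 i) l.
  by move=> _ i; exists (F z * x 0 i); exact: cderiv_exp_slice.
have [c Fc _] := polydisc_has_ps rho0 rho1 FB Fd.
suff cE K : c K = mpow x K / (mfact K)%:R.
  by rewrite (_ : (fun K => mpow x K / (mfact K)%:R) = c) //; apply/funext => K; rewrite cE.
have rec i K' : (K' i).+1%:R * c (addat i 1 K') = x 0 i * c K'.
  have [Fdiff h1] := has_ps_derive i rho0 Fc.
  have h2 : has_ps (fun z => 'D_(delta_mx 0 i) F z) (fun K => x 0 i * c K) rho.
    move=> z zr; have [sc Fz] := Fc z zr; split.
      have := abs_summableZ (x 0 i) sc; congr abs_summable.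
      by apply/funext => L; rewrite mulrA.
    rewrite (differentiable_derive_unique (Fdiff z zr) (cderiv_exp_slice x z i)) -[cexp _]/(F z) Fz mulrC.
    by rewrite -(csumZ _ sc); congr csum; apply/funext => L; rewrite mulrA.
  exact: (has_ps_unique rho0 h1 h2 K').
elim/midx_ind: K => [|i K IH].
  rewrite mpow0 mfact0 divr1.
  have := has_ps_mpartial [ffun=> 0%N] rho0 Fc; rewrite mfact0 mul1r => <-.
  rewrite /mpartial; elim: (enum 'I_d) => [|i s IH] /=.
    by rewrite /F /dotc big1 ?cexp0 // => i _; rewrite mxE mul0r.
  by rewrite ffunE.
have n0 : (K i).+1%:R != 0 :> C by rewrite -normc_eq0 normc_nat pnatr_eq0.
apply: (mulfI n0); rewrite rec IH mpow_addat expr1 mfact_addat1 natrM invfM.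
have := mfact_neq0 K; move: n0; move: (K i).+1%:R (mfact K)%:R (mpow x K) => p q r p0 q0.
by field; rewrite p0 q0.
Qed.

(** At the moduli the series has nonnegative terms and sums to the exponential. *)
Lemma exp_terms_le (q : 'I_d -> R) x z : (forall i, normc (z 0 i) <= q i) ->
  forall J : {fset midx d},
    \sum_(K <- J) normc (mpow x K / (mfact K)%:R * mpow z K) <= expR (\sum_i q i * normc (x 0 i)).
Proof.
move=> zq J; have q0 i : 0 <= q i by apply: le_trans (zq i); exact: normc_ge0.
pose y : 'rV[C]_d := rowr (fun i => normc (x 0 i)).
pose r : 'rV[C]_d := rowr q.
have rho0 (i : 'I_d) : 0 < q i + 1 by have := q0 i; lra.
have rr i : normc (r 0 i) < q i + 1 by rewrite mxE normc_real ger0_norm // ltrDl.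
have [sy Ey] := exp_has_ps y rho0 rr.
pose v (K : midx d) : R := (\prod_i normc (x 0 i) ^+ K i) / (mfact K)%:R * \prod_i q i ^+ K i.
have vE : (fun K => mpow y K / (mfact K)%:R * mpow r K) = (fun K => (v K)%:C).
  apply/funext => K; rewrite !mpow_rowr /v !rmorphM /= fmorphV rmorph_nat //.
have v0 K : 0 <= v K.
  rewrite /v mulr_ge0 ?divr_ge0 ?prodr_ge0 // => i _; rewrite exprn_ge0 ?normc_ge0 //.
rewrite vE in sy Ey.
have := nonneg_sum_le_csum J v0 sy; rewrite -Ey.
have -> : dotc r y = (\sum_i q i * normc (x 0 i))%:C.
  by rewrite rmorph_sum; apply: eq_bigr => i _; rewrite !mxE -rmorphM.
rewrite cexp_real /=; apply: le_trans; apply: ler_sum => K _.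
rewrite /v 2!normcM normcV normc_nat !normc_mpow ler_wpM2l //.
  by rewrite divr_ge0 // prodr_ge0 // => i _; rewrite exprn_ge0 ?normc_ge0.
apply: ler_prod => i _; rewrite exprn_ge0 ?normc_ge0 //=.
by rewrite lerXn2r ?nnegrE ?normc_ge0.
Qed.

End ExponentialSeries.

(** * The moment-generating function *)

Section MgfSeries.
Context {R : realType} {d : nat} {disp : measure_display} {T : measurableType disp}.
Context {P : probability T R} (X : {RV P >-> d.-tuple R}) (Rad : 'I_d -> \bar R).
Local Notation C := R[i].
Local Notation csum := summability.sum.
Hypothesis M_defined : mgf_defined X Rad.

Definition mgf_coef (K : midx d) : C :=
  cintegral P setT (fun w => mpow (cvec (X w)) K / (mfact K)%:R).

Definition expabs (q : 'I_d -> R) (x : d.-tuple R) : R := expR (\sum_i q i * `|tnth x i|).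

Lemma exp_cvec_le (q : 'I_d -> R) (x : d.-tuple R) (z : 'rV[C]_d) : (forall i, normc (z 0 i) <= q i) ->
  forall J : {fset midx d},
    \sum_(K <- J) normc (mpow (cvec x) K / (mfact K)%:R * mpow z K) <= expabs q x.
Proof.
move=> zq J; apply: le_trans (exp_terms_le (cvec x) zq J) _; rewrite /expabs.
by under eq_bigr do rewrite mxE normc_real.
Qed.

Lemma measurable_tnth_norm i : measurable_fun [set: d.-tuple R] (fun x => `|tnth x i|).
Proof. by apply: measurableT_comp => //; exact: measurable_tnth. Qed.

Lemma measurable_expabs q : measurable_fun [set: d.-tuple R] (expabs q).
Proof.
apply: measurableT_comp => //; apply: measurable_sum => i.
by apply: measurable_funM; [exact: measurable_cst|exact: measurable_tnth_norm].
Qed.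

Lemma measurable_RV : measurable_fun [set: T] X.
Proof. exact: measurable_funP. Qed.

Lemma expabs_integrable q : (forall i, 0 <= q i) -> (forall i, ((q i)%:E < Rad i)%E) ->
  P.-integrable setT (EFin \o (expabs q \o X)).
Proof.
move=> q0 qR; apply/integrableP; split.
  apply/measurable_EFinP; apply: measurableT_comp; first exact: measurable_expabs.
  exact: measurable_RV.
have := M_defined q0 qR; rewrite unlock; apply: le_lt_trans.
rewrite le_eqVlt; apply/orP; left; apply/eqP; apply: eq_integral => w _ /=.
by rewrite ger0_norm // expR_ge0.
Qed.

Lemma expabs_integrable_dist q : (forall i, 0 <= q i) -> (forall i, ((q i)%:E < Rad i)%E) ->
  (distribution P X).-integrable setT (EFin \o expabs q).
Proof.
move=> q0 qR.
have m : measurable_fun setT (EFin \o expabs q).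
  by apply/measurable_EFinP; exact: measurable_expabs.
apply/integrableP; split=> //.
rewrite ge0_integral_distribution //; last exact: measurableT_comp.
by have /integrableP[_] := expabs_integrable q0 qR.
Qed.

Lemma cmeas_mpow K : cmeas [set: d.-tuple R] (fun x => mpow (cvec x) K).
Proof.
apply: cmeas_prod => i; apply: cmeasX.
rewrite (_ : (fun x => _) = (fun x => (tnth x i)%:C)); last by apply/funext => x; rewrite mxE.
by apply: cmeas_real; exact: measurable_tnth.
Qed.

Lemma cmeas_comp (g : d.-tuple R -> C) : cmeas setT g -> cmeas setT (g \o X).
Proof.
by move=> [gr gi]; split; [exact: (measurableT_comp gr measurable_RV)|exact: (measurableT_comp gi measurable_RV)].
Qed.

Lemma mgf_terms_dominated (q : 'I_d -> R) (z : 'rV[C]_d) : (forall i, normc (z 0 i) <= q i) ->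
  forall w, [set: T] w -> forall J : {fset midx d},
    \sum_(K <- J) normc (mpow z K * (mpow (cvec (X w)) K / (mfact K)%:R)) <= (expabs q \o X) w.
Proof.
move=> zq w _ J; apply: le_trans (exp_cvec_le (X w) zq J).
by apply: ler_sum => K _; rewrite mulrC.
Qed.

Lemma cmeas_mgf_term (c : C) (K : midx d) :
  cmeas [set: T] (fun w => c * (mpow (cvec (X w)) K / (mfact K)%:R)).
Proof.
apply: cmeasM; first exact: cmeas_cst.
apply: cmeasM; last exact: cmeas_cst.
exact: (cmeas_comp (cmeas_mpow K)).
Qed.

(** The exponential series may be integrated term by term, as it is dominated by
[expabs rho]. *)
Lemma mgf_has_ps (rho : 'I_d -> R) : (forall i, 0 < rho i) ->
  (forall i, ((rho i)%:E < Rad i)%E) -> has_ps (mgf X) mgf_coef rho.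
Proof.
move=> rho0 rR z zr.
pose u (K : midx d) w := mpow z K * (mpow (cvec (X w)) K / (mfact K)%:R).
have zq i : normc (z 0 i) <= rho i by exact: ltW.
have mu_ K : cmeas setT (u K) by exact: cmeas_mgf_term.
have iG := expabs_integrable (fun i => ltW (rho0 i)) rR.
have uG := mgf_terms_dominated zq.
(* The factor [mpow z K] may vanish, so integrability is read off at the radii. *)
have iK K : cint_on P setT (fun w => mpow (cvec (X w)) K / (mfact K)%:R).
  have rq i : normc (rowr rho 0 i : C) <= rho i by rewrite mxE normc_real gtr0_norm.
  have mk := mpow_rowr rho K.
  have p0 : 0 < \prod_i rho i ^+ K i by apply: prodr_gt0 => i _; rewrite exprn_gt0.
  have iG' : P.-integrable setT (EFin \o (fun w => (\prod_i rho i ^+ K i)^-1 * (expabs rho \o X) w)).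
    exact: (integrableZl measurableT _ iG).
  apply: (cint_on_dom measurableT _ iG').
    have := cmeas_mgf_term 1 K; congr cmeas; apply/funext => w; by rewrite mul1r.
  move=> w _; rewrite ler_pdivlMl //.
  have := mgf_terms_dominated rq (w := w) I [fset K]%fset.
  by rewrite big_seq_fset1 mk normcM normc_real gtr0_norm.
have cE K : cintegral P setT (u K) = mgf_coef K * mpow z K.
  by rewrite cintegralZ // mulrC.
have sc := abs_summable_cintegral measurableT mu_ iG uG.
have E : (fun K => mgf_coef K * mpow z K) = (fun K => cintegral P setT (u K)).
  by apply/funext => K; rewrite cE.
rewrite E; split=> //.
have h1 := cintegral_csum measurableT mu_ iG uG.
rewrite (has_csum_eq h1) /mgf; congr cintegral; apply/funext => w.
have [_ ->] := exp_has_ps (cvec (X w)) rho0 zr.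
by congr csum; apply/funext => K; rewrite /u mulrC.
Qed.

End MgfSeries.

(** * Contour integrals of Laurent series *)

Section TorusIntegrals.
Context {R : realType}.
Local Notation C := R[i].
Local Notation csum := summability.sum.
Local Notation leb := (@lebesgue_measure R).

Lemma cmeas_unitc_scale (D : set R) (x : R) : cmeas D (fun t : R => unitc (x * t)).
Proof.
split; apply: measurable_funTS; apply: continuous_measurable_fun.
  exact: (continuous_Re (@unitc_scale_continuous _ x)).
exact: (continuous_Im (@unitc_scale_continuous _ x)).
Qed.

(** On a circle each term is a multiple of a character, and only trivial characters have
a nonzero integral. *)
Lemma circle_integral_csum (I : countType) (c : I -> C) (n m : I -> nat) (rho B : R) (h : C -> C) :
  0 < rho ->
  (forall J : {fset I}, \sum_(k <- J) normc (c k) * (rho ^+ n k / rho ^+ m k) <= B) ->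
  (forall w, normc w = rho -> h w = csum (fun k => c k * (w ^+ n k / w ^+ m k))) ->
  circle_integral rho h =
    csum (fun k => c k * (if (n k).+1 == m k then 0 +i* (2 * pi) else 0)).
Proof.
move=> r0 cB hE.
have rC : rho%:C != 0 :> C by rewrite -normc_eq0 normc_real normr_eq0 gt_eqF.
have nC : normc (rho%:C : C) = rho by rewrite normc_real gtr0_norm.
pose a k : C := c k * (rho%:C ^+ (n k).+1 / rho%:C ^+ m k) * (0 +i* 1).
pose u k t := a k * unitc (((n k).+1%:R - (m k)%:R) * t).
have wE t : rho%:C * cexp (0 +i* t) = rho%:C * unitc t by rewrite unitc_cexp.
have nw t : normc (rho%:C * unitc t) = rho by rewrite normcM normc_unitc nC mulr1.
have w0 t : rho%:C * unitc t != 0 by rewrite -normc_eq0 nw gt_eqF.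
have n1 : normc (0 +i* 1 : C) = 1 by rewrite /= expr0n /= add0r expr1n sqrtr1.
have uN k t : normc (u k t) = normc (c k) * (rho ^+ n k / rho ^+ m k) * rho.
  rewrite /u /a normcM normc_unitc mulr1 normcM n1 mulr1 2!normcM normcV !normcX nC.
  by rewrite exprS -!mulrA; congr (_ * _); rewrite mulrC -mulrA.
have uE k t : c k * ((rho%:C * unitc t) ^+ n k / (rho%:C * unitc t) ^+ m k) *
    ((0 +i* 1) * (rho%:C * unitc t)) = u k t.
  rewrite /u /a mulrBl unitcD -unitcV -(unitcX _ (n k).+1) -(unitcX _ (m k)) !exprMn invfM !exprS.
  move: (unitc t) (unitc t ^+ n k) (unitc t ^- m k) (rho%:C ^+ n k) (rho%:C ^- m k) (0 +i* 1).
  by move=> x1 x2 x3 x4 x5 x6; ring.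
have su w : normc w = rho -> abs_summable (fun k => c k * (w ^+ n k / w ^+ m k)).
  move=> wr; apply: abs_summable_le cB => k.
  by rewrite normcM normcM normcV !normcX wr.
have mD : measurable (`[0, 2 * pi] : set R) by exact: measurable_itv.
have mu_ k : cmeas `[0, 2 * pi] (u k).
  by apply: cmeasM; [exact: cmeas_cst|exact: cmeas_unitc_scale].
have iG : leb.-integrable `[0, 2 * pi] (EFin \o (fun=> B * rho)).
  by apply: continuous_integrable => t; exact: cst_continuous.
have uG t : `[0, 2 * pi]%classic t -> forall J : {fset I}, \sum_(k <- J) normc (u k t) <= B * rho.
  move=> _ J; under eq_bigr do rewrite uN; rewrite -mulr_suml ler_wpM2r ?cB //; exact: ltW.
rewrite /circle_integral.
have -> : (fun t : R => let w := rho%:C * cexp (0 +i* t) in h w * ((0 +i* 1) * w)) =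
    (fun t => csum (u ^~ t)).
  apply/funext => t.
  transitivity (((0 +i* 1) * (rho%:C * unitc t)) * h (rho%:C * unitc t)).
    by rewrite -wE; exact: mulrC.
  rewrite hE ?nw // -(csumZ _ (su _ (nw t))); congr (csum _).
  by apply/funext => k; rewrite -uE; exact: mulrC.
rewrite -(has_csum_eq (@cintegral_csum R _ (measurableTypeR R) leb _ mD _ _ _ mu_ iG uG)); congr (csum _); apply/funext => k.
rewrite -(cintE 0 (2 * pi)) (cintZ _ _ _ (@unitc_scale_continuous _ _)) /a.
case: eqP => [e|/eqP ne].
  rewrite e mulfV ?expf_neq0 // mulr1 -mulrA; congr (_ * _).
  rewrite (_ : cint _ _ _ = (2 * pi)%:C).
    by apply/eqP; rewrite eq_complex /= !mul0r !mulr0 subrr mul1r add0r !eqxx.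
  rewrite -[RHS]mulr1 -cint_period_cst; apply: eq_cint => t _.
  by rewrite subrr mul0r unitc0.
by rewrite cint_unitc_period // !mulr0.
Qed.

(** After some of the variables have been integrated, the others still lie on their
circles and the sum has the same form in them. *)
Lemma torus_integral_csum d (I : countType) (c : I -> C) (n m : I -> 'I_d -> nat)
    (rho : 'I_d -> R) (B : R) (h : 'rV[C]_d -> C) : (forall i, 0 < rho i) ->
  (forall J : {fset I},
     \sum_(k <- J) normc (c k) * \prod_i (rho i ^+ n k i / rho i ^+ m k i) <= B) ->
  (forall th : 'rV[C]_d, (forall i, normc (th 0 i) = rho i) ->
     h th = csum (fun k => c k * \prod_i (th 0 i ^+ n k i / th 0 i ^+ m k i))) ->
  torus_integral rho h =
    csum (fun k => c k * \prod_i (if (n k i).+1 == m k i then 0 +i* (2 * pi) else 0 : C)).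
Proof.
move=> r0 cB hE.
pose fac (s : seq 'I_d) (th : 'rV[C]_d) k i : C :=
  if i \in s then (if (n k i).+1 == m k i then 0 +i* (2 * pi) else 0)
  else th 0 i ^+ n k i / th 0 i ^+ m k i.
have pi0 : 0 < 2 * @pi R by rewrite mulr_gt0 ?pi_gt0.
pose q k i : R := rho i ^+ n k i / rho i ^+ m k i.
have q0 k i : 0 < q k i by rewrite divr_gt0 ?exprn_gt0.
(* The factor [1 + 2 * pi * rho i] covers a variable before and after integration. *)
have facB (s : seq 'I_d) (th : 'rV[C]_d) k i : (i \notin s -> normc (th 0 i) = rho i) ->
    normc (fac s th k i) <= (1 + 2 * pi * rho i) * q k i.
  move=> hth; have pr : 0 < 2 * pi * rho i by rewrite mulr_gt0.
  rewrite /fac; case: ifPn => [_|/hth hi]; last first.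
    by rewrite normcM normcV !normcX hi -/(q k i) ler_peMl ?ltW // ltrDl.
  case: eqP => [e|_]; last by rewrite normc0 ltW // mulr_gt0 // addr_gt0.
  have -> : normc (0 +i* (2 * pi) : C) = 2 * pi.
    by rewrite /= expr0n /= add0r sqrtr_sqr gtr0_norm.
  have -> : q k i = (rho i)^-1.
    by rewrite /q -e exprS invfM mulrCA mulfV ?mulr1 // expf_neq0 // gt_eqF.
  by rewrite ler_pdivlMr // mulrDl mul1r lerDr ltW.
have H s : uniq s -> forall th : 'rV[C]_d, (forall i, i \notin s -> normc (th 0 i) = rho i) ->
    foldr (fun i (g : 'rV[C]_d -> C) th => circle_integral (rho i) (fun w => g (set_coord th i w))) h s th =
    csum (fun k => c k * \prod_i fac s th k i).
  elim: s => [_ th hth|i s IH /= /andP[is_ us] th hth].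
    by rewrite /= hE //; move=> i; exact: hth.
  pose c' k := c k * \prod_(j | j != i) fac s th k j.
  have split_fac w k : \prod_j fac s (set_coord th i w) k j =
      (w ^+ n k i / w ^+ m k i) * \prod_(j | j != i) fac s th k j.
    rewrite (bigD1 i) //= {1}/fac (negbTE is_) set_coordE eqxx; congr (_ * _).
    by apply: eq_bigr => j /negbTE ji; rewrite /fac set_coordE ji.
  rewrite (@circle_integral_csum I c' (n ^~ i) (m ^~ i) (rho i)
    ((\prod_j (1 + 2 * pi * rho j)) * B)) //.
  - congr csum; apply/funext => k; rewrite /c' -mulrA; congr (_ * _).
    rewrite [RHS](bigD1 i) //= mulrC {2}/fac inE eqxx; congr (_ * _).
    by apply: eq_bigr => j /negbTE ji; rewrite /fac inE ji.
  - move=> J; have CP : 0 <= \prod_j (1 + 2 * pi * rho j).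
      by apply: prodr_ge0 => j _; rewrite addr_ge0 // !mulr_ge0 ?pi_ge0 // ltW.
    apply: le_trans (ler_wpM2l CP (cB J)); rewrite mulr_sumr; apply: ler_sum => k _.
    rewrite /c' normcM normc_prod -/(q k i) -mulrA [leRHS]mulrCA.
    apply: ler_wpM2l; first exact: normc_ge0.
    rewrite -big_split [leRHS](bigD1 i) //= mulrC; apply: ler_pM.
    + exact: ltW.
    + by apply: prodr_ge0 => j _; exact: normc_ge0.
    + by rewrite ler_peMl ?(ltW (q0 k i)) // lerDl !mulr_ge0 ?pi_ge0 // ltW.
    + apply: ler_prod => j ji; rewrite normc_ge0 /=; apply: facB => js.
      by apply: hth; rewrite inE negb_or ji.
  - move=> w wr; rewrite IH //; last first.
      move=> j js; rewrite set_coordE; case: eqP => [->|/eqP ji] //.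
      by apply: hth; rewrite inE negb_or ji.
    congr csum; apply/funext => k; rewrite split_fac /c' -[RHS]mulrA; congr (_ * _); exact: mulrC.
rewrite /torus_integral H ?enum_uniq //; last by move=> i; rewrite mem_enum.
congr csum; apply/funext => k; congr (_ * _); apply: eq_bigr => i _.
by rewrite /fac mem_enum.
Qed.

End TorusIntegrals.

(** * The Borel transform *)

Section BorelTransform.
Context {R : realType} {d : nat}.
Local Notation C := R[i].
Local Notation csum := summability.sum.
Implicit Types (f : 'rV[C]_d -> C) (r rho rad : 'I_d -> R).

(** The induction step is [e <= ((n + 2) / (n + 1)) ^ (n + 2)], that is,
[1 - 1 / (n + 2) <= exp (- 1 / (n + 2))]. *)
Lemma fact_expR_le n : n`!%:R * expR n%:R <= n.+1%:R ^+ n.+1 :> R.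
Proof.
elim: n => [|n IH]; first by rewrite expR0 mulr1.
have n2 : (0 : R) < n.+2%:R by rewrite ltr0n.
have e1 : expR 1 * n.+1%:R ^+ n.+2 <= n.+2%:R ^+ n.+2 :> R.
  have h : n.+1%:R / n.+2%:R <= expR (- n.+2%:R^-1) :> R.
    apply: le_trans (expR_ge1Dx _); rewrite ler_pdivrMr // mulrDl mul1r mulNr mulVf ?gt_eqF //.
    by rewrite -[n.+2%:R]natr1 addrK.
  have : (n.+1%:R / n.+2%:R) ^+ n.+2 <= expR (- n.+2%:R^-1) ^+ n.+2 :> R.
    by apply: lerXn2r => //; rewrite nnegrE ?expR_ge0 // divr_ge0.
  rewrite -expRM_natl mulrN mulfV ?gt_eqF // expRN expr_div_n ler_pdivrMr ?exprn_gt0 //.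
  by rewrite mulrC ler_pdivlMr ?expR_gt0 // mulrC.
apply: le_trans e1; rewrite factS natrM exprS.
have -> : expR n.+1%:R = expR n%:R * expR 1 :> R by rewrite -expRD natr1.
rewrite [leLHS](_ : _ = expR 1 * (n.+1%:R * (n`!%:R * expR n%:R))); last by ring.
by rewrite ler_pM2l ?expR_gt0 // ler_pM2l ?ltr0n.
Qed.

(** The factor [n + 1] lost in [fact_expR_le] is absorbed by [exp (- (n + 1) (1 - q))]. *)
Lemma fact_expR_bound q n : q < 1 ->
  n`!%:R * expR (n.+1%:R * q) <= expR 1 / (1 - q) * n.+1%:R ^+ n :> R.
Proof.
move=> q1; have q2 : 0 < 1 - q by rewrite subr_gt0.
have n1 : (0 : R) < n.+1%:R by rewrite ltr0n.
set y := n.+1%:R * (1 - q).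
have yE : y * expR (- y) <= 1.
  rewrite expRN ler_pdivrMr ?expR_gt0 // mul1r; apply: le_trans (expR_ge1Dx y); lra.
have -> : expR (n.+1%:R * q) = expR n%:R * expR 1 * expR (- y).
  by rewrite -!expRD /y -natr1; congr expR; ring.
have h := fact_expR_le n.
apply: (@le_trans _ _ (n.+1%:R ^+ n.+1 * expR 1 * expR (- y))).
  by rewrite -!mulrA mulrA ler_wpM2r // mulr_ge0 // expR_ge0.
rewrite exprS -(ler_pM2r q2).
rewrite (_ : _ * (1 - q) = expR 1 * n.+1%:R ^+ n * (y * expR (- y))); last by rewrite /y; ring.
rewrite [leRHS](_ : _ = expR 1 * n.+1%:R ^+ n * 1).
  by apply: ler_wpM2l => //; rewrite mulr_ge0 ?expR_ge0 ?exprn_ge0.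
by field; rewrite gt_eqF.
Qed.

Definition taylor f (K : midx d) : C := mpartial K f 0 / (mfact K)%:R.

Lemma entire_cauchy f r rho rad (c : R) : (forall z, differentiable f z) ->
  (forall z, normc (f z) <= c * expR (\sum_i r i * normc (z 0 i))) ->
  (forall i, 0 <= r i) -> 0 <= c ->
  (forall i, 0 < rho i) -> (forall i, rho i < rad i) ->
  has_ps f (taylor f) rho /\
  forall K, normc (taylor f K) * \prod_i rho i ^+ K i <= c * expR (\sum_i r i * rad i).
Proof.
move=> fd fc r0 c0 rho0 rr.
have [z zr|z zr i|a fa aB] := @polydisc_has_ps R d f rad rho (c * expR (\sum_i r i * rad i)) rho0 rr.
- apply: le_trans (fc z) _; rewrite ler_wpM2l // ler_expR; apply: ler_sum => i _.
  by rewrite ler_wpM2l // ltW.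
- by eexists; exact: differentiable_cderiv.
suff -> : taylor f = a by [].
apply/funext => K; rewrite /taylor (has_ps_mpartial K rho0 fa) mulrC mulKf //.
exact: mfact_neq0.
Qed.

(** Cauchy's estimate on the polydisc of radii proportional to [L + 1]: up to a
constant, the growth of [f] there is compensated by the factorials. *)
Lemma mpartial_bound f r r' (c : R) : (forall z, differentiable f z) ->
  (forall z, normc (f z) <= c * expR (\sum_i r i * normc (z 0 i))) ->
  0 <= c -> (forall i, 0 <= r i) -> (forall i, r i < r' i) ->
  exists2 B : R, 0 <= B & forall L, normc (mpartial L f 0) <= B * \prod_i r' i ^+ L i.
Proof.
move=> fd fc c0 r0 rr'.
pose s i := (r i + r' i) / 2.
have rs i : r i < s i by rewrite /s; have := rr' i; lra.
have sr i : s i < r' i by rewrite /s; have := rr' i; lra.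
have s0 i : 0 < s i by apply: le_lt_trans (rs i).
have r'0 i : 0 < r' i by apply: lt_trans (sr i).
have q1 i : r i / s i < 1 by rewrite ltr_pdivrMr // mul1r.
pose D i : R := expR 1 / (1 - r i / s i).
have D0 i : 0 <= D i by rewrite divr_ge0 ?expR_ge0 // subr_ge0 ltW.
exists (c * \prod_i D i) => [|L]; first by rewrite mulr_ge0 // prodr_ge0.
pose rho i : R := (L i).+1%:R / r' i; pose rad i : R := (L i).+1%:R / s i.
have rho0 i : 0 < rho i by rewrite divr_gt0 // ltr0n.
have rhorad i : rho i < rad i by rewrite ltr_pM2l ?ltr0n // ltf_pV2 ?posrE.
have [_ /(_ L)] := entire_cauchy fd fc r0 c0 rho0 rhorad.
rewrite /taylor normcM normcV normc_nat.
have fL : (0 : R) < (mfact L)%:R by rewrite ltr0n; apply: prodn_gt0 => i; exact: fact_gt0.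
have pr : 0 < \prod_i rho i ^+ L i by apply: prodr_gt0 => i _; exact: exprn_gt0.
rewrite mulrAC ler_pdivrMr // -ler_pdivlMr // => /le_trans -> //.
rewrite ler_pdivrMr // -!mulrA; apply: ler_wpM2l => //.
rewrite expR_sum mulrC /mfact natr_prod -!big_split /=; apply: ler_prod => i _.
rewrite mulr_ge0 ?expR_ge0 //=.
rewrite [X in _ * expR X](_ : _ = (L i).+1%:R * (r i / s i)); last by rewrite /rad; ring.
apply: (le_trans (fact_expR_bound (L i) (q1 i))).
rewrite -/(D i) /rho expr_div_n [r' i ^+ L i * _]mulrC divfK // expf_neq0 // gt_eqF //.
Qed.

Lemma borel_termE f z (K : midx d) :
  borel_term f z K = mpartial K f 0 * \prod_i (z 0 i)^-1 ^+ (K i).+1.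
Proof.
rewrite /borel_term /mpow -prodfV; congr (_ * _); apply: eq_bigr => i _.
by rewrite ffunE exprVn.
Qed.

Lemma inv_geometric (r' N : 'I_d -> R) (B : R) (u : midx d -> R) : 0 <= B ->
  (forall i, 0 <= r' i) -> (forall i, r' i < N i) ->
  (forall L, u L <= B * \prod_i r' i ^+ L i) ->
  forall J : {fset midx d}, \sum_(L <- J) u L * \prod_i (N i)^-1 ^+ (L i).+1 <=
    B * \prod_i ((1 - r' i / N i)^-1 / N i).
Proof.
move=> B0 r0 rN uB J.
have N0 i : 0 < N i by apply: le_lt_trans (rN i).
pose g i n : R := (r' i / N i) ^+ n / N i.
apply: (@le_trans _ _ (B * \sum_(L <- J) \prod_i g i (L i))).
  rewrite mulr_sumr; apply: ler_sum => L _.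
  rewrite [leRHS](_ : _ = (B * \prod_i r' i ^+ L i) * \prod_i (N i)^-1 ^+ (L i).+1).
    apply: ler_wpM2r => //; apply: prodr_ge0 => i _; rewrite exprn_ge0 // invr_ge0 ltW //.
  rewrite -mulrA -big_split; congr (_ * _); apply: eq_bigr => i _.
  by rewrite /g expr_div_n exprSr exprVn /= -[LHS]mulrA.
apply: ler_wpM2l => //; apply: midx_sum_prod => i.
  by move=> n; rewrite divr_ge0 ?exprn_ge0 ?divr_ge0 // ltW.
move=> n; rewrite -mulr_suml ler_wpM2r ?invr_ge0 ?(ltW (N0 i)) //.
apply: geometric_bound; first by rewrite divr_ge0 // ltW.
by rewrite ltr_pdivrMr // mul1r.
Qed.

(** [mpartial_bound] at a radius between [r] and [|th|] bounds the jets of the terms of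
the Laurent series by a geometric series. *)
Lemma borel_differentiable f r (c : R) th : (forall z, differentiable f z) ->
  (forall z, normc (f z) <= c * expR (\sum_i r i * normc (z 0 i))) ->
  0 <= c -> (forall i, 0 <= r i) -> polyexterior r th ->
  abs_summable (borel_term f th) /\ differentiable (borel f) th.
Proof.
move=> fd fc c0 r0 rth; have [del' del'0 hdel'] := ex_margin rth.
pose del := del' / 2; have del0 : 0 < del by rewrite divr_gt0.
pose r' i := r i + del / 2; have rr' i : r i < r' i by rewrite /r' ltrDl divr_gt0.
have r'0 i : 0 <= r' i by apply: le_trans (ltW (rr' i)).
pose N i := normc (th 0 i) - del.
have rN i : r' i < N i.
  rewrite /r' /N /del; have := hdel' i; have := del'0; move: (normc _) (r i) => a b; lra.
have N0 i : 0 < N i by exact: le_lt_trans (rN i).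
have delth i : del < normc (th 0 i) by have := N0 i; rewrite /N subr_gt0.
have [B B0 fB] := mpartial_bound fd fc c0 r0 rr'.
have HS := inv_geometric B0 r'0 rN fB.
have jt (L : midx d) : exists p, jet (fun x : 'rV[C]_d => \prod_i (x 0 i)^-1 ^+ (L i).+1) th del p
    (\prod_i (N i)^-1 ^+ (L i).+1).
  apply: (jet_prod (index_enum 'I_d) (g := fun i x => (x 0 i)^-1 ^+ (L i).+1)) => // i.
  have [p hp] := jet_inv_coord del0 (delth i).
  exact: (jet_exp (L i).+1 del0 hp).
have [p hp] := choice jt; split.
  apply: (abs_summable_le _ HS) => L; rewrite borel_termE normcM; apply: ler_wpM2l.
    exact: normc_ge0.
  have := jet_value_bound (h := 0) del0 (hp L); rewrite addr0; apply => i.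
  by rewrite mxE normc0 ltW.
have [|_ hg] := csum_has_grad (F := borel f) del0 hp HS.
  by move=> h _; congr csum; apply/funext => L; rewrite borel_termE.
by have [] := has_grad_diff del0 hg.
Qed.

End BorelTransform.

(** * Contour integrals as coefficients *)

Section AppellCoefficients.
Context {R : realType} {d : nat}.
Local Notation C := R[i].
Local Notation csum := summability.sum.
Implicit Types (M f : 'rV[C]_d -> C) (r rho : 'I_d -> R) (K J L : midx d).

Lemma prod_exp_midx_add (V : comNzRingType) (x : 'I_d -> V) K J :
  \prod_i x i ^+ (midx_add K J) i = (\prod_i x i ^+ K i) * \prod_i x i ^+ J i.
Proof. by rewrite -big_split; apply: eq_bigr => i _; rewrite ffunE exprD. Qed.

Lemma mpow_midx_add (z : 'rV[C]_d) K J : mpow z (midx_add K J) = mpow z K * mpow z J.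
Proof. exact: prod_exp_midx_add. Qed.

Lemma has_ps_sum_bound F (c : midx d -> C) rho rho1 : has_ps F c rho1 -> (forall i, 0 <= rho i) ->
  (forall i, rho i < rho1 i) ->
  exists2 S : R, 0 <= S & forall A : {fset midx d}, \sum_(J <- A) normc (c J) * \prod_i rho i ^+ J i <= S.
Proof.
move=> Fc rho0 rr; have rowrE i : normc ((rowr rho) 0 i) = rho i.
  by rewrite mxE normc_real ger0_norm.
have [|sM _] := Fc (rowr rho); first by move=> i; rewrite rowrE.
have [S S0 hS] := abs_summable_bounded sM; exists S => // A; apply: le_trans (hS A).
apply: ler_sum => J _; rewrite normcM normc_mpow.
by under [X in _ <= _ * X]eq_bigr do rewrite rowrE.
Qed.

(** The [J]-part of the bound on [b (K + J)] is paid for by the summability of [m], the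
[K]-part remains. *)
Lemma shifted_sum_bound (m b : midx d -> C) r' rho (S B : R) K : 0 <= B ->
  (forall i, 0 <= r' i) -> (forall i, r' i <= rho i) ->
  (forall L, normc (b L) <= B * \prod_i r' i ^+ L i) ->
  (forall A : {fset midx d}, \sum_(J <- A) normc (m J) * \prod_i rho i ^+ J i <= S) ->
  forall A : {fset midx d}, \sum_(J <- A) normc (m J * b (midx_add K J)) <= B * S * \prod_i rho i ^+ K i.
Proof.
move=> B0 r0 rr bB mS A.
have rho0 i : 0 <= rho i by exact: le_trans (rr i).
have P0 : 0 <= \prod_i rho i ^+ K i by apply: prodr_ge0 => i _; exact: exprn_ge0.
rewrite [leRHS](_ : _ = B * \prod_i rho i ^+ K i * S); last by ring.
apply: le_trans (ler_wpM2l (mulr_ge0 B0 P0) (mS A)).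
rewrite mulr_sumr; apply: ler_sum => J _; rewrite normcM.
rewrite [leRHS](_ : _ = normc (m J) * (B * \prod_i rho i ^+ (midx_add K J) i)).
  apply: ler_wpM2l; first exact: normc_ge0.
  apply: (le_trans (bB _)); apply: ler_wpM2l => //; apply: ler_prod => i _.
  by rewrite exprn_ge0 //=; apply: lerXn2r; rewrite ?nnegrE.
by rewrite prod_exp_midx_add; ring.
Qed.

(** Cauchy's residue formula, one coordinate at a time: only the terms of the double
series with [L = K + J] contribute to the contour integral. The right-hand side does
not involve the radii. *)
Lemma appell_coef_eq M f (m : midx d -> C) r rho rho1 (c : R) K :
  (forall z, differentiable f z) ->
  (forall z, normc (f z) <= c * expR (\sum_i r i * normc (z 0 i))) ->
  0 <= c -> (forall i, 0 <= r i) -> (forall i, r i < rho i) -> (forall i, rho i < rho1 i) ->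
  has_ps M m rho1 ->
  appell_coef M rho f K = csum (fun J => m J * mpartial (midx_add K J) f 0).
Proof.
move=> fd fc c0 r0 rrho rrho1 Mm.
have rho0 i : 0 < rho i by apply: le_lt_trans (rrho i).
pose r' i := (r i + rho i) / 2.
have rr' i : r i < r' i by rewrite /r'; have := rrho i; lra.
have r'rho i : r' i < rho i by rewrite /r'; have := rrho i; lra.
have r'0 i : 0 <= r' i by apply: le_trans (ltW (rr' i)).
have [B B0 fB] := mpartial_bound fd fc c0 r0 rr'.
have [S S0 mS] := has_ps_sum_bound Mm (fun i => ltW (rho0 i)) rrho1.
have bS := inv_geometric B0 r'0 r'rho fB.
set S2 := B * _ in bS.
pose b L : C := mpartial L f 0.
pose cc (p : midx d * midx d) : C := m p.1 * b p.2.
pose n (p : midx d * midx d) i := (K i + p.1 i)%N.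
pose n' (p : midx d * midx d) i := (p.2 i).+1.
have P0 : 0 <= \prod_i rho i ^+ K i by apply: prodr_ge0 => i _; exact: exprn_ge0 (ltW _).
have termE (x : 'I_d -> R) p : \prod_i (x i ^+ n p i / x i ^+ n' p i) =
    \prod_i x i ^+ K i * (\prod_i x i ^+ p.1 i * \prod_i (x i)^-1 ^+ (p.2 i).+1).
  rewrite -!big_split; apply: eq_bigr => i _ /=; rewrite /n /n' exprD exprVn.
  by rewrite -[LHS]mulrA.
have termCE (x : 'I_d -> C) p : \prod_i (x i ^+ n p i / x i ^+ n' p i) =
    \prod_i x i ^+ K i * (\prod_i x i ^+ p.1 i * \prod_i (x i)^-1 ^+ (p.2 i).+1).
  rewrite -!big_split; apply: eq_bigr => i _ /=; rewrite /n /n' exprD exprVn.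
  by rewrite -[LHS]mulrA.
rewrite /appell_coef (torus_integral_csum (c := cc) (n := n) (m := n')
  (B := \prod_i rho i ^+ K i * (S * S2))) //; first last.
- move=> th thr; pose u J := m J * mpow th J.
  have su : abs_summable u.
    by apply: (Mm th _).1 => i; rewrite thr.
  have [sb _] : abs_summable (borel_term f th) /\ differentiable (borel f) th.
    by apply: (borel_differentiable fd fc c0 r0) => i; rewrite thr.
  have [sp pE] := csum_mul su sb.
  have -> : mpow th K * M th * borel f th = mpow th K * (csum u * csum (borel_term f th)).
    rewrite -mulrA; congr (_ * (_ * _)).
    by apply: (Mm th _).2 => i; rewrite thr.
  rewrite -pE -(csumZ _ sp); congr (csum _); apply/funext => p.
  rewrite termCE borel_termE /u /cc /b /mpow.
  set x1 := \prod_i _; set x2 := \prod_i _; set x3 := \prod_i _.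
  by move: (m p.1) (mpartial p.2 f 0) => x4 x5; ring.
- apply: fset_sum_pair.
    move=> p; rewrite mulr_ge0 ?normc_ge0 //; apply: prodr_ge0 => i _.
    by rewrite divr_ge0 ?exprn_ge0 // ltW.
  move=> J1 J2; pose v J := normc (m J) * \prod_i rho i ^+ J i.
  pose w L := normc (b L) * \prod_i (rho i)^-1 ^+ (L i).+1.
  have w0 L : 0 <= w L.
    by rewrite mulr_ge0 ?normc_ge0 //; apply: prodr_ge0 => i _; rewrite exprn_ge0 // invr_ge0 ltW.
  have -> : \sum_(J <- J1) \sum_(L <- J2) normc (cc (J, L)) *
      \prod_i (rho i ^+ n (J, L) i / rho i ^+ n' (J, L) i) =
      \prod_i rho i ^+ K i * ((\sum_(J <- J1) v J) * (\sum_(L <- J2) w L)).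
    rewrite mulr_suml mulr_sumr; apply: eq_bigr => J _.
    rewrite 2!mulr_sumr; apply: eq_bigr => L _.
    by rewrite termE /cc normcM /v /w /=; ring.
  apply: ler_wpM2l => //; apply: ler_pM; [|exact: sumr_ge0| |exact: bS].
    apply: sumr_ge0 => J _; rewrite mulr_ge0 ?normc_ge0 //; apply: prodr_ge0 => i _.
    by rewrite exprn_ge0 // ltW.
  exact: mS.
set t := 0 +i* (2 * pi).
have t0 : t != 0 by rewrite eq_complex /= eqxx mulf_neq0 ?gt_eqF ?pi_gt0.
pose U p : C := cc p * (if p.2 == midx_add K p.1 then t ^+ d else 0).
rewrite (_ : (fun p => _) = U); last first.
  apply/funext => p; rewrite /U; congr (_ * _); case: eqP => [e|/eqP ne].
    rewrite (eq_bigr (fun=> t)) ?prodr_const ?card_ord // => i _.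
    by rewrite /n /n' e ffunE eqxx.
  have [i hi] : exists i, p.2 i != (K i + p.1 i)%N.
    apply/existsP; move: ne; apply: contraR => /existsPn h.
    by apply/eqP/ffunP => i; rewrite ffunE; apply/eqP/negbNE/h.
  by rewrite (bigD1 i) //= /n /n' eqSS eq_sym (negbTE hi) mul0r.
have hI : injective (fun J => (J, midx_add K J)) by move=> J J' [].
have sJ : abs_summable (fun J => m J * b (midx_add K J)).
  by apply/abs_summableP; exists (B * S * \prod_i rho i ^+ K i);
     apply: (shifted_sum_bound K B0 r'0 (fun i => ltW (r'rho i)) fB mS).
have UE J : U (J, midx_add K J) = t ^+ d * (m J * b (midx_add K J)).
  by rewrite /U /= eqxx mulrC.
have UF : (fun J => U (J, midx_add K J)) = (fun J => t ^+ d * (m J * b (midx_add K J))).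
  exact/funext.
have [||_ ->] := csum_reindex (u := U) hI.
- move=> [J L] h; rewrite /U /=; case: eqP => [e|_]; last by rewrite mulr0.
  by case: (h J); rewrite e.
- by rewrite UF; exact: abs_summableZ.
by rewrite UF csumZ // mulrA mulVf ?mul1r // expf_neq0.
Qed.

Lemma appell_coef_bound M f (m : midx d -> C) r rho rho1 (c : R) :
  (forall z, differentiable f z) ->
  (forall z, normc (f z) <= c * expR (\sum_i r i * normc (z 0 i))) ->
  0 <= c -> (forall i, 0 <= r i) -> (forall i, r i < rho i) -> (forall i, rho i < rho1 i) ->
  has_ps M m rho1 ->
  exists2 S : R, 0 <= S & forall K (A : {fset midx d}),
    \sum_(J <- A) normc (m J * mpartial (midx_add K J) f 0) <= S * \prod_i rho i ^+ K i.
Proof.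
move=> fd fc c0 r0 rrho rrho1 Mm.
have rho0 i : 0 < rho i by apply: le_lt_trans (rrho i).
have [B B0 fB] := mpartial_bound fd fc c0 r0 rrho.
have [S S0 mS] := has_ps_sum_bound Mm (fun i => ltW (rho0 i)) rrho1.
exists (B * S) => [|K A]; first exact: mulr_ge0.
exact: (shifted_sum_bound K B0 (fun i => ltW (rho0 i)) (fun i => lexx _) fB mS).
Qed.

End AppellCoefficients.

(** * Products and reciprocals of power series *)

Section CauchyProducts.
Context {R : realType} {d : nat}.
Local Notation C := R[i].
Local Notation csum := summability.sum.
Implicit Types (F G : 'rV[C]_d -> C) (rho : 'I_d -> R) (K L : midx d) (u v : midx d -> C).

(** Summation over all pairs with [K + J = L] makes this the convolution without
naming the finite set of such pairs. *)
Definition conv u v L : C := csum (fun p : midx d * midx d =>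
  if midx_add p.1 p.2 == L then u p.1 * v p.2 else 0).

Lemma prod_exp_gt0 rho K : (forall i, 0 < rho i) -> 0 < \prod_i rho i ^+ K i.
Proof. by move=> rho0; apply: prodr_gt0 => i _; exact: exprn_gt0. Qed.

Lemma weighted_prod_bound rho u v (A B : R) : (forall i, 0 < rho i) ->
  (forall J : {fset midx d}, \sum_(K <- J) normc (u K) * \prod_i rho i ^+ K i <= A) ->
  (forall J : {fset midx d}, \sum_(K <- J) normc (v K) * \prod_i rho i ^+ K i <= B) ->
  forall J : {fset midx d * midx d},
    \sum_(p <- J) normc (u p.1 * v p.2) * \prod_i rho i ^+ (midx_add p.1 p.2) i <= A * B.
Proof.
move=> rho0 uA vB; have P0 K := ltW (prod_exp_gt0 K rho0).
apply: fset_sum_pair => [p|J1 J2]; first by rewrite mulr_ge0 ?normc_ge0.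
have s0 (w : midx d -> C) (J : {fset midx d}) : 0 <= \sum_(K <- J) normc (w K) * \prod_i rho i ^+ K i.
  by apply: sumr_ge0 => K _; rewrite mulr_ge0 ?normc_ge0.
apply: le_trans (ler_pM (s0 u J1) (s0 v J2) (uA J1) (vB J2)).
rewrite mulr_suml; apply: ler_sum => K _; rewrite mulr_sumr; apply: ler_sum => L _ /=.
by rewrite prod_exp_midx_add normcM mulrACA.
Qed.

Lemma conv_summable rho u v (A B : R) L : (forall i, 0 < rho i) ->
  (forall J : {fset midx d}, \sum_(K <- J) normc (u K) * \prod_i rho i ^+ K i <= A) ->
  (forall J : {fset midx d}, \sum_(K <- J) normc (v K) * \prod_i rho i ^+ K i <= B) ->
  abs_summable (fun p : midx d * midx d => if midx_add p.1 p.2 == L then u p.1 * v p.2 else 0) /\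
  normc (conv u v L) * \prod_i rho i ^+ L i <= A * B.
Proof.
move=> rho0 uA vB; have P0 := prod_exp_gt0 L rho0.
have H (J : {fset midx d * midx d}) : \sum_(p <- J)
   normc (if midx_add p.1 p.2 == L then u p.1 * v p.2 else 0) <= A * B / \prod_i rho i ^+ L i.
  rewrite ler_pdivlMr // mulr_suml; apply: le_trans (weighted_prod_bound rho0 uA vB J).
  apply: ler_sum => p _; case: eqP => [->|_] //.
  by rewrite normc0 mul0r mulr_ge0 ?normc_ge0 // ltW // prod_exp_gt0.
split; first by apply/abs_summableP; exists (A * B / \prod_i rho i ^+ L i).
by rewrite -ler_pdivlMr //; exact: csum_le H.
Qed.

Lemma has_ps_weights F u rho rho' : has_ps F u rho' -> (forall i, 0 < rho i) ->
  (forall i, rho i < rho' i) ->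
  exists A : R, forall J : {fset midx d}, \sum_(K <- J) normc (u K) * \prod_i rho i ^+ K i <= A.
Proof.
by move=> Fu rho0 rr; have [A _] := has_ps_sum_bound Fu (fun i => ltW (rho0 i)) rr; exists A.
Qed.

(** The product of the two series is a sum over pairs; its fibres under the addition of
multiindices are the terms of the Cauchy product. *)
Lemma has_psM F G u v rho : (forall i, 0 < rho i) -> has_ps F u rho -> has_ps G v rho ->
  has_ps (fun z => F z * G z) (conv u v) rho.
Proof.
move=> rho0 Fu Gv z zr.
pose rho1 i := rho i / 2.
have r10 i : 0 < rho1 i by rewrite divr_gt0.
have r1r i : rho1 i < rho i by rewrite /rho1; have := rho0 i; lra.
have [A uA] := has_ps_weights Fu r10 r1r; have [B vB] := has_ps_weights Gv r10 r1r.
have [su Fz] := Fu z zr; have [sv Gz] := Gv z zr.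
have [sp pE] := csum_mul su sv.
pose w (p : midx d * midx d) := u p.1 * mpow z p.1 * (v p.2 * mpow z p.2).
have fE : (fun L => conv u v L * mpow z L) =
    (fun L => csum (fun p => if midx_add p.1 p.2 == L then w p else 0)).
  apply/funext => L; rewrite mulrC /conv -(csumZ _ (conv_summable L r10 uA vB).1).
  congr (csum _); apply/funext => p; case: eqP => [<-|_]; last by rewrite mulr0.
  by rewrite mpow_midx_add /w; ring.
rewrite fE Fz Gz; split; first exact: abs_summable_fiber.
by rewrite (csum_fiber (fun p : midx d * midx d => midx_add p.1 p.2) sp) pE.
Qed.

(** A sequence along which [1 / F] is unbounded converges along an ultrafilter, and there
the power series converges to its value at the limit by dominated convergence, so that
[F] would vanish at this point. *)
Lemma inv_bounded F u rho rho' : (forall i, 0 < rho i) -> (forall i, rho i < rho' i) ->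
  has_ps F u rho' -> (forall z : 'rV[C]_d, (forall i, normc (z 0 i) < rho' i) -> F z <> 0) ->
  exists B : R, forall z : 'rV[C]_d, (forall i, normc (z 0 i) <= rho i) -> normc (F z)^-1 <= B.
Proof.
move=> rho0 rr Fu F0; apply/not_existsP => nB.
have /choice[zz hz] (n : nat) : exists z : 'rV[C]_d, (forall i, normc (z 0 i) <= rho i) /\ n%:R < normc (F z)^-1.
  have /existsNP[z /not_implyP[zr /negP]] := nB n%:R; rewrite -ltNge => zn.
  by exists z.
have [U [UU NU]] := ultraFilterLemma (@eventually_filter).
have /choice[l hl] (i : 'I_d) : exists l : C, (fun n => zz n 0 i) @ U --> l /\ normc l <= rho i.
  have [|l h1 h2] := @ultra_bounded_ccvg R nat U UU (fun n => zz n 0 i) (rho i).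
    by move=> n; have [] := hz n.
  by exists l.
pose z : 'rV[C]_d := \row_i l i.
have zr i : normc (z 0 i) <= rho i by rewrite mxE; have [] := hl i.
have small (y : 'rV[C]_d) : (forall i, normc (y 0 i) <= rho i) -> forall i, normc (y 0 i) < rho' i.
  by move=> yr i; apply: le_lt_trans (rr i).
have [A uA] := has_ps_weights Fu rho0 rr.
have domin (y : 'rV[C]_d) : (forall i, normc (y 0 i) <= rho i) ->
    forall K, normc (u K * mpow y K) <= normc (u K) * \prod_i rho i ^+ K i.
  move=> yr K; rewrite normcM normc_mpow; apply: ler_wpM2l; first exact: normc_ge0.
  apply: ler_prod => i _; rewrite exprn_ge0 ?normc_ge0 //=.
  by apply: lerXn2r; rewrite ?nnegrE ?normc_ge0 // ltW.
have FU : (fun n => F (zz n)) @ U --> F z.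
  rewrite (Fu z (small _ zr)).2.
  rewrite (_ : (fun n => F (zz n)) = (fun n => csum (fun K => u K * mpow (zz n) K))); last first.
    by apply/funext => n; rewrite (Fu _ (small _ (hz n).1)).2.
  apply: (csum_dominated _ _ uA).
  - by move=> K; rewrite mulr_ge0 ?normc_ge0 // ltW // prod_exp_gt0.
  - by move=> n K; apply: domin; have [] := hz n.
  - move=> K; have cX i k : (fun n => zz n 0 i ^+ k) @ U --> l i ^+ k.
      elim: k => [|k IH]; first exact: cvg_cst.
      rewrite exprS (_ : (fun n => _) = (fun n => zz n 0 i * zz n 0 i ^+ k)).
        exact: (cvgM (hl i).1 IH).
      by apply/funext => n; rewrite exprS.
    have cP : (fun n => mpow (zz n) K) @ U --> mpow z K.
      rewrite /mpow; elim: (index_enum 'I_d) => [|i s IH].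
        rewrite big_nil (_ : (fun n => _) = fun=> 1); first exact: cvg_cst.
        by apply/funext => n; rewrite big_nil.
      rewrite big_cons mxE (_ : (fun n => _) =
        (fun n => zz n 0 i ^+ K i * \prod_(j <- s) zz n 0 j ^+ K j)).
        exact: (cvgM (cX i (K i)) IH).
      by apply/funext => n; rewrite big_cons.
    exact: (cvgM (cvg_cst (u K)) cP).
  - exact: domin.
have Fz0 : 0 < normc (F z) by apply: normc_gt0; apply/eqP; exact: F0 (small _ zr).
have /cvg_normcP/(_ _ (divr_gt0 Fz0 (ltr0n R 2)))h1 := FU.
pose N := (Num.trunc (2 / normc (F z))).+1.
have h2 : U [set n | (N <= n)%N] by apply: NU; exists N.
have [n [/= Fn Nn]] := filter_ex (filterI h1 h2).
have Fn0 : normc (F z) / 2 < normc (F (zz n)).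
  have := normcB (F z) (F (zz n)); rewrite normcBC; move: Fn; lra.
have := (hz n).2; apply/negP; rewrite -leNgt normcV.
apply: (@le_trans _ _ (2 / normc (F z))).
  by rewrite -[leRHS]invf_div lef_pV2 ?posrE ?divr_gt0 ?(ltW Fn0) // (lt_trans _ Fn0) // divr_gt0.
apply: (@le_trans _ _ N%:R); last by rewrite ler_nat.
by rewrite ltW // truncnS_gt.
Qed.

End CauchyProducts.

(** * Appell polynomials *)

Section AppellPolynomials.
Context {R : realType} {d : nat}.
Local Notation C := R[i].
Local Notation csum := summability.sum.
Implicit Types (f : 'rV[C]_d -> C) (z th : 'rV[C]_d) (rho r s : 'I_d -> R) (K L : midx d).

Lemma has_ps_ext F G c rho : (forall z, (forall i, normc (z 0 i) < rho i) -> F z = G z) ->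
  has_ps F c rho -> @has_ps R d G c rho.
Proof. by move=> FG Fc z zr; rewrite -FG //; exact: Fc. Qed.

Lemma has_ps_taylor F c rho : (forall i, 0 < rho i) -> @has_ps R d F c rho -> c = taylor F.
Proof.
move=> rho0 Fc; apply/funext => K; rewrite /taylor (has_ps_mpartial K rho0 Fc) mulrC mulKf //.
exact: mfact_neq0.
Qed.

Lemma ex_above (Rad : 'I_d -> \bar R) (a : 'I_d -> R) : (forall i, ((a i)%:E < Rad i)%E) ->
  exists2 b : 'I_d -> R, forall i, a i < b i & forall i, ((b i)%:E < Rad i)%E.
Proof.
move=> aR; have /choice[b hb] (i : 'I_d) : exists x : R, a i < x /\ (x%:E < Rad i)%E.
  case: (Rad i) (aR i) => [x| |//] ax.
    exists ((a i + x) / 2); move: ax; rewrite !lte_fin => ax; lra.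
  by exists (a i + 1); rewrite ltrDl ltr01 ltry.
by exists b => i; have [] := hb i.
Qed.

(** A term outside a large finite set is the difference of two partial sums near the
limit. *)
Lemma cvg_terms_bounded (I : choiceType) (u : I -> C) (l : C) : partial_sum u @ totally --> l ->
  exists B : R, forall i, normc (u i) <= B.
Proof.
move=> /has_csumP/(_ 1 ltr01)[J0 hJ0].
exists (2 + \sum_(i <- J0) normc (u i)) => i.
have S0 : 0 <= \sum_(i <- J0) normc (u i) by apply: sumr_ge0 => j _; exact: normc_ge0.
case: (boolP (i \in J0)) => iJ.
  apply: (@le_trans _ _ (\sum_(i <- J0) normc (u i))); last by rewrite lerDr.
  rewrite (big_fsetD1 i) //= lerDl; apply: sumr_ge0 => j _; exact: normc_ge0.
have h0 := hJ0 J0 (fsubset_refl _).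
have h1 := hJ0 (i |` J0)%fset (fsubsetU1 _ _).
rewrite big_fsetU1 //= in h1.
set t := \sum_(i <- J0) u i in h0 h1.
have -> : u i = (u i + t - l) - (t - l) by ring.
by have := normcD (u i + t - l) (- (t - l)); rewrite normcN; move: h0 h1; lra.
Qed.

(** Convergence at one point with nonzero coordinates bounds the terms there, which gives
absolute convergence on the polydisc through this point. *)
Lemma near_has_ps (F : 'rV[C]_d -> C) (c : midx d -> C) :
  (\forall th \near (0 : 'rV[C]_d), partial_sum (fun K => c K * mpow th K) @ totally --> F th) ->
  exists2 e : R, 0 < e & has_ps F c (fun=> e).
Proof.
move=> /nbhs_ballP[e' /ex_real_gt0[e e0 ->]] H.
have inb th : (forall i, normc (th 0 i) <= e / 2) ->
    partial_sum (fun K => c K * mpow th K) @ totally --> F th.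
  move=> thr; apply: H; rewrite -ball_normE /= sub0r normrN rnormE ltcR.
  apply: (@le_lt_trans _ _ (e / 2)); last lra.
  by apply: rnorm_le => //; lra.
have e2 : 0 < e / 2 by lra.
have rE i : normc ((rowr (fun _ : 'I_d => e / 2)) 0 i) = e / 2.
  by rewrite mxE normc_real gtr0_norm.
have [|B hB] := @cvg_terms_bounded _ _ (F (rowr (fun=> e / 2))) (inb _ _).
  by move=> i; rewrite rE.
exists (e / 2) => // z zr.
have cB K : normc (c K) * \prod_(i < d) (e / 2) ^+ K i <= B.
  by apply: le_trans (hB K); rewrite normcM normc_mpow; under [X in _ <= _ * X]eq_bigr do rewrite rE.
have [_ sc] := coef_bound_summable (fun=> e2) cB zr.
by split=> //; rewrite (has_csum_eq (inb z (fun i => ltW (zr i)))).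
Qed.

Context (M : 'rV[C]_d -> C) (m : midx d -> C) (Rad : 'I_d -> \bar R).
Hypothesis Rad_gt0 : forall i, (0 < Rad i)%E.
Hypothesis M_ps : forall s, (forall i, 0 < s i) -> (forall i, ((s i)%:E < Rad i)%E) -> has_ps M m s.
Hypothesis M_neq0 : forall th, polydisc Rad th -> M th <> 0.

Let in_polydisc s th : (forall i, ((s i)%:E < Rad i)%E) -> (forall i, normc (th 0 i) <= s i) ->
  polydisc Rad th.
Proof. by move=> sR ths i; apply: le_lt_trans (sR i); rewrite lee_fin. Qed.

Definition recip_coef : midx d -> C := taylor (fun th => (M th)^-1).

(** [1 / M] is bounded on every smaller polydisc by [inv_bounded], and differentiable in
each variable. *)
Lemma recip_has_ps s : (forall i, 0 < s i) -> (forall i, ((s i)%:E < Rad i)%E) ->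
  has_ps (fun th => (M th)^-1) recip_coef s.
Proof.
move=> s0 sR; have [s1 ss1 s1R] := ex_above sR; have [s2 s12 s2R] := ex_above s1R.
have s10 i : 0 < s1 i by exact: lt_trans (ss1 i).
have s20 i : 0 < s2 i by exact: lt_trans (s12 i).
have Ms2 := M_ps s20 s2R.
have M0 th : (forall i, normc (th 0 i) < s2 i) -> M th <> 0.
  by move=> ths; apply: M_neq0; apply: (in_polydisc s2R) => i; exact: ltW.
have [B hB] := inv_bounded s10 s12 Ms2 M0.
have [z zr|z zr i|c hc _] := @polydisc_has_ps R d (fun th => (M th)^-1) s1 s B s0 ss1.
- by apply: hB => i; exact: ltW.
- have zs2 j : normc (z 0 j) < s2 j by exact: lt_trans (s12 j).
  have zz : set_coord z i (z 0 i) = z.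
    by apply/rowP => j; rewrite set_coordE; case: eqP => [->|].
  eexists; apply: cderivV.
    by rewrite zz; apply/eqP; exact: M0.
  exact: (differentiable_cderiv i ((has_ps_derive i s20 Ms2).1 z zs2)).
by rewrite /recip_coef -(has_ps_taylor s0 hc).
Qed.

(** The Appell polynomials divided by the factorials, in terms of the coefficients of
[1 / M]. *)
Definition appell_coeff z K : C := conv (fun I => mpow z I / (mfact I)%:R) recip_coef K.

Lemma appell_coeff_has_ps z s : (forall i, 0 < s i) -> (forall i, ((s i)%:E < Rad i)%E) ->
  has_ps (fun th => cexp (dotc th z) / M th) (appell_coeff z) s.
Proof. by move=> s0 sR; apply: has_psM => //; [exact: exp_has_ps|exact: recip_has_ps]. Qed.

Let exp_weights z s (s0 : forall i, 0 < s i) (J : {fset midx d}) :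
  \sum_(K <- J) normc (mpow z K / (mfact K)%:R) * \prod_i s i ^+ K i <=
    expR (\sum_i s i * normc (z 0 i)).
Proof.
have sE i : normc ((rowr s) 0 i) = s i by rewrite mxE normc_real gtr0_norm.
apply: le_trans (@exp_terms_le R d s z (rowr s) _ J); last by move=> i; rewrite sE.
apply: ler_sum => K _; rewrite [leRHS]normcM normc_mpow.
by under [X in _ <= _ * X]eq_bigr do rewrite sE.
Qed.

Let recip_weights s : (forall i, 0 < s i) -> (forall i, ((s i)%:E < Rad i)%E) ->
  exists2 S : R, 0 <= S & forall J : {fset midx d},
    \sum_(K <- J) normc (recip_coef K) * \prod_i s i ^+ K i <= S.
Proof.
move=> s0 sR; have [s1 ss1 s1R] := ex_above sR.
have s10 i : 0 < s1 i by exact: lt_trans (ss1 i).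
exact: (has_ps_sum_bound (recip_has_ps s10 s1R) (fun i => ltW (s0 i)) ss1).
Qed.

Lemma appell_coeff_bound s : (forall i, 0 < s i) -> (forall i, ((s i)%:E < Rad i)%E) ->
  exists2 S : R, 0 <= S & forall z K,
    normc (appell_coeff z K) * \prod_i s i ^+ K i <= S * expR (\sum_i s i * normc (z 0 i)).
Proof.
move=> s0 sR; have [S S0 hS] := recip_weights s0 sR; exists S => // z K.
by rewrite mulrC [leRHS]mulrC mulrC; exact: (conv_summable K s0 (exp_weights z s0) hS).2.
Qed.

Lemma appell_coeff_summable z K :
  abs_summable (fun p : midx d * midx d => if midx_add p.1 p.2 == K
    then mpow z p.1 / (mfact p.1)%:R * recip_coef p.2 else 0).
Proof.
have [s s0 sR] := ex_above Rad_gt0; have [S S0 hS] := recip_weights s0 sR.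
exact: (conv_summable K s0 (exp_weights z s0) hS).1.
Qed.

Lemma ex_is_appell : is_appell M (fun K z => (mfact K)%:R * appell_coeff z K).
Proof.
move=> z; have [s s0 sR] := ex_above Rad_gt0.
have [e e0 he] := ex_margin s0.
apply/nbhs_ballP; exists (e%:C); first by rewrite /= ltcR.
move=> th; rewrite -ball_normE /= sub0r normrN rnormE ltcR => the.
have ths i : normc (th 0 i) < s i.
  by apply: le_lt_trans (coord_le_rnorm th i) _; apply: lt_trans the _; rewrite -[e]add0r.
have [sc ->] := appell_coeff_has_ps z s0 sR ths.
rewrite (_ : (fun K => _) = (fun K => appell_coeff z K * mpow th K)); first exact: csumP.
by apply/funext => K; rewrite [_ * appell_coeff _ _]mulrC mulfK ?mfact_neq0.
Qed.

(** The generating function determines the family, by uniqueness of the coefficients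
of a power series. *)
Lemma appellE K z : appell M K z / (mfact K)%:R = appell_coeff z K.
Proof.
have /(_ z)/near_has_ps[e e0 he] : is_appell M (appell M).
  by apply: getPex; exists (fun K z => (mfact K)%:R * appell_coeff z K); exact: ex_is_appell.
have [s s0 sR] := ex_above Rad_gt0.
pose t i : R := Num.min e (s i).
have t0 i : 0 < t i by rewrite lt_min e0 s0.
have h1 : has_ps (fun th => cexp (dotc th z) / M th) (fun K => appell M K z / (mfact K)%:R) t.
  by apply: has_ps_subset he => i; rewrite ge_min lexx.
have h2 : has_ps (fun th => cexp (dotc th z) / M th) (appell_coeff z) t.
  by apply: has_ps_subset (appell_coeff_has_ps z s0 sR) => i; rewrite ge_min lexx orbT.
exact: (has_ps_unique t0 h1 h2).
Qed.

(** The identity [exp (th . z) = (exp (th . z) / M th) * M th] on coefficients. *)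
Lemma conv_appell_coeff z L : conv (appell_coeff z) m L = mpow z L / (mfact L)%:R.
Proof.
have [s s0 sR] := ex_above Rad_gt0.
apply: (has_ps_unique s0 _ (exp_has_ps z s0)).
apply: has_ps_ext (has_psM s0 (appell_coeff_has_ps z s0 sR) (M_ps s0 sR)) => th ths.
by rewrite divfK //; apply/eqP; apply: M_neq0; apply: (in_polydisc sR) => i; exact: ltW.
Qed.

Section Expansion.
Context (f : 'rV[C]_d -> C) (r rho : 'I_d -> R) (c : R).
Hypothesis fd : forall z, differentiable f z.
Hypothesis fc : forall z, normc (f z) <= c * expR (\sum_i r i * normc (z 0 i)).
Hypothesis c0 : 0 <= c.
Hypothesis r0 : forall i, 0 <= r i.
Hypothesis rrho : forall i, r i < rho i.
Hypothesis rhoR : forall i, ((rho i)%:E < Rad i)%E.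

Let rho0 i : 0 < rho i. Proof. exact: le_lt_trans (rrho i). Qed.

Lemma appell_coef_borel K :
  appell_coef M rho f K = csum (fun J => m J * mpartial (midx_add K J) f 0).
Proof.
have [s rs sR] := ex_above rhoR.
have s0 i : 0 < s i by exact: lt_trans (rs i).
exact: (appell_coef_eq K fd fc c0 r0 rrho rs (M_ps s0 sR)).
Qed.

Lemma appell_coef_le : exists2 S : R, 0 <= S &
  forall K, normc (appell_coef M rho f K) <= S * \prod_i rho i ^+ K i.
Proof.
have [s rs sR] := ex_above rhoR.
have s0 i : 0 < s i by exact: lt_trans (rs i).
have [S S0 hS] := appell_coef_bound fd fc c0 r0 rrho rs (M_ps s0 sR).
by exists S => // K; rewrite appell_coef_borel; apply: csum_le => A; exact: hS.
Qed.

(** Taylor's series of [f], with each monomial expanded by [conv_appell_coeff], is a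
double series over [K] and [J]; summing it over [J] first yields the coefficients. *)
Lemma appell_expansion z : csum (fun K => appell_coef M rho f K * appell_coeff z K) = f z.
Proof.
have [s rs sR] := ex_above rhoR.
have s0 i : 0 < s i by exact: lt_trans (rs i).
have [B B0 fB] := mpartial_bound fd fc c0 r0 rrho.
have [A hA] := has_ps_weights (appell_coeff_has_ps z s0 sR) rho0 rs.
have [A' hA'] := has_ps_weights (M_ps s0 sR) rho0 rs.
pose w (p : midx d * midx d) :=
  mpartial (midx_add p.1 p.2) f 0 * (appell_coeff z p.1 * m p.2).
have sw : abs_summable w.
  apply/abs_summableP; exists (B * (A * A')) => J.
  apply: le_trans (ler_wpM2l B0 (weighted_prod_bound rho0 hA hA' J)).
  rewrite mulr_sumr; apply: ler_sum => p _; rewrite normcM mulrC mulrCA.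
  by apply: ler_wpM2l; [exact: normc_ge0|exact: fB].
have -> : f z = csum w.
  pose t i := normc (z 0 i) + 1; pose t' i := normc (z 0 i) + 2.
  have t0 i : 0 < t i by rewrite /t; have := normc_ge0 (z 0 i); lra.
  have tt' i : t i < t' i by rewrite /t /t'; lra.
  have [fps _] := entire_cauchy fd fc r0 c0 t0 tt'.
  have zt i : normc (z 0 i) < t i by rewrite /t; lra.
  rewrite (fps z zt).2 -(csum_fiber (fun p : midx d * midx d => midx_add p.1 p.2) sw).
  congr (csum _); apply/funext => L.
  rewrite /taylor mulrAC -mulrA -conv_appell_coeff /conv -(csumZ _ (conv_summable L rho0 hA hA').1).
  by congr (csum _); apply/funext => p; case: eqP => [<-|_]; rewrite ?mulr0.
rewrite -(csum_iter sw); congr (csum _); apply/funext => K.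
rewrite appell_coef_borel mulrC -csumZ.
  by congr (csum _); apply/funext => J; rewrite /w /=; ring.
have [S S0 hS] := appell_coef_bound fd fc c0 r0 rrho rs (M_ps s0 sR).
by apply/abs_summableP; exists (S * \prod_i rho i ^+ K i).
Qed.

End Expansion.

End AppellPolynomials.

(** * Convergence of the expansions *)

Section Convergence.
Context {R : realType} {d : nat}.
Local Notation C := R[i].
Local Notation csum := summability.sum.

Lemma normc_coord_continuous i : continuous (fun z : 'rV[C]_d => normc (z 0 i) : R).
Proof.
move=> z; apply: ((cvgrPdist_lt (FF := nbhs_filter z) (fun y : 'rV[C]_d => normc (y 0 i)) (normc (z 0 i))).2) => e e0.
apply/nbhs_ballP; exists (e%:C); first by rewrite /= ltcR.
move=> y; rewrite -ball_normE /= rnormE ltcR => hy.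
have := coord_le_rnorm (z - y) i; rewrite !mxE => zy.
have h1 := normcB (z 0 i) (y 0 i); have h2 := normcB (y 0 i) (z 0 i).
by rewrite normcBC in h2; rewrite ltr_norml; apply/andP; split; lra.
Qed.

Lemma compact_coord_bounded (A : set 'rV[C]_d) : compact A ->
  exists Z : 'I_d -> R, forall z, A z -> forall i, normc (z 0 i) <= Z i.
Proof.
move=> cA; have /choice[Z hZ] (i : 'I_d) : exists Zi : R, forall z, A z -> normc (z 0 i) <= Zi.
  have cI : compact ((fun z : 'rV[C]_d => normc (z 0 i) : R) @` A).
    apply: continuous_compact => //; apply: continuous_subspaceT.
    exact: normc_coord_continuous.
  have /compact_bounded [b [_ hb]] := cI.
  exists (b + 1) => z Az; have b1 : b < b + 1 by rewrite ltrDl.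
  by have := hb _ b1 (normc (z 0 i)) (ex_intro2 _ _ z Az erefl); apply: le_trans; exact: ler_norm.
by exists Z => z Az i; exact: hZ.
Qed.

Lemma summable_nonneg (I : choiceType) (m : I -> R) B : (forall k, 0 <= m k) ->
  (forall J : {fset I}, \sum_(k <- J) m k <= B) -> summable [set: I] (fun k => (m k)%:E).
Proof.
move=> m0 mB.
have : abs_summable (fun k => (m k)%:C).
  by apply/abs_summableP; exists B => J; under eq_bigr do rewrite normc_real ger0_norm //.
rewrite /abs_summable (_ : (fun k => _) = (fun k => (m k)%:E)) //.
by apply/funext => k; rewrite normc_real ger0_norm.
Qed.

(** Weierstrass' criterion. *)
Lemma abs_cvg_compacts_dom (I : choiceType) (u : I -> 'rV[C]_d -> C) F :
  (forall Z : 'I_d -> R, exists m : I -> R,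
    [/\ forall k, 0 <= m k, exists B : R, forall J : {fset I}, \sum_(k <- J) m k <= B &
        forall k (z : 'rV[C]_d), (forall i, normc (z 0 i) <= Z i) -> normc (u k z) <= m k]) ->
  (forall z, F z = csum (u ^~ z)) -> abs_cvg_compacts u F.
Proof.
move=> um FE; split=> [A cA|].
  have [Z hZ] := compact_coord_bounded cA; have [m [m0 [B mB] mu_]] := um Z.
  by exists m; split; [move=> k z Az; apply: mu_ => i; exact: hZ|exact: summable_nonneg mB].
apply/fam_cvgP => A cA; have [Z hZ] := compact_coord_bounded cA.
have [m [m0 [B mB] mu_]] := um Z.
have sm : abs_summable (fun k => (m k)%:C).
  by apply/abs_summableP; exists B => J; under eq_bigr do rewrite normc_real ger0_norm //.
move=> Q /uniform_nbhs[E [entE EQ]].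
move: entE; rewrite -entourage_ballE => -[e'] /= /ex_real_gt0[e e0 ->] eE.
have e2 : 0 < e / 2 by rewrite divr_gt0.
have [J0 hJ0] := abs_summable_tail sm e2.
exists J0 => // J /= J0J; apply: EQ => z Az; apply: eE => /=.
have uz k : normc (u k z) <= m k by apply: mu_ => i; exact: hZ.
rewrite -ball_normE /= normc_norm ltcR partial_sumE FE.
apply: (@le_lt_trans _ _ (e / 2)); last lra.
apply: csum_approx.
  by apply: (abs_summable_le uz mB).
move=> J' J'J; apply: (@le_trans _ _ (\sum_(k <- J') normc (m k)%:C)).
  by apply: ler_sum => k _; rewrite normc_real ger0_norm.
by apply/ltW/hJ0/(fdisjointWr J0J).
Qed.

End Convergence.

Section AppellSeries.
Context {R : realType} {d : nat} {disp : measure_display} {T : measurableType disp}.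
Context {P : probability T R} (X : {RV P >-> d.-tuple R}) (Rad : 'I_d -> \bar R).
Local Notation C := R[i].
Local Notation csum := summability.sum.
Hypothesis M_defined : mgf_defined X Rad.

(** Exponential type below [Rad] serves for both modes of convergence: it is bounded
on compacts, and integrable by the assumption on the law. *)
Lemma abs_cvg_exp_type (I : countType) (u : I -> 'rV[C]_d -> C) F (s : 'I_d -> R)
    (m : I -> R) (B : R) : (forall i, 0 <= s i) -> (forall i, ((s i)%:E < Rad i)%E) ->
  (forall k, 0 <= m k) -> (forall J : {fset I}, \sum_(k <- J) m k <= B) ->
  (forall k z, normc (u k z) <= m k * expR (\sum_i s i * normc (z 0 i))) ->
  (forall k, cmeas setT (fun x : d.-tuple R => u k (cvec x))) ->
  (forall z, F z = csum (u ^~ z)) ->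
  abs_cvg_compacts u F /\
  abs_cvg_L1 (distribution P X) (fun k x => u k (cvec x)) (fun x => F (cvec x)).
Proof.
move=> s0 sR m0 mB um cu FE; split.
  apply: abs_cvg_compacts_dom => // Z.
  pose E := expR (\sum_i s i * Z i).
  exists (fun k => m k * E); split.
  - by move=> k; rewrite mulr_ge0 ?expR_ge0.
  - by exists (B * E) => J; rewrite -mulr_suml ler_wpM2r ?expR_ge0.
  - move=> k z zZ; apply: (le_trans (um k z)); apply: ler_wpM2l => //.
    by rewrite ler_expR; apply: ler_sum => i _; apply: ler_wpM2l.
pose G (x : d.-tuple R) := B * expabs s x.
have iG : (distribution P X).-integrable setT (EFin \o G).
  rewrite (_ : _ \o _ = (fun x => (B%:E * (EFin \o expabs s) x)%E)) //.
  exact: (integrableZl measurableT _ (expabs_integrable_dist M_defined s0 sR)).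
have uG (x : d.-tuple R) : [set: d.-tuple R] x ->
    forall J : {fset I}, \sum_(k <- J) normc (u k (cvec x)) <= G x.
  move=> _ J; apply: (@le_trans _ _ (\sum_(k <- J) m k * expabs s x)).
    apply: ler_sum => k _; apply: (le_trans (um _ _)); rewrite /expabs.
    by under eq_bigr do rewrite mxE normc_real.
  by rewrite -mulr_suml /G; apply: ler_wpM2r; [exact: expR_ge0|exact: mB].
rewrite (_ : (fun x => F (cvec x)) = (fun x => csum (fun k => u k (cvec x)))); last first.
  by apply/funext => x; rewrite FE.
split.
- by move=> k; exact: (term_cint_on measurableT cu iG uG k).
- exact: (csum_cint_on measurableT cu iG uG).
- exact: (summable_integrals measurableT cu iG uG).
- exact: (L1_cvg_totally measurableT cu iG uG).
Qed.

Lemma binomial_term_le (x y : R) n k : 0 <= x -> 0 <= y ->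
  (n + k)`!%:R / (n`!%:R * k`!%:R) * (x ^+ n * y ^+ k) <= (x + y) ^+ (n + k).
Proof.
move=> x0 y0; have f0 j : j`!%:R != 0 :> R by rewrite pnatr_eq0 -lt0n fact_gt0.
have kn : (k < (n + k).+1)%N by rewrite ltnS leq_addl.
rewrite exprDn (bigD1 (Ordinal kn)) //= addnK.
have -> : (n + k)`!%:R = 'C(n + k, k)%:R * (n`!%:R * k`!%:R) :> R.
  by rewrite -(bin_fact (leq_addl n k)) addnK 2!natrM; congr (_ * _); exact: mulrC.
rewrite mulfK; last by rewrite mulf_neq0.
rewrite mulr_natl lerDl; apply: sumr_ge0 => j _.
by rewrite mulrn_wge0 // mulr_ge0 // exprn_ge0.
Qed.

Hypothesis Rad_gt0 : forall i, (0 < Rad i)%E.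
Hypothesis M_neq0 : forall theta, polydisc Rad theta -> mgf X theta <> 0.

Let M := mgf X.

Let M_ps (s : 'I_d -> R) : (forall i, 0 < s i) -> (forall i, ((s i)%:E < Rad i)%E) ->
  has_ps M (mgf_coef X) s.
Proof. exact: mgf_has_ps. Qed.

Let aE K z : appell M K z / (mfact K)%:R = appell_coeff M z K.
Proof. exact: (appellE Rad_gt0 M_ps M_neq0). Qed.

Lemma cmeas_appell_coeff K :
  cmeas setT (fun x : d.-tuple R => appell_coeff M (cvec x) K).
Proof.
pose t (p : midx d * midx d) (x : d.-tuple R) : C := if midx_add p.1 p.2 == K
    then mpow (cvec x) p.1 / (mfact p.1)%:R * recip_coef M p.2 else 0.
apply: (@cmeas_cvg _ _ _ _ (fun N x => \sum_(p <- code_below (midx d * midx d)%type N) t p x)).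
  move=> N; apply: cmeas_sum => p; rewrite /t; case: (midx_add p.1 p.2 == K); last exact: cmeas_cst.
  by apply: cmeasM; [apply: cmeasM; [exact: cmeas_mpow|exact: cmeas_cst]|exact: cmeas_cst].
move=> x _; apply: csum_code_below.
exact: (appell_coeff_summable Rad_gt0 M_ps M_neq0 (cvec x) K).
Qed.

(** Since [rho < s], the bound [rho ^ K] on the coefficients and the bound [s ^ - K] on
the Appell polynomials make the series geometric. *)
Lemma appell_series_cvg f (r rho : 'I_d -> R) : entire_exp_type Rad f r -> between r rho Rad ->
  let u := appell_series M (appell_coef M rho f) in
  abs_cvg_compacts u f /\
  abs_cvg_L1 (distribution P X) (fun K x => u K (cvec x)) (fun x => f (cvec x)).
Proof.
move=> [fd r0 rR [c /ltW c0 fc]] rb u.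
have rrho i : r i < rho i by have [] := rb i.
have rhoR i : ((rho i)%:E < Rad i)%E by have [] := rb i.
have rho0 i : 0 < rho i by exact: le_lt_trans (rrho i).
have [s rs sR] := ex_above rhoR.
have s0 i : 0 < s i by exact: lt_trans (rs i).
have [S S0 hS] := appell_coef_le M_ps fd fc c0 r0 rrho rhoR.
have [S' S'0 hS'] := appell_coeff_bound M_ps M_neq0 s0 sR.
have q0 i n : 0 <= (rho i / s i) ^+ n by rewrite exprn_ge0 // divr_ge0 // ltW.
apply: (@abs_cvg_exp_type _ u f s (fun K => S * S' * \prod_i (rho i / s i) ^+ K i)
  (S * S' * \prod_i (1 - rho i / s i)^-1)) => //.
- by move=> i; exact: ltW.
- by move=> K; rewrite !mulr_ge0 // prodr_ge0.
- move=> J; rewrite -mulr_sumr; apply: ler_wpM2l; first exact: mulr_ge0.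
  apply: (midx_sum_prod (g := fun i n => (rho i / s i) ^+ n)) => // i N.
  by apply: geometric_bound; [rewrite divr_ge0 // ltW|rewrite ltr_pdivrMr // mul1r].
- move=> K z; rewrite /u /appell_series aE normcM.
  have sK := prod_exp_gt0 K s0.
  have := hS' z K; rewrite -ler_pdivlMr // => h.
  apply: (le_trans (ler_pM (normc_ge0 _) (normc_ge0 _) (hS K) h)).
  have -> : \prod_i (rho i / s i) ^+ K i = (\prod_i rho i ^+ K i) / \prod_i s i ^+ K i.
    by rewrite -prodfV -big_split; apply: eq_bigr => i _; rewrite expr_div_n.
  by rewrite le_eqVlt; apply/orP; left; apply/eqP; ring.
- move=> K; apply: cmeasM; first exact: cmeas_cst.
  by under eq_fun do rewrite aE; exact: cmeas_appell_coeff.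
- move=> z; rewrite -(appell_expansion Rad_gt0 M_ps M_neq0 fd fc c0 r0 rrho rhoR z).
  by congr (csum _); apply/funext => K; rewrite /u /appell_series aE.
Qed.

Lemma appell_coef_indep f (r rho rho' : 'I_d -> R) : entire_exp_type Rad f r ->
  between r rho Rad -> between r rho' Rad -> appell_coef M rho f = appell_coef M rho' f.
Proof.
move=> [fd r0 rR [c /ltW c0 fc]] rb rb'; apply/funext => K.
rewrite (appell_coef_borel M_ps fd fc c0 r0 (fun i => (rb i).1) (fun i => (rb i).2)).
by rewrite (appell_coef_borel M_ps fd fc c0 r0 (fun i => (rb' i).1) (fun i => (rb' i).2)).
Qed.

Lemma mfact_midx_add_le (rho rho' : 'I_d -> R) (I J : midx d) : (forall i, 0 <= rho i) ->
  (forall i, 0 <= rho' i) ->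
  (mfact (midx_add I J))%:R / ((mfact I)%:R * (mfact J)%:R) *
    ((\prod_i rho i ^+ I i) * \prod_i rho' i ^+ J i) <=
  \prod_i (rho i + rho' i) ^+ (midx_add I J) i.
Proof.
move=> h h'; rewrite /mfact !natr_prod -big_split -prodfV -!big_split /=.
apply: ler_prod => i _; rewrite ffunE binomial_term_le // andbT.
by rewrite !mulr_ge0 ?invr_ge0 ?mulr_ge0 ?exprn_ge0.
Qed.

(** The binomial theorem turns the bounds [rho ^ I] and [rho' ^ J] on the coefficients,
together with the factorials, into [(rho + rho') ^ (I + J)]; the radii may be chosen
with [rho + rho' < Rad] because the coefficients do not depend on them. *)
Lemma wick_series_cvg f g (r rg rho rhog : 'I_d -> R) :
  entire_exp_type Rad f r -> entire_exp_type Rad g rg ->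
  (forall i, ((r i + rg i)%:E < Rad i)%E) ->
  between r rho Rad -> between rg rhog Rad ->
  let a := appell_coef M rho f in let b := appell_coef M rhog g in
  abs_cvg_compacts (wick_series M a b) (wick M a b) /\
  abs_cvg_L1 (distribution P X) (fun IJ x => wick_series M a b IJ (cvec x))
    (fun x => wick M a b (cvec x)).
Proof.
move=> hf hg rrR rb rgb a b.
have [t rt tR] := ex_above rrR.
have [s ts sR] := ex_above tR.
have [fd r0 rR [c /ltW c0 fc]] := hf; have [gd rg0 rgR [c' /ltW c'0 gc]] := hg.
pose w i := (t i - (r i + rg i)) / 2.
have w0 i : 0 < w i by rewrite divr_gt0 // subr_gt0.
pose rho1 i := r i + w i; pose rho2 i := rg i + w i.
have rho12 i : rho1 i + rho2 i = t i by rewrite /rho1 /rho2 /w; field.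
have r1 i : r i < rho1 i by rewrite ltrDl.
have r2 i : rg i < rho2 i by rewrite ltrDl.
have rho10 i : 0 < rho1 i by exact: le_lt_trans (r1 i).
have rho20 i : 0 < rho2 i by exact: le_lt_trans (r2 i).
have t0 i : 0 < t i by rewrite -rho12 addr_gt0.
have s0 i : 0 < s i by exact: lt_trans (ts i).
have R1 i : ((rho1 i)%:E < Rad i)%E.
  by apply: le_lt_trans (tR i); rewrite lee_fin -rho12 lerDl ltW.
have R2 i : ((rho2 i)%:E < Rad i)%E.
  by apply: le_lt_trans (tR i); rewrite lee_fin -rho12 lerDr ltW.
have aE1 : a = appell_coef M rho1 f by apply: (appell_coef_indep hf rb) => i; split.
have bE1 : b = appell_coef M rho2 g by apply: (appell_coef_indep hg rgb) => i; split.
have [S S0 hS] := appell_coef_le M_ps fd fc c0 r0 r1 R1.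
have [S2 S20 hS2] := appell_coef_le M_ps gd gc c'0 rg0 r2 R2.
have [S' S'0 hS'] := appell_coeff_bound M_ps M_neq0 s0 sR.
rewrite -aE1 in hS; rewrite -bE1 in hS2; clear aE1 bE1 hf hg rb rgb; clearbody a b.
have q0 i : 0 <= t i / s i by rewrite divr_ge0 // ltW.
pose q (I : midx d) : R := \prod_i (t i / s i) ^+ I i.
have qq0 I : 0 <= q I by apply: prodr_ge0 => i _; exact: exprn_ge0.
pose Q : R := \prod_i (1 - t i / s i)^-1.
have qQ (J : {fset midx d}) : \sum_(I <- J) q I <= Q.
  apply: (midx_sum_prod (g := fun i n => (t i / s i) ^+ n)) => [i n|i N]; first exact: exprn_ge0.
  by apply: geometric_bound => //; rewrite ltr_pdivrMr // mul1r.
have SS : 0 <= S * S2 * S' by rewrite !mulr_ge0.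
apply: (@abs_cvg_exp_type _ (wick_series M a b) (wick M a b) s
  (fun IJ => S * S2 * S' * (q IJ.1 * q IJ.2)) (S * S2 * S' * (Q * Q))) => //.
- by move=> i; exact: ltW.
- by move=> IJ; rewrite mulr_ge0 // mulr_ge0.
- move=> J; rewrite -mulr_sumr; apply: ler_wpM2l => //.
  apply: (fset_sum_pair (m := fun IJ => q IJ.1 * q IJ.2)) => [p|J1 J2]; first exact: mulr_ge0.
  rewrite [leLHS](_ : _ = (\sum_(I <- J1) q I) * (\sum_(I <- J2) q I)).
    by apply: ler_pM; rewrite ?sumr_ge0.
  by rewrite mulr_suml; apply: eq_bigr => I _; rewrite mulr_sumr.
- move=> [I J] z; rewrite /wick_series /=; set N := midx_add I J.
  have fN : (mfact N)%:R != 0 :> C by exact: mfact_neq0.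
  have -> : appell M N z / ((mfact I)%:R * (mfact J)%:R) =
      (mfact N)%:R / ((mfact I)%:R * (mfact J)%:R) * appell_coeff M z N.
    by rewrite -aE [RHS]mulrC mulrA divfK.
  set k : R := (mfact N)%:R / ((mfact I)%:R * (mfact J)%:R).
  have k0 : 0 <= k by rewrite divr_ge0 // mulr_ge0.
  have kE : normc ((mfact N)%:R / ((mfact I)%:R * (mfact J)%:R) : C) = k.
    by rewrite normcM normcV normcM !normc_nat.
  rewrite normcM (normcM (a I)) (normcM _ (appell_coeff M z N)) kE.
  have sN := prod_exp_gt0 N s0.
  have := hS' z N; rewrite -ler_pdivlMr // => h.
  set e := expR _ in h *.
  have e0 : 0 <= e by exact: expR_ge0.
  have hk := mfact_midx_add_le I J (fun i => ltW (rho10 i)) (fun i => ltW (rho20 i)).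
  rewrite -/N -/k in hk.
  have qN : q I * q J = (\prod_i t i ^+ N i) / \prod_i s i ^+ N i.
    rewrite /q -prod_exp_midx_add -prodfV -big_split; apply: eq_bigr => i _.
    by rewrite expr_div_n.
  have hab := ler_pM (normc_ge0 _) (normc_ge0 _) (hS I) (hS2 J).
  apply: (le_trans (ler_pM _ _ hab (ler_wpM2l k0 h))).
  + by rewrite mulr_ge0 ?normc_ge0.
  + by rewrite mulr_ge0 ?normc_ge0.
  rewrite qN.
  set x1 := \prod_i rho1 i ^+ I i; set x2 := \prod_i rho2 i ^+ J i.
  set x3 := \prod_i s i ^+ N i; set x4 := \prod_i t i ^+ N i.
  rewrite [leLHS](_ : _ = (S * S2 * S' * e / x3) * (k * (x1 * x2))); last by ring.
  rewrite [leRHS](_ : _ = (S * S2 * S' * e / x3) * x4); last by ring.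
  apply: ler_wpM2l; first by rewrite divr_ge0 ?mulr_ge0 // ltW.
  apply: (le_trans hk); rewrite le_eqVlt; apply/orP; left; apply/eqP.
  by apply: eq_bigr => i _; rewrite rho12.
- move=> [I J]; rewrite /wick_series /=.
  apply: cmeasM; first exact: cmeas_cst.
  apply: cmeasM; last exact: cmeas_cst.
  rewrite (_ : (fun x => _) = (fun x : d.-tuple R =>
    (mfact (midx_add I J))%:R * appell_coeff M (cvec x) (midx_add I J))).
    by apply: cmeasM; [exact: cmeas_cst|exact: cmeas_appell_coeff].
  by apply/funext => x; rewrite -aE mulrC divfK // mfact_neq0.
Qed.

End AppellSeries.

Local Close Scope complex_scope.

Theorem theorem2p1 (R : realType) (d : nat) (disp : measure_display)
    (T : measurableType disp) (P : probability T R)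
    (X : {RV P >-> d.-tuple R}) (Rad : 'I_d -> \bar R)
    (Rad_gt0 : forall i, (0 < Rad i)%E)
    (M_defined : mgf_defined X Rad)
    (M_neq0 : forall theta, polydisc Rad theta -> mgf X theta <> 0)
    (f : 'rV[R[i]]_d -> R[i]) (r : 'I_d -> R)
    (f_type : entire_exp_type Rad f r) :
  let M := mgf X in
  let mu := distribution P X in
  [/\ (forall theta, polyexterior r theta ->
         abs_summable (borel_term f theta) /\ differentiable (borel f) theta),
      (forall rho rho', between r rho Rad -> between r rho' Rad ->
         forall K, appell_coef M rho f K = appell_coef M rho' f K),
      (forall rho, between r rho Rad ->
         let u := appell_series M (appell_coef M rho f) in
         abs_cvg_compacts u f /\
         abs_cvg_L1 mu (fun K x => u K (cvec x)) (fun x => f (cvec x))) &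
      (forall (g : 'rV[R[i]]_d -> R[i]) (rg : 'I_d -> R),
         entire_exp_type Rad g rg ->
         (forall i, ((r i + rg i)%:E < Rad i)%E) ->
         forall rho rhog, between r rho Rad -> between rg rhog Rad ->
         let a := appell_coef M rho f in
         let b := appell_coef M rhog g in
         abs_cvg_compacts (wick_series M a b) (wick M a b) /\
         abs_cvg_L1 mu (fun IJ x => wick_series M a b IJ (cvec x))
                       (fun x => wick M a b (cvec x)))].
Proof.
have [fd r0 rR [c /ltW c0 fc]] := f_type.
split.
- by move=> th rth; exact: borel_differentiable fd fc c0 r0 rth.
- by move=> rho rho' h h' K; rewrite (appell_coef_indep M_defined f_type h h').
- by move=> rho h; exact: (appell_series_cvg M_defined Rad_gt0 M_neq0 f_type h).
- move=> g rg g_type rrR rho rhog h hg.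
  exact: (wick_series_cvg M_defined Rad_gt0 M_neq0 f_type g_type rrR h hg).
Qed.
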